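(* For every integer $c \geq 1$, the property $\mathsf{CI}_{\leq c}$ of Noetherian local rings does not satisfy the Nagata criterion (NC).
   Context: All rings are commutative with identity. A Noetherian local ring $(A,\mathfrak m,k)$ is a complete intersection if its completion satisfies $\widehat{A} \cong R/(f_1,\ldots,f_r)$ for some regular local ring $R$ and some regular sequence $f_1,\ldots,f_r$ in $R$ ($r \ge 0$). Its embedding dimension is $\operatorname{edim}(A)=\dim_k(\mathfrak m/\mathfrak m^2)$ and its codimension is $\operatorname{codim}(A)=\operatorname{edim}(A)-\dim(A)$. For an integer $c\ge 0$, $A$ satisfies $\mathsf{CI}_{\leq c}$ if $A$ is a complete intersection and $\operatorname{codim}(A)\le c$. For a property $\mathbb P$ of Noetherian local rings and a Noetherian ring $A$, put $\mathbb P(A)=\{\mathfrak p\in\operatorname{Spec}(A)\mid A_{\mathfrak p}\text{ satisfies }\mathbb P\}$. The property $\mathbb P$ satisfies the Nagata criterion (NC) if for every Noetherian ring $A$ the following holds: if $\mathbb P(A/\mathfrak p)$ contains a nonempty open subset of $\operatorname{Spec}(A/\mathfrak p)$ for every $\mathfrak p\in\operatorname{Spec}(A)$, then $\mathbb P(A)$ is an open subset of $\operatorname{Spec}(A)$. *)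

(* Defs.v *)
From HB Require Import structures.
From mathcomp Require Import all_boot all_order all_algebra.
From mathcomp Require Import generic_quotient ring_quotient.
From mathcomp Require Import boolp classical_sets topology.
From mathcomp Require Import ring.

Set Implicit Arguments.
Unset Strict Implicit.
Unset Printing Implicit Defensive.

Import GRing.Theory.

Local Open Scope classical_set_scope.
Local Open Scope quotient_scope.
Local Open Scope ring_scope.

(* Rings are [comPzRingType]s, so that the zero ring is allowed, e.g. as the
   quotient by a non-proper ideal.  (The ideals of mathcomp's ring_quotient
   are proper and live in nonzero rings.) *)

Identity Coercion set_fun : set >-> Funclass.

Section Ideals.
Variable A : comPzRingType.

Definition is_ideal (I : set A) : Prop :=
  [/\ I 0, forall x y, I x -> I y -> I (x + y) & forall a x, I x -> I (a * x)].

Record ideal := Ideal { ideal_set :> set A; idealP : is_ideal ideal_set }.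

Lemma ideal_gen_subproof (S : set A) :
  is_ideal [set x | forall J : ideal, S `<=` J -> J x].
Proof.
split=> [J _|x y Ix Iy J SJ|a x Ix J SJ]; case: (idealP J) => // *; eauto.
Qed.

Definition ideal_gen (S : set A) : ideal := Ideal (ideal_gen_subproof S).

Definition ideal_mul (I J : ideal) : ideal :=
  ideal_gen [set z | exists x y, [/\ I x, J y & z = x * y]].

Definition ideal_exp (I : ideal) (n : nat) : ideal :=
  iter n (ideal_mul I) (ideal_gen setT).

Definition noetherian : Prop :=
  forall I : ideal, exists s : seq A, I = ideal_gen [set` s] :> set A.

Definition maximal_ideal (m : ideal) : Prop :=
  ~ m 1 /\ forall J : ideal, m `<=` J -> ~ J 1 -> J `<=` m.

Definition local_with (m : ideal) : Prop :=
  maximal_ideal m /\ forall n : ideal, maximal_ideal n -> n = m :> set A.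

Definition is_prime (p : ideal) : Prop :=
  ~ p 1 /\ forall x y, p (x * y) -> p x \/ p y.

Record Spec := PrimeIdeal { prime_ideal :> ideal; primeP : is_prime prime_ideal }.

Definition has_prime_chain (n : nat) : Prop :=
  exists p : 'I_n.+1 -> Spec, forall i j : 'I_n.+1, (i < j)%N -> p i `<` p j.

Definition has_krull_dim (d : nat) : Prop :=
  has_prime_chain d /\ forall n, has_prime_chain n -> (n <= d)%N.

Definition regular_sequence (s : seq A) : Prop :=
  ~ ideal_gen [set` s] 1 /\
  forall i : nat, (i < size s)%N -> forall x : A,
    ideal_gen [set` take i s] (nth 0 s i * x) -> ideal_gen [set` take i s] x.

End Ideals.

Section Zariski.
Variable A : comPzRingType.

HB.instance Definition _ := gen_eqMixin (Spec A).
HB.instance Definition _ := gen_choiceMixin (Spec A).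

Definition zariski_closed (E : set A) : set (Spec A) := [set p | E `<=` p].

Definition zariski_open (U : set (Spec A)) : Prop :=
  exists E : set A, U = ~` zariski_closed E.

Lemma zariski_openT : zariski_open setT.
Proof.
by exists setT; apply/seteqP; split=> // p _ /(_ 1 I); case: (primeP p).
Qed.

Lemma zariski_openI : setI_closed zariski_open.
Proof.
move=> _ _ [E ->] [F ->].
exists [set z | exists x y, [/\ E x, F y & z = x * y]].
apply/seteqP; split=> p /=.
  move=> [/existsNP[x /not_implyP[Ex px]] /existsNP[y /not_implyP[Fy py]]] EFp.
  have [_ /(_ x y)[]//] := primeP p.
  by apply: EFp; exists x, y.
move=> /existsNP[_ /not_implyP[[x [y [Ex Fy ->]]] pxy]].
have [_ _ pM] := idealP p.
by split=> [/(_ x Ex)|/(_ y Fy)] H; apply: pxy; [rewrite mulrC|]; exact: pM.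
Qed.

Lemma zariski_open_bigU (I : Type) (U : I -> set (Spec A)) :
  (forall i, zariski_open (U i)) -> zariski_open (\bigcup_i U i).
Proof.
move=> openU; exists [set x | exists i, forall p, ~ U i p -> p x].
apply/seteqP; split=> p /=.
  move=> [i _ Uip] Ep; have [E UE] := openU i.
  move: (Uip); rewrite UE; apply=> x Ex; apply: Ep; exists i => q.
  by rewrite UE => /contrapT; exact.
move=> /existsNP[x /not_implyP[[i Uix] px]]; exists i => //.
by apply/not_notP => /Uix.
Qed.

HB.instance Definition _ := isOpenTopological.Build (Spec A)
  zariski_openT zariski_openI zariski_open_bigU.

End Zariski.

Section QuotientRing.
Variables (A : comPzRingType) (I : ideal A).

Definition ideal_pred : {pred A} := fun x => `[< I x >].

Lemma ideal_pred_zmod_closed : zmod_closed ideal_pred.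
Proof.
have [I0 ID IM] := idealP I; split=> [|x y]; first exact/asboolP.
by move=> /asboolP Ix /asboolP Iy; apply/asboolP/ID; rewrite // -mulN1r; exact: IM.
Qed.

HB.instance Definition _ :=
  GRing.isZmodClosed.Build A ideal_pred ideal_pred_zmod_closed.

Definition quot_ring : Type := Quotient.quot ideal_pred.

HB.instance Definition _ := GRing.Zmodule.on quot_ring.
HB.instance Definition _ := EqQuotient.on quot_ring.

Definition quot_pi (x : A) : quot_ring := \pi_quot_ring x.

Lemma quot_piP x y : quot_pi x = quot_pi y <-> I (x - y).
Proof.
split=> [/eqP|Ixy]; first by rewrite -Quotient.idealrBE => /asboolP.
by apply/eqP; rewrite -Quotient.idealrBE; apply/asboolP.
Qed.

Lemma quot_pi_repr (x : quot_ring) : quot_pi (repr x) = x.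
Proof. exact: reprK. Qed.

Lemma quot_piB : {morph quot_pi : x y / x - y >-> x - y}.
Proof. by move=> x y; rewrite /quot_pi raddfB. Qed.

HB.instance Definition _ := GRing.isZmodMorphism.Build A quot_ring quot_pi quot_piB.

Definition quot_one : quot_ring := quot_pi 1.
Definition quot_mul (x y : quot_ring) : quot_ring := quot_pi (repr x * repr y).

Lemma quot_mulE x y : quot_mul (quot_pi x) (quot_pi y) = quot_pi (x * y).
Proof.
have [_ ID IM] := idealP I; apply/quot_piP.
set x' := repr _; set y' := repr _.
have Hx : I (x' - x) by apply/quot_piP; rewrite quot_pi_repr.
have Hy : I (y' - y) by apply/quot_piP; rewrite quot_pi_repr.
have -> : x' * y' - x * y = y' * (x' - x) + x * (y' - y) by ring.
by apply: ID; exact: IM.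
Qed.

Lemma quot_mulA : associative quot_mul.
Proof.
move=> x y z; rewrite -[x]quot_pi_repr -[y]quot_pi_repr -[z]quot_pi_repr.
by rewrite !quot_mulE mulrA.
Qed.

Lemma quot_mulC : commutative quot_mul.
Proof. by move=> x y; rewrite /quot_mul mulrC. Qed.

Lemma quot_mul1 : left_id quot_one quot_mul.
Proof. by move=> x; rewrite -[x]quot_pi_repr quot_mulE mul1r. Qed.

Lemma quot_mulDl : left_distributive quot_mul +%R.
Proof.
move=> x y z; rewrite -[x]quot_pi_repr -[y]quot_pi_repr -[z]quot_pi_repr.
by rewrite -raddfD !quot_mulE -raddfD -mulrDl.
Qed.

HB.instance Definition _ := GRing.Zmodule_isComPzRing.Build quot_ring
  quot_mulA quot_mulC quot_mul1 quot_mulDl.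

Lemma quot_pi_monoid_morphism : monoid_morphism quot_pi.
Proof. by split=> // x y; rewrite -quot_mulE. Qed.

HB.instance Definition _ :=
  GRing.isMonoidMorphism.Build A quot_ring quot_pi quot_pi_monoid_morphism.

End QuotientRing.

(* The cotangent space m/m^2 as a module over A/m; [m] is any ideal. *)
Section Cotangent.
Variables (A : comPzRingType) (m : ideal A).

Record ideal_elt := IdealElt { elt_val : A; _ : elt_val \in ideal_pred m }.

HB.instance Definition _ := [isSub for elt_val].
HB.instance Definition _ := [Choice of ideal_elt by <:].
HB.instance Definition _ := [SubChoice_isSubZmodule of ideal_elt by <:].

Lemma elt_valP (x : ideal_elt) : m (elt_val x).
Proof. by case: x => x /= mx; apply/asboolP. Qed.

Definition elt_square : {pred ideal_elt} :=
  fun x => `[< ideal_exp m 2 (elt_val x) >].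

Lemma elt_square_zmod_closed : zmod_closed elt_square.
Proof.
have [I0 ID IM] := idealP (ideal_exp m 2); split=> [|x y]; first exact/asboolP.
move=> /asboolP Ix /asboolP Iy; apply/asboolP.
rewrite -[elt_val _]/(\val (x - y)) raddfB; apply: ID => //.
by rewrite -mulN1r; exact: IM.
Qed.

HB.instance Definition _ :=
  GRing.isZmodClosed.Build ideal_elt elt_square elt_square_zmod_closed.

Definition cotangent : Type := Quotient.quot elt_square.

HB.instance Definition _ := GRing.Zmodule.on cotangent.
HB.instance Definition _ := EqQuotient.on cotangent.

Definition cot_pi (x : ideal_elt) : cotangent := \pi_cotangent x.

Lemma cot_piP x y : cot_pi x = cot_pi y <-> ideal_exp m 2 (elt_val x - elt_val y).
Proof.
split=> [/eqP|Ixy]; first by rewrite -Quotient.idealrBE => /asboolP.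
by apply/eqP; rewrite -Quotient.idealrBE; apply/asboolP.
Qed.

Lemma cot_pi_repr (x : cotangent) : cot_pi (repr x) = x.
Proof. exact: reprK. Qed.

Lemma cot_piD : {morph cot_pi : x y / x + y}.
Proof. by move=> x y; rewrite /cot_pi raddfD. Qed.

Lemma elt_scale_subproof (a : A) (x : ideal_elt) : a * elt_val x \in ideal_pred m.
Proof. by have [_ _ mM] := idealP m; apply/asboolP/mM/elt_valP. Qed.

Definition elt_scale (a : A) (x : ideal_elt) : ideal_elt :=
  IdealElt (elt_scale_subproof a x).

Definition cot_scale (a : quot_ring m) (x : cotangent) : cotangent :=
  cot_pi (elt_scale (repr a) (repr x)).

Lemma cot_scaleE a x : cot_scale (quot_pi m a) (cot_pi x) = cot_pi (elt_scale a x).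
Proof.
have [_ ID IM] := idealP (ideal_exp m 2); apply/cot_piP => /=.
set a' := repr _; set x' := repr _.
have Ha : m (a' - a) by apply/quot_piP; rewrite quot_pi_repr.
have Hx : ideal_exp m 2 (elt_val x' - elt_val x).
  by apply/cot_piP; rewrite cot_pi_repr.
have -> : a' * elt_val x' - a * elt_val x =
    (a' - a) * elt_val x + a' * (elt_val x' - elt_val x) by ring.
apply: ID; last exact: IM.
move=> J; apply; exists (elt_val x), (a' - a); split; [exact: elt_valP| |exact: mulrC].
move=> K; apply.
exists (a' - a), 1; split; [by []| |by rewrite mulr1].
by move=> L /(_ 1 I).
Qed.

Lemma cot_scaleA a b x : cot_scale a (cot_scale b x) = cot_scale (a * b) x.
Proof.
rewrite -[a]quot_pi_repr -[b]quot_pi_repr -[x]cot_pi_repr -rmorphM !cot_scaleE.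
by congr cot_pi; apply: val_inj; rewrite /= mulrA.
Qed.

Lemma cot_scale1 : left_id 1 cot_scale.
Proof.
move=> x; rewrite -[x]cot_pi_repr -(rmorph1 (quot_pi m)) cot_scaleE.
by congr cot_pi; apply: val_inj; rewrite /= mul1r.
Qed.

Lemma cot_scaleDr : right_distributive cot_scale +%R.
Proof.
move=> a x y; rewrite -[a]quot_pi_repr -[x]cot_pi_repr -[y]cot_pi_repr.
rewrite -cot_piD !cot_scaleE -cot_piD.
by congr cot_pi; apply: val_inj; rewrite /= mulrDr.
Qed.

Lemma cot_scaleDl x : {morph cot_scale^~ x : a b / a + b}.
Proof.
move=> a b; rewrite -[a]quot_pi_repr -[b]quot_pi_repr -[x]cot_pi_repr.
rewrite -rmorphD !cot_scaleE -cot_piD.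
by congr cot_pi; apply: val_inj; rewrite /= mulrDl.
Qed.

HB.instance Definition _ := GRing.Zmodule_isLmodule.Build (quot_ring m) cotangent
  cot_scaleA cot_scale1 cot_scaleDr cot_scaleDl.

(* dim_k m/m^2 = n, for k = A/m; the linear isomorphism is that of [Vector.axiom]. *)
Definition has_edim (n : nat) : Prop :=
  exists f : {linear 'rV[quot_ring m]_n -> cotangent}, bijective f.

End Cotangent.

Section Localization.
Variables (A : comPzRingType) (p : Spec A).

Record fraction := Fraction {
  numer : A; denom : A; denomP : ~ p denom }.

HB.instance Definition _ := gen_eqMixin fraction.
HB.instance Definition _ := gen_choiceMixin fraction.

Definition eq_fraction (x y : fraction) : bool :=
  `[< exists u : A, ~ p u /\
        u * (numer x * denom y) = u * (numer y * denom x) >].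

Lemma compl_prime_mul (x y : A) :
  ~ p x -> ~ p y -> ~ p (x * y).
Proof. by have [_ pM] := primeP p; move=> px py /pM[]. Qed.

Lemma compl_prime1 : ~ p 1.
Proof. by case: (primeP p). Qed.

Lemma eq_fraction_refl : reflexive eq_fraction.
Proof. by move=> x; apply/asboolP; exists 1; split=> //; exact: compl_prime1. Qed.

Lemma eq_fraction_sym : symmetric eq_fraction.
Proof. by move=> x y; apply/asboolP/asboolP => -[u [pu e]]; exists u. Qed.

Lemma eq_fraction_trans : transitive eq_fraction.
Proof.
move=> y x z /asboolP[u [pu exy]] /asboolP[v [pv eyz]]; apply/asboolP.
exists (u * v * denom y); split.
  by do 2?[apply: compl_prime_mul => //]; exact: denomP.
have -> : u * v * denom y * (numer x * denom z) =
  v * denom z * (u * (numer x * denom y)) by ring.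
rewrite exy.
have -> : v * denom z * (u * (numer y * denom x)) =
  u * denom x * (v * (numer y * denom z)) by ring.
by rewrite eyz; ring.
Qed.

Canonical eq_fraction_equiv :=
  EquivRel eq_fraction eq_fraction_refl eq_fraction_sym eq_fraction_trans.

Definition localization : Type := {eq_quot eq_fraction}.

HB.instance Definition _ := Choice.on localization.
HB.instance Definition _ : EqQuotient _ eq_fraction localization :=
  EqQuotient.on localization.

Definition loc_pi (x : fraction) : localization := \pi_localization x.

Lemma loc_piP x y : loc_pi x = loc_pi y <-> exists u : A, ~ p u /\
  u * (numer x * denom y) = u * (numer y * denom x).
Proof. by split=> [/eqmodP/asboolP|H] //; apply/eqmodP/asboolP. Qed.

Lemma loc_pi_repr (x : localization) : loc_pi (repr x) = x.
Proof. exact: reprK. Qed.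

Definition loc_frac (x : fraction) : fraction := repr (loc_pi x).

Lemma loc_fracP x : exists u : A, ~ p u /\
  u * (numer (loc_frac x) * denom x) = u * (numer x * denom (loc_frac x)).
Proof. by apply/loc_piP; rewrite loc_pi_repr. Qed.

Definition frac_add (x y : fraction) : fraction :=
  Fraction (numer x * denom y + numer y * denom x)
    (compl_prime_mul (@denomP x) (@denomP y)).
Definition frac_mul (x y : fraction) : fraction :=
  Fraction (numer x * numer y)
    (compl_prime_mul (@denomP x) (@denomP y)).
Definition frac_opp (x : fraction) : fraction :=
  Fraction (- numer x) (@denomP x).
Definition frac_of (a : A) : fraction := Fraction (a) compl_prime1.

Definition loc_add (x y : localization) := loc_pi (frac_add (repr x) (repr y)).
Definition loc_mul (x y : localization) := loc_pi (frac_mul (repr x) (repr y)).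
Definition loc_opp (x : localization) := loc_pi (frac_opp (repr x)).

Lemma loc_addE x y : loc_add (loc_pi x) (loc_pi y) = loc_pi (frac_add x y).
Proof.
have [u [pu eu]] := loc_fracP x; have [v [pv ev]] := loc_fracP y.
apply/loc_piP; exists (u * v); split; first exact: compl_prime_mul.
move: eu ev; rewrite -/(loc_frac x) -/(loc_frac y) /=.
move: (loc_frac x) (loc_frac y) => [a s ?] [b t ?] /=.
case: x y => [c q ?] [d r ?] /= eu ev.
have -> : u * v * ((a * t + b * s) * (q * r)) =
  v * t * r * (u * (a * q)) + u * s * q * (v * (b * r)) by ring.
by rewrite eu ev; ring.
Qed.

Lemma loc_mulE x y : loc_mul (loc_pi x) (loc_pi y) = loc_pi (frac_mul x y).
Proof.
have [u [pu eu]] := loc_fracP x; have [v [pv ev]] := loc_fracP y.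
apply/loc_piP; exists (u * v); split; first exact: compl_prime_mul.
move: eu ev; rewrite -/(loc_frac x) -/(loc_frac y) /=.
move: (loc_frac x) (loc_frac y) => [a s ?] [b t ?] /=.
case: x y => [c q ?] [d r ?] /= eu ev.
have -> : u * v * (a * b * (q * r)) = (u * (a * q)) * (v * (b * r)) by ring.
by rewrite eu ev; ring.
Qed.

Lemma loc_oppE x : loc_opp (loc_pi x) = loc_pi (frac_opp x).
Proof.
have [u [pu eu]] := loc_fracP x.
by apply/loc_piP; exists u; split=> //=; rewrite !mulNr !mulrN; congr (- _).
Qed.

Lemma loc_pi_eq x y :
  numer x * denom y = numer y * denom x -> loc_pi x = loc_pi y.
Proof.
by move=> e; apply/loc_piP; exists 1; rewrite e; split=> //; exact: compl_prime1.
Qed.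

Lemma loc_addA : associative loc_add.
Proof.
move=> x y z; rewrite -[x]loc_pi_repr -[y]loc_pi_repr -[z]loc_pi_repr.
by rewrite !loc_addE; apply: loc_pi_eq => /=; ring.
Qed.

Lemma loc_addC : commutative loc_add.
Proof. by move=> x y; apply: loc_pi_eq => /=; ring. Qed.

Lemma loc_add0 : left_id (loc_pi (frac_of 0)) loc_add.
Proof.
by move=> x; rewrite -[x]loc_pi_repr loc_addE; apply: loc_pi_eq => /=; ring.
Qed.

Lemma loc_addN : left_inverse (loc_pi (frac_of 0)) loc_opp loc_add.
Proof.
move=> x; rewrite -[x]loc_pi_repr loc_oppE loc_addE.
by apply: loc_pi_eq => /=; ring.
Qed.

HB.instance Definition _ :=
  GRing.isZmodule.Build localization loc_addA loc_addC loc_add0 loc_addN.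

Lemma loc_mulA : associative loc_mul.
Proof.
move=> x y z; rewrite -[x]loc_pi_repr -[y]loc_pi_repr -[z]loc_pi_repr.
by rewrite !loc_mulE; apply: loc_pi_eq => /=; ring.
Qed.

Lemma loc_mulC : commutative loc_mul.
Proof. by move=> x y; apply: loc_pi_eq => /=; ring. Qed.

Lemma loc_mul1 : left_id (loc_pi (frac_of 1)) loc_mul.
Proof.
by move=> x; rewrite -[x]loc_pi_repr loc_mulE; apply: loc_pi_eq => /=; ring.
Qed.

Lemma loc_mulDl : left_distributive loc_mul loc_add.
Proof.
move=> x y z; rewrite -[x]loc_pi_repr -[y]loc_pi_repr -[z]loc_pi_repr.
by rewrite !(loc_mulE, loc_addE); apply: loc_pi_eq => /=; ring.
Qed.

HB.instance Definition _ := GRing.Zmodule_isComPzRing.Build localization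
  loc_mulA loc_mulC loc_mul1 loc_mulDl.

End Localization.

(* The I-adic completion, as the inverse limit of the rings A/I^n. *)
Section Completion.
Variables (A : comPzRingType) (I : ideal A).

Definition compatible (x : forall n, quot_ring (ideal_exp I n)) : Prop :=
  forall n (a : A), x n.+1 = quot_pi _ a -> x n = quot_pi _ a.

Record completion := Completion {
  coord :> forall n, quot_ring (ideal_exp I n);
  coordP : compatible coord }.

HB.instance Definition _ := gen_eqMixin completion.
HB.instance Definition _ := gen_choiceMixin completion.

Lemma completion_eq (x y : completion) : (forall n, x n = y n) -> x = y.
Proof.
case: x y => [x Px] [y Py] /= e.
have exy : x = y by exact: functional_extensionality_dep.
by case: _ / exy {e} Py => Py; congr Completion; exact: Prop_irrelevance.
Qed.

Lemma compatibleP (x : forall n, quot_ring (ideal_exp I n)) :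
  (forall n, exists a, x n.+1 = quot_pi _ a /\ x n = quot_pi _ a) -> compatible x.
Proof.
move=> H n b e; have [a [ea ->]] := H n; apply/quot_piP.
have /quot_piP : quot_pi (ideal_exp I n.+1) a = quot_pi (ideal_exp I n.+1) b.
  by rewrite -ea.
move=> /(_ (ideal_exp I n)); apply=> _ [u [v [_ Iv ->]]].
by have [_ _] := idealP (ideal_exp I n); exact.
Qed.

Lemma completion_lift (x : completion) n :
  exists a, x n.+1 = quot_pi _ a /\ x n = quot_pi _ a.
Proof.
exists (repr (x n.+1)); rewrite quot_pi_repr; split=> //.
by apply: coordP; rewrite quot_pi_repr.
Qed.

Lemma compatible_of (a : A) : compatible (fun n => quot_pi _ a).
Proof. by apply: compatibleP => n; exists a. Qed.

Lemma compatible_add (x y : completion) : compatible (fun n => x n + y n).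
Proof.
apply: compatibleP => n.
have [a [-> ->]] := completion_lift x n; have [b [-> ->]] := completion_lift y n.
by exists (a + b); rewrite !rmorphD.
Qed.

Lemma compatible_mul (x y : completion) : compatible (fun n => x n * y n).
Proof.
apply: compatibleP => n.
have [a [-> ->]] := completion_lift x n; have [b [-> ->]] := completion_lift y n.
by exists (a * b); rewrite !rmorphM.
Qed.

Lemma compatible_opp (x : completion) : compatible (fun n => - x n).
Proof.
apply: compatibleP => n; have [a [-> ->]] := completion_lift x n.
by exists (- a); rewrite !rmorphN.
Qed.

Definition to_completion (a : A) := Completion (@compatible_of a).
Definition comp_add (x y : completion) := Completion (@compatible_add x y).
Definition comp_mul (x y : completion) := Completion (@compatible_mul x y).
Definition comp_opp (x : completion) := Completion (@compatible_opp x).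

Lemma comp_addA : associative comp_add.
Proof. by move=> x y z; apply: completion_eq => n /=; rewrite addrA. Qed.
Lemma comp_addC : commutative comp_add.
Proof. by move=> x y; apply: completion_eq => n /=; rewrite addrC. Qed.
Lemma comp_add0 : left_id (to_completion 0) comp_add.
Proof. by move=> x; apply: completion_eq => n /=; rewrite rmorph0 add0r. Qed.
Lemma comp_addN : left_inverse (to_completion 0) comp_opp comp_add.
Proof. by move=> x; apply: completion_eq => n /=; rewrite rmorph0 addNr. Qed.

HB.instance Definition _ :=
  GRing.isZmodule.Build completion comp_addA comp_addC comp_add0 comp_addN.

Lemma comp_mulA : associative comp_mul.
Proof. by move=> x y z; apply: completion_eq => n /=; rewrite mulrA. Qed.
Lemma comp_mulC : commutative comp_mul.
Proof. by move=> x y; apply: completion_eq => n /=; rewrite mulrC. Qed.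
Lemma comp_mul1 : left_id (to_completion 1) comp_mul.
Proof. by move=> x; apply: completion_eq => n /=; rewrite rmorph1 mul1r. Qed.
Lemma comp_mulDl : left_distributive comp_mul comp_add.
Proof. by move=> x y z; apply: completion_eq => n /=; rewrite mulrDl. Qed.

HB.instance Definition _ := GRing.Zmodule_isComPzRing.Build completion
  comp_mulA comp_mulC comp_mul1 comp_mulDl.

End Completion.

Definition ring_iso (A B : comPzRingType) : Prop :=
  exists f : {rmorphism A -> B}, bijective f.

Definition regular_local (R : comPzRingType) : Prop :=
  noetherian R /\ exists (m : ideal R) (d : nat),
    [/\ local_with m, has_edim m d & has_krull_dim R d].

Definition noetherian_local (A : comPzRingType) (m : ideal A) : Prop :=
  noetherian A /\ local_with m.

Definition complete_intersection (A : comPzRingType) (m : ideal A) : Prop :=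
  exists (R : comPzRingType) (f : seq R),
    [/\ regular_local R, regular_sequence f &
        ring_iso (completion m) (quot_ring (ideal_gen [set` f]))].

(* codim A = edim A - dim A; both terms are finite and edim A >= dim A when
   (A, m) is a Noetherian local ring. *)
Definition has_codim (A : comPzRingType) (m : ideal A) (k : nat) : Prop :=
  exists e d : nat, [/\ has_edim m e, has_krull_dim A d & e = (d + k)%N].

(* The local rings of this file carry no chosen maximal ideal: [m] is unique. *)
Definition CI_le (c : nat) (A : comPzRingType) : Prop :=
  exists m : ideal A, [/\ noetherian_local m, complete_intersection m &
    exists2 k, has_codim m k & (k <= c)%N].

Definition locus (P : comPzRingType -> Prop) (A : comPzRingType) :
    set (Spec A) :=
  [set p | P (localization p)].

Arguments locus P A : clear implicits.

Definition nagata_criterion (P : comPzRingType -> Prop) : Prop :=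
  forall A : comPzRingType, noetherian A ->
    (forall p : Spec A, exists U : set (Spec (quot_ring p)),
        [/\ open U, U !=set0 & U `<=` locus P (quot_ring p)]) ->
    open (locus P A).

(* Main.v *)
Require Import Defs.
From HB Require Import structures.
From mathcomp Require Import all_boot all_order all_algebra all_field.
From mathcomp Require Import generic_quotient.
From mathcomp Require Import boolp classical_sets topology.
From mathcomp Require Import ring.

(* The counterexample is one-dimensional.  Let K = Q(sqrt 2, sqrt 3, sqrt 5, ...)
   and let s_i be the involution of K that changes the sign of the square root
   t_i of the i-th prime only, so that every element of K is fixed by almost
   all s_i.  Let E be the ring of the f in K[X] such that f(i) is fixed by s_i
   for every natural number i.  Then E is a Noetherian domain of dimension one.
   At the maximal ideal m_i = {f | f(i) = 0} it is a quadratic extension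
   W[y]/(y^2 - t_i^2 u^2) of the subring W of the elements fixed by s_i, where
   u = X - i generates a maximal ideal of W; so E_{m_i} is a hypersurface of
   codimension one, singular for every i, while E is regular at every other
   prime.

   Put A = E[e_1, ..., e_c]/(e_1^2, ..., e_c^2).  Every A/p is either a field or
   isomorphic to E, hence satisfies CI_{<= c} at all its primes.  At its minimal
   prime A is a complete intersection of codimension c, but at the infinitely
   many maximal ideals over the m_i it has codimension at least c + 1.  Since a
   nonzero element of E lies in finitely many m_i, the locus is not open. *)

Set Implicit Arguments.
Unset Strict Implicit.
Unset Printing Implicit Defensive.

Import GRing.Theory Num.Theory.

Local Open Scope classical_set_scope.
Local Open Scope quotient_scope.
Local Open Scope ring_scope.

Arguments ideal_mul : simpl never.
Arguments ideal_exp : simpl never.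

(** A singular point of E has codimension only one, so for [1 <= c] it is invisible in the quotients
    A/p, which see E without its nilpotent thickening. The dual numbers raise every codimension by
    c: the generic point then sits exactly on the bound and each m_i crosses it. Two demands on E
    compete: infinitely many conditions, so that every nonempty open set meets the singular points,
    and Noetherianity. They are reconciled because every element of K is fixed by almost all s_i: a
    polynomial violates finitely many conditions, and a factor vanishing at those integers brings it
    into E. Away from the m_i, E thus looks like K[X] modulo a suitable norm, and Cohen's theorem
    leaves only the primes to be shown finitely generated. Completions are computed in three cases:
    an Artinian local ring is its own completion, a principal maximal ideal gives a discrete
    valuation ring, and the quadratic extension gives a quadratic extension of the latter. To leave
    the locus at a point over m_i, it is enough to bound the embedding dimension below by c + 2 and
    the dimension above by 1. *)

Lemma sub_gen (A : comPzRingType) (S : set A) : S `<=` ideal_gen S.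
Proof. by move=> x Sx J; exact. Qed.

Lemma gen_min (A : comPzRingType) (S : set A) (J : ideal A) :
  S `<=` J -> ideal_gen S `<=` J.
Proof. by move=> SJ x; exact. Qed.

Opaque ideal_gen.

(** * Ideals, maximality in Noetherian rings, and Nakayama's lemma *)

Section IdealTheory.
Variable A : comPzRingType.
Implicit Types (I J : ideal A) (x y a : A) (s : seq A).

Lemma ideal0 I : I 0. Proof. by case: (idealP I). Qed.
Lemma idealD I x y : I x -> I y -> I (x + y).
Proof. by case: (idealP I) => _ + _; apply. Qed.
Lemma idealMl I a x : I x -> I (a * x).
Proof. by case: (idealP I) => _ _; apply. Qed.
Lemma idealMr I x a : I x -> I (x * a).
Proof. by rewrite mulrC; exact: idealMl. Qed.
Lemma idealN I x : I x -> I (- x).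
Proof. by rewrite -mulN1r; exact: idealMl. Qed.
Lemma idealB I x y : I x -> I y -> I (x - y).
Proof. by move=> Ix /idealN; exact: idealD. Qed.
Lemma idealBr I x y : I y -> I (x - y) -> I x.
Proof. by move=> Iy /(idealD Iy); rewrite addrC subrK. Qed.
Lemma ideal1 I x : I 1 -> I x.
Proof. by move=> /(idealMl x); rewrite mulr1. Qed.
Lemma ideal_sum I (T : Type) (r : seq T) (F : T -> A) :
  (forall i, I (F i)) -> I (\sum_(i <- r) F i).
Proof.
by move=> IF; elim/big_ind: _ => //; [exact: ideal0|move=> *; exact: idealD].
Qed.

Lemma gen_nilP x : ideal_gen [set` [::] : seq A] x <-> x = 0.
Proof.
split=> [|-> ]; last exact: ideal0.
have I0 : is_ideal [set 0 : A].
  by split=> // [a b -> ->|a b ->]; rewrite ?addr0 ?mulr0.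
by apply: (gen_min (J := Ideal I0)) => y.
Qed.

Lemma gen_consP g s x : ideal_gen [set` g :: s] x <->
  exists a y, ideal_gen [set` s] y /\ x = a * g + y.
Proof.
have IP : is_ideal [set x | exists a y, ideal_gen [set` s] y /\ x = a * g + y].
  split=> [|x1 x2 [a1 [y1 [i1 ->]]] [a2 [y2 [i2 ->]]]|b x1 [a1 [y1 [i1 ->]]]].
  - by exists 0, 0; split; [exact: ideal0|rewrite mul0r addr0].
  - by exists (a1 + a2), (y1 + y2); split; [exact: idealD|ring].
  - by exists (b * a1), (b * y1); split; [exact: idealMl|ring].
split=> [|[a [y [iy ->]]]].
  apply: (gen_min (J := Ideal IP)) => y /=; rewrite inE => /orP[/eqP->|ys].
    by exists 1, 0; split; [exact: ideal0|ring].
  by exists 0, y; split; [exact: sub_gen|ring].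
apply: idealD; first by apply/idealMl/sub_gen; rewrite /= mem_head.
by apply: gen_min iy => z zs; apply: sub_gen; rewrite /= inE [z \in s]zs orbT.
Qed.

Lemma gen_seq1P g x : ideal_gen [set` [:: g]] x <-> exists a, x = a * g.
Proof.
split=> [/gen_consP[a [y [/gen_nilP-> ->]]]|[a ->]].
  by exists a; rewrite addr0.
by apply/gen_consP; exists a, 0; rewrite addr0; split=> //; exact: ideal0.
Qed.

Lemma gen_catP s t x : ideal_gen [set` s ++ t] x <->
  exists y z, [/\ ideal_gen [set` s] y, ideal_gen [set` t] z & x = y + z].
Proof.
elim: s x => [|g s IH] x /=.
  split=> [tx|[y [z [/gen_nilP-> tz ->]]]]; last by rewrite add0r.
  by exists 0, x; rewrite add0r; split=> //; exact: ideal0.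
split=> [/gen_consP[a [w [/IH[y [z [sy tz ->]]] ->]]]|[y [z [/gen_consP[a [w [sw ->]]] tz ->]]]].
  by exists (a * g + y), z; split=> //; [apply/gen_consP; exists a, y|ring].
apply/gen_consP; exists a, (w + z); split; last by ring.
by apply/IH; exists w, z.
Qed.

Lemma gen_ordP n (v : 'I_n -> A) x :
  ideal_gen [set` [seq v i | i <- enum 'I_n]] x <->
  exists a : 'I_n -> A, x = \sum_i a i * v i.
Proof.
split; last first.
  by move=> [a ->]; apply: ideal_sum => i; apply/idealMl/sub_gen/map_f/mem_enum.
have IP : is_ideal [set x | exists a : 'I_n -> A, x = \sum_i a i * v i].
  split=> [|y z [a ->] [b ->]|c y [a ->]].
  - by exists (fun=> 0); rewrite big1 // => i _; rewrite mul0r.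
  - by exists (fun i => a i + b i); rewrite -big_split; apply: eq_bigr => i _; rewrite mulrDl.
  - by exists (fun i => c * a i); rewrite mulr_sumr; apply: eq_bigr => i _; rewrite mulrA.
apply: (gen_min (J := Ideal IP)) => _ /mapP[i _ ->].
exists (fun j => (j == i)%:R); rewrite (bigD1 i) //= eqxx mul1r big1 ?addr0 // => j /negPf->.
by rewrite mul0r.
Qed.

Lemma is_ideal_add I J : is_ideal [set x | exists y z, [/\ I y, J z & x = y + z]].
Proof.
split=> [|_ _ [a [b [Ia Jb ->]]] [c [d [Ic Jd ->]]]|c _ [a [b [Ia Jb ->]]]].
- by exists 0, 0; rewrite addr0; split=> //; exact: ideal0.
- by exists (a + c), (b + d); split; [exact: idealD|exact: idealD|ring].
- by exists (c * a), (c * b); split; [exact: idealMl|exact: idealMl|ring].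
Qed.
Definition ideal_add I J : ideal A := Ideal (is_ideal_add I J).

Lemma ideal_addl I J : I `<=` ideal_add I J.
Proof. by move=> x Ix; exists x, 0; rewrite addr0; split=> //; exact: ideal0. Qed.
Lemma ideal_addr I J : J `<=` ideal_add I J.
Proof. by move=> x Jx; exists 0, x; rewrite add0r; split=> //; exact: ideal0. Qed.

Lemma is_ideal_colon I a : is_ideal [set x | I (x * a)].
Proof.
split=> [|x y Ix Iy|b x Ix] /=; rewrite ?mul0r ?mulrDl -?mulrA.
- exact: ideal0.
- exact: idealD.
- exact: idealMl.
Qed.
Definition colon I a : ideal A := Ideal (is_ideal_colon I a).

Definition fg (I : set A) := exists s : seq A, I = ideal_gen [set` s] :> set A.

(** Without a maximal member, choice yields a strictly increasing sequence; its union is finitely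
    generated, hence already equal to one of its terms. *)
Lemma noetherian_max (P : ideal A -> Prop) : noetherian A ->
  (exists I, P I) -> exists I, P I /\ forall J, P J -> I `<=` J -> J `<=` I.
Proof.
move=> noeth [I0 PI0]; apply: contrapT => nomax.
have next (I : {I | P I}) : exists J : {I | P I}, sval I `<` sval J.
  apply: contrapT => H; apply: nomax; exists (sval I); split; first exact: svalP.
  move=> J PJ IJ; apply: contrapT => JI; apply: H.
  by exists (exist _ J PJ).
have [f fP] := choice next.
pose F n := sval (iter n f (exist _ I0 PI0)).
have FS n : F n `<=` F n.+1 by case: (fP (iter n f (exist _ I0 PI0))).
have Fm m n : (m <= n)%N -> F m `<=` F n.
  elim: n => [|n IH]; first by rewrite leqn0 => /eqP->.
  rewrite leq_eqVlt => /orP[/eqP->//|/IH H] x /H; exact: FS.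
have IU : is_ideal [set x | exists n, F n x].
  split=> [|x y [m Fx] [n Fy]|a x [n Fx]].
  - by exists 0%N; exact: ideal0.
  - exists (maxn m n); apply: idealD.
      by apply: Fm Fx; exact: leq_maxl.
    by apply: Fm Fy; exact: leq_maxr.
  - by exists n; exact: idealMl.
have [s es] := noeth (Ideal IU).
have [N FN] : exists N, [set` s] `<=` F N.
  have : [set` s] `<=` Ideal IU by rewrite es; exact: sub_gen.
  elim: s {es} => [|g s IH] sI; first by exists 0%N.
  have [|N sN] := IH; first by move=> x xs; apply: sI; rewrite /= inE [x \in s]xs orbT.
  have [|M gM] := sI g; first by rewrite /= mem_head.
  exists (maxn M N) => x /=; rewrite inE => /orP[/eqP->|xs].
    by apply: Fm gM; exact: leq_maxl.
  by apply: Fm (sN _ xs); exact: leq_maxr.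
case: (fP (iter N f (exist _ I0 PI0))) => _; apply=> x Fx.
have : Ideal IU x by exists N.+1.
by rewrite es; exact: gen_min.
Qed.

Lemma noetherian_acc (F : nat -> ideal A) : noetherian A ->
  (forall n, F n `<=` F n.+1) -> exists N, forall n, (N <= n)%N -> F n `<=` F N.
Proof.
move=> noeth FS.
have Fm m n : (m <= n)%N -> F m `<=` F n.
  elim: n => [|n IH]; first by rewrite leqn0 => /eqP->.
  rewrite leq_eqVlt => /orP[/eqP->//|/IH H] x /H; exact: FS.
have [|I [[N ->] H]] := @noetherian_max (fun I => exists n, I = F n) noeth.
  by exists (F 0%N), 0%N.
by exists N => n Nn; apply: H; [exists n|exact: Fm].
Qed.

(** Nakayama's lemma in the local ring at [Q], written without localizing: units of the local ring
    appear as multipliers [t] outside [Q]. The induction removes one generator at a time. *)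
Lemma nakayama (Q J : ideal A) s : is_prime Q ->
  (forall g, g \in s -> exists t, ~ Q t /\
     exists j q, [/\ J j, ideal_mul Q (ideal_gen [set` s]) q & t * g = j + q]) ->
  exists t, ~ Q t /\ forall x, ideal_gen [set` s] x -> J (t * x).
Proof.
move=> [Q1 QM].
have mulQ x y : ~ Q x -> ~ Q y -> ~ Q (x * y) by move=> nx ny /QM[].
have mulE r x : ideal_mul Q (ideal_gen [set` r]) x ->
    forall h r', r = h :: r' -> exists a y, [/\ Q a, ideal_mul Q (ideal_gen [set` r']) y & x = a * h + y].
  move=> + h r' er; rewrite er.
  have IP : is_ideal [set x | exists a y, [/\ Q a, ideal_mul Q (ideal_gen [set` r']) y & x = a * h + y]].
    split=> [|x1 x2 [a1 [y1 [q1 i1 ->]]] [a2 [y2 [q2 i2 ->]]]|b x1 [a1 [y1 [q1 i1 ->]]]].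
    - by exists 0, 0; split; [exact: ideal0|exact: ideal0|rewrite mul0r addr0].
    - by exists (a1 + a2), (y1 + y2); split; [exact: idealD|exact: idealD|ring].
    - by exists (b * a1), (b * y1); split; [exact: idealMl|exact: idealMl|ring].
  apply: (gen_min (J := Ideal IP)) => _ [q [z [Qq /gen_consP[a [y [iy ->]]] ->]]].
  exists (q * a), (q * y); split; [exact: idealMr| |by ring].
  by apply: sub_gen; exists q, y.
elim: s => [|g s IH] H.
  by exists 1; split=> // x /gen_nilP->; rewrite mulr0; exact: ideal0.
have [t [Qt [j [q [Jj qI e]]]]] := H g (mem_head _ _).
have [a [y [Qa Qy eq]]] := mulE _ _ qI _ _ erefl.
(* The relation [t * g = j + a * g + y] with [a] in [Q] is solved for [g]: its coefficient [t - a]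
   is still outside [Q]. *)
pose t' := t - a.
have Qt' : ~ Q t' by move=> h; apply: Qt; apply: idealBr Qa h.
have e' : t' * g = j + y by rewrite /t' mulrBl e eq; ring.
have [|t2 [Qt2 Ht2]] := IH.
  move=> h hs; have [|th [Qth [jh [qh [Jjh qhI eh]]]]] := H h; first by rewrite inE hs orbT.
  have [ah [yh [Qah Qyh eqh]]] := mulE _ _ qhI _ _ erefl.
  exists (t' * th); split; first exact: mulQ.
  exists (t' * jh + ah * j), (ah * y + t' * yh); split.
  - by apply: idealD; exact: idealMl.
  - by apply: idealD; exact: idealMl.
  - rewrite -mulrA eh eqh.
    have -> : t' * (jh + (ah * g + yh)) = t' * jh + ah * (t' * g) + t' * yh by ring.
    by rewrite e'; ring.
exists (t2 * t'); split; first exact: mulQ.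
move=> x /gen_consP[c [z [zs ->]]].
have -> : t2 * t' * (c * g + z) = c * t2 * (t' * g) + t' * (t2 * z) by ring.
rewrite e' mulrDr; apply: idealD; last by apply: idealMl; exact: Ht2.
apply: idealD; first exact: idealMl.
rewrite -mulrA; apply: idealMl.
have : ideal_gen [set` s] `<=` colon J t2.
  by move=> w ws; rewrite /= mulrC; exact: Ht2.
move=> sJ; rewrite mulrC.
have : ideal_mul Q (ideal_gen [set` s]) `<=` colon J t2.
  by apply: gen_min => _ [q' [w [_ sw ->]]]; apply: idealMl; exact: sJ.
by move=> /(_ _ Qy).
Qed.

Lemma ideal_expS I n : ideal_exp I n.+1 = ideal_mul I (ideal_exp I n).
Proof. by []. Qed.

Lemma ideal_exp0 I x : ideal_exp I 0 x.
Proof. by apply: sub_gen. Qed.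

Lemma ideal_mulI I J x y : I x -> J y -> ideal_mul I J (x * y).
Proof. by move=> Ix Jy; apply: sub_gen; exists x, y. Qed.

Lemma ideal_mul_min I J (K : ideal A) : (forall x y, I x -> J y -> K (x * y)) ->
  ideal_mul I J `<=` K.
Proof. by move=> H; apply: gen_min => _ [x [y [Ix Jy ->]]]; exact: H. Qed.

Lemma ideal_exp1 I x : ideal_exp I 1 x <-> I x.
Proof.
split; first by apply: ideal_mul_min => a b Ia _; exact: idealMr.
by move=> Ix; rewrite -[x]mulr1; apply: ideal_mulI => //; exact: ideal_exp0.
Qed.

Lemma ideal_expSsub I n : ideal_exp I n.+1 `<=` ideal_exp I n.
Proof. by apply: ideal_mul_min => a b _; exact: idealMl. Qed.

Lemma ideal_expM I m n x y :
  ideal_exp I m x -> ideal_exp I n y -> ideal_exp I (m + n) (x * y).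
Proof.
elim: m x => [|m IH] x mx ny; first exact: idealMl.
have : ideal_mul I (ideal_exp I m) `<=` colon (ideal_exp I (m.+1 + n)) y.
  apply: ideal_mul_min => a b Ia mb /=; rewrite -mulrA addSn ideal_expS.
  by apply: ideal_mulI => //; exact: IH.
by apply.
Qed.

Lemma ideal_exp_le I m n : (m <= n)%N -> ideal_exp I n `<=` ideal_exp I m.
Proof.
elim: n => [|n IH]; first by rewrite leqn0 => /eqP->.
by rewrite leq_eqVlt => /orP[/eqP->//|/IH H] x /ideal_expSsub/H.
Qed.

Lemma prime_sub_exp (P : ideal A) I n : is_prime P -> ideal_exp I n `<=` P -> I `<=` P.
Proof.
move=> [P1 PM]; elim: n => [|n IH] H; first by case: P1; apply: H; exact: ideal_exp0.
move=> x Ix; apply: contrapT => nPx; apply: (nPx); apply: (IH _ _ Ix) => y ny.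
by have /H/PM[] : ideal_exp I n.+1 (x * y) by exact: ideal_mulI.
Qed.

End IdealTheory.

(** * Krull's height theorem *)

Section KrullHeight.
Variable A : comPzRingType.
Implicit Types (I J P p q : ideal A) (x y a : A).

Lemma is_ideal_sat P I : is_prime P -> is_ideal [set r | exists s, ~ P s /\ I (s * r)].
Proof.
move=> [P1 PM]; split=> [|x y [s [Ps Ix]] [t [Pt Iy]]|a x [s [Ps Ix]]].
- by exists 1; split=> //; rewrite mulr0; exact: ideal0.
- exists (s * t); split; first by move=> /PM[].
  have -> : s * t * (x + y) = t * (s * x) + s * (t * y) by ring.
  by apply: idealD; exact: idealMl.
- by exists s; split=> //; rewrite mulrCA; exact: idealMl.
Qed.
Definition sat P (Pp : is_prime P) I : ideal A := Ideal (is_ideal_sat I Pp).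

Definition saturated P I := forall s r : A, ~ P s -> I (s * r) -> I r.

Lemma sat_saturated P (Pp : is_prime P) I : saturated P (sat Pp I).
Proof.
move=> s r Ps [t [Pt]]; rewrite mulrA => H; exists (t * s); split=> //.
by case: Pp => _ PM /PM[].
Qed.

Lemma sub_sat P (Pp : is_prime P) I : I `<=` sat Pp I.
Proof. by move=> x Ix; exists 1; rewrite mul1r; case: Pp. Qed.

Lemma sat_le P (Pp : is_prime P) I J : I `<=` J -> sat Pp I `<=` sat Pp J.
Proof. by move=> IJ x [s [Ps Ix]]; exists s; split=> //; exact: IJ. Qed.

Lemma ideal_add_le I I' J : I `<=` I' -> ideal_add I J `<=` ideal_add I' J.
Proof. by move=> II' _ [y [z [Iy Jz ->]]]; exists y, z; split=> //; exact: II'. Qed.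

Hypothesis noeth : noetherian A.

(* If [P] is minimal over [p + (x)], then the localization at [P] of
   [A / (p + (x))] is Artinian. *)
Lemma dcc_over_minimal p P x : is_prime P ->
  (forall r : ideal A, is_prime r -> p `<=` r -> r x -> r `<=` P -> P `<=` r) ->
  forall F : nat -> ideal A,
    (forall n, [/\ p `<=` F n, F n x & saturated P (F n)]) ->
    (forall n, F n.+1 `<=` F n) ->
  exists N, forall n, (N <= n)%N -> F N `<=` F n.
Proof.
move=> Pp Pmin.
pose S I := [/\ p `<=` I, I x & saturated P I].
pose Dcc I := forall F : nat -> ideal A, (forall n, S (F n)) -> (forall n, I `<=` F n) ->
  (forall n, F n.+1 `<=` F n) -> exists N, forall n, (N <= n)%N -> F N `<=` F n.
suff H I : S I -> Dcc I.
  move=> F SF FS.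
  pose I0 := sat Pp (ideal_add p (ideal_gen [set x])).
  apply: (H I0) => //.
    split; [|by apply/sub_sat/ideal_addr/sub_gen|exact: sat_saturated].
    by move=> y py; apply/sub_sat/ideal_addl.
  move=> n r [s [Ps]] [y [z [py xz e]]]; have [pF Fx satF] := SF n.
  apply: satF Ps _; rewrite e; apply: idealD; first exact: pF.
  by apply: (gen_min _ xz) => _ ->.
move=> SI; apply: contrapT => nDI.
(* Noetherian induction: [I] is replaced by a saturated ideal that is maximal among those above
   which the chain condition fails. *)
have [|I' [[{}SI {}nDI] maxI]] := @noetherian_max _ (fun I => S I /\ ~ Dcc I) noeth.
  by exists I.
move: {I} I' SI nDI maxI => I SI nDI maxI.
have [pI Ix satI] := SI.
have I1 : ~ I 1.
  move=> I1; apply: nDI => F SF IF FS; exists 0%N => n _ y _.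
  by apply/ideal1/IF.
(* A maximal colon ideal is an associated prime of [I]. It contains [p] and [x], and lies in [P]
   because [I] is saturated, so it contains [P] by minimality. Hence [J / I], with [J] generated by
   [I] and [a], has length one locally at [P]. *)
have [|C [[a [Ia eC]] maxa]] := @noetherian_max _ (fun J => exists a, ~ I a /\ J = colon I a) noeth.
  by exists (colon I 1), 1.
subst C.
have prime_col : is_prime (colon I a).
  split; first by rewrite /= mul1r.
  move=> y z /= Iyza; apply: contrapT => /not_orP[Iya Iza].
  apply: Iya; apply: (maxa (colon I (z * a))) => /=; first by exists (z * a).
    by move=> w /= Iwa; rewrite mulrCA; exact: idealMl.
  by rewrite mulrA.
have Pa : P `<=` colon I a.
  apply: Pmin => //= [y py||y Iya].
  - by apply/idealMr/pI.
  - exact: idealMr.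
  - by apply: contrapT => Py; apply: Ia; exact: satI Iya.
pose J := sat Pp (ideal_add I (ideal_gen [set a])).
have IJ : I `<=` J by move=> y Iy; apply/sub_sat/ideal_addl.
have Ja : J a by apply/sub_sat/ideal_addr/sub_gen.
have JE y : J y -> exists s i b, [/\ ~ P s, I i & s * y = i + b * a].
  move=> [s [Ps [i [z [Ii az e]]]]]; exists s, i.
  have : ideal_gen [set` [:: a]] z.
    by apply: (gen_min _ az) => _ ->; apply: sub_gen; rewrite /= inE.
  by move=> /gen_seq1P[b eb]; exists b; rewrite -eb.
have SJ : S J.
  by split; [move=> y /pI/IJ|exact: IJ|exact: sat_saturated].
have DJ : Dcc J by apply: contrapT => nDJ; apply/Ia/(maxI J).
apply: nDI => F SF IF FS.
have Fm m n : (m <= n)%N -> F n `<=` F m.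
  elim: n => [|n IH]; first by rewrite leqn0 => /eqP->.
  by rewrite leq_eqVlt => /orP[/eqP->//|/IH H] y /FS/H.
pose G n := sat Pp (ideal_add (F n) J).
have [||n|N1 HN1] := DJ G.
- move=> n; split; [|by apply/sub_sat/ideal_addl/IF|exact: sat_saturated].
  by move=> y py; apply/sub_sat/ideal_addl/IF/pI.
- by move=> n y Jy; apply/sub_sat/ideal_addr.
- by apply/sat_le/ideal_add_le.
(* Since [J / I] has length one at [P], either some [F N2] meets [J] in [I] alone, or every [F m]
   contains [a] and hence [J]. The intersections with [J] are stationary in both cases. *)
have [N2 HN2] : exists N2, forall n m y, (N2 <= n)%N -> (N2 <= m)%N -> F n y -> J y -> F m y.
  have [[N2 HN2]|/forallNP H] := pselect (exists N2, forall y, F N2 y -> J y -> I y).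
    exists N2 => n m y nN mN Fy Jy; apply: IF; apply: HN2 => //; exact: Fm Fy.
  exists 0%N => n m y _ _ _ Jy; have /existsNP[z /not_implyP[Fz /not_implyP[Jz Iz]]] := H m.
  have [s [i [b [Ps Ii e]]]] := JE _ Jz.
  have [_ _ satF] := SF m.
  have Pb : ~ P b.
    move=> Pb; apply: Iz; apply: satI Ps _; rewrite e; apply: idealD => //.
    exact: Pa.
  have Fa : F m a.
    apply: satF Pb _; have -> : b * a = s * z - i by rewrite e; ring.
    by apply: idealB; [exact: idealMl|exact: IF].
  have [s' [i' [b' [Ps' Ii' e']]]] := JE _ Jy.
  apply: satF Ps' _; rewrite e'; apply: idealD; first exact: IF.
  exact: idealMl.
(* Modular law: nested ideals with the same saturated sum and the same intersection with [J]
   coincide. *)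
exists (maxn N1 N2) => n Nn r Fr.
have [N1n N2n] : (N1 <= n)%N /\ (N2 <= n)%N.
  by split; [exact: leq_trans (leq_maxl _ _) Nn|exact: leq_trans (leq_maxr _ _) Nn].
have : G N1 r by apply/sub_sat/ideal_addl/(Fm _ _ (leq_maxl N1 N2)).
move=> /(HN1 n N1n)[s [Ps [i [j [Fi Jj e]]]]].
have [_ _ satF] := SF n; apply: satF Ps _; rewrite e; apply: idealD => //.
apply: (HN2 (maxn N1 N2) n) => //; first exact: leq_maxr.
have -> : j = s * r - i by rewrite e; ring.
by apply: idealB; [exact: idealMl|exact: (Fm _ _ Nn)].
Qed.

(** The principal ideal theorem. If [P] were minimal over [p + (x)], the symbolic powers of [q]
    modulo [p] would be stationary, and Nakayama at [q] would give [q = p]. It is phrased as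
    exchanging [q] for a prime containing [x], which is the move that [move_chain] repeats. *)
Theorem krull_pit p q P x : is_prime p -> is_prime q -> is_prime P ->
  p `<` q -> q `<` P -> P x -> ~ q x ->
  exists r : ideal A, [/\ is_prime r, p `<=` r, r x & r `<` P].
Proof.
move=> pp qp Pp [pq nqp] [qP nPq] Px qx; apply: contrapT => nor.
have Pmin (r : ideal A) : is_prime r -> p `<=` r -> r x -> r `<=` P -> P `<=` r.
  by move=> rp pr rx rP; apply: contrapT => nPr; apply: nor; exists r.
have satq_P I : saturated q I -> saturated P I.
  by move=> H s r Ps; apply: H => qs; apply/Ps/qP.
pose Q n := sat qp (ideal_add (ideal_exp q n) p).
pose xA := ideal_gen [set x].
pose F n := sat Pp (ideal_add (Q n) xA).
have QS n : Q n.+1 `<=` Q n by apply/sat_le/ideal_add_le/ideal_expSsub.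
have pQ n : p `<=` Q n by move=> y py; apply/sub_sat/ideal_addr.
have [n|n|N /(_ N.+1 (leqnSn _)) HN] := dcc_over_minimal Pp Pmin (F := F).
- split; [|by apply/sub_sat/ideal_addr/sub_gen|exact: sat_saturated].
  by move=> y py; apply/sub_sat/ideal_addl/pQ.
- by apply/sat_le/ideal_add_le/QS.
(* Nakayama at [P]: the symbolic powers [Q N] and [Q N.+1] of [q] modulo [p] agree. *)
have QN : Q N `<=` Q N.+1.
  have [g eg] := noeth (Q N).
  have [|t [Pt Ht]] := @nakayama _ P (Q N.+1) g Pp.
    move=> r rg.
    have Qr : Q N r by rewrite eg; exact: sub_gen.
    have [|s [Ps [r' [z [Qr' xz e]]]]] := HN r; first exact/sub_sat/ideal_addl.
    have [a ez] : exists a, z = a * x.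
      apply/gen_seq1P; apply: (gen_min _ xz) => _ ->; apply: sub_gen.
      by rewrite /= inE.
    exists s; split=> //; exists r', z; split=> //.
    rewrite ez mulrC; apply: ideal_mulI => //; rewrite -eg.
    (* As [x] is outside [q] and [Q N] is [q]-saturated, [a] itself lies in [Q N], so that [z] is in
       [P] times [Q N]. *)
    have : Q N (x * a).
      have -> : x * a = s * r - r' by rewrite e ez; ring.
      by apply: idealB; [exact: idealMl|exact: QS].
    exact: sat_saturated.
  move=> y; rewrite eg => /Ht; apply: satq_P Pt; exact: sat_saturated.
have [g eg] := noeth (ideal_exp q N).
have [|t [qt Ht]] := @nakayama _ q p g qp.
  move=> r rg.
  have : Q N r by apply/sub_sat/ideal_addl; rewrite eg; exact: sub_gen.
  move=> /QN[s [qs [y [z [qy pz e]]]]]; exists s; split=> //; exists z, y.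
  split=> //; last by rewrite e addrC.
  apply: ideal_mul_min qy => u v qu; rewrite eg => gv; exact: ideal_mulI.
apply: nqp; apply: (prime_sub_exp (n := N) pp) => y; rewrite eg => /Ht.
by case: pp => _ pM /pM[]// /pq.
Qed.

Fixpoint prime_chain p (s : seq (ideal A)) : Prop :=
  if s is q :: s' then [/\ is_prime q, p `<` q & prime_chain q s'] else True.

(** Repeated use of [krull_pit] from the top pushes [x] down the chain while the top prime is kept:
    having [x] in the bottom prime costs exactly one step of length. *)
Lemma move_chain p (s : seq (ideal A)) x : is_prime p -> prime_chain p s -> (0 < size s)%N -> last p s x ->
  exists q (s' : seq (ideal A)), [/\ is_prime q, prime_chain q s', p `<=` q, q x &
    size s = (size s').+1 /\ last q s' = last p s].
Proof.
elim: s p => // q1 [|q2 s] IH p pp; first move=> [q1p pq _] _ /= qx.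
  by exists q1, [::]; split=> //; case: pq.
move=> [q1p pq1 cq1] _ lx.
have [//|//|r [s' [rp cr q1r rx [ss ls]]]] := IH q1 q1p cq1.
have [q1x|nq1x] := pselect (q1 x).
  by exists q1, (q2 :: s); split=> //; case: pq1.
have q1r' : q1 `<` r by split=> // H; apply/nq1x/H.
have [r' [r'p pr' r'x r'r]] := krull_pit pp q1p rp pq1 q1r' rx nq1x.
by exists r', (r :: s'); split=> //; split=> //=; rewrite -ss.
Qed.

(** Working above a base prime [p] avoids quotient rings: [move_chain] absorbs the first generator
    into a new base prime, and the induction goes on with the remaining generators. *)
Theorem krull_height (g : seq A) p (s : seq (ideal A)) : is_prime p -> prime_chain p s -> (forall x, x \in g -> last p s x) ->
  (forall r : ideal A, is_prime r -> p `<=` r -> [set` g] `<=` r -> r `<=` last p s -> last p s `<=` r) ->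
  (size s <= size g)%N.
Proof.
elim: g p s => [|x g IH] p s pp cs lg lmin.
  case: s cs lg lmin => // q s cs lg lmin.
  have pl r t : prime_chain r t -> r `<=` last r t.
    elim: t r => [r _|r' t IHt r /= [_ [rr' _] /IHt H] z /rr'] //; exact: H.
  case: (cs) => qp [pq nqp] cq.
  have /= H : last p (q :: s) `<=` p by apply: lmin => //; exact: (pl p (q :: s) cs).
  by case: nqp => z /(pl _ _ cq)/H.
case: s cs lg lmin => // q s cs lg lmin.
have [//||r [s' [rp cr pr rx [ss ls]]]] := move_chain (x := x) pp cs.
  by apply: lg; rewrite mem_head.
rewrite ss ltnS; apply: IH rp cr _ _; rewrite ls.
  by move=> y yg; apply: lg; rewrite inE yg orbT.
move=> r' r'p rr' gr' r'l; apply: lmin => //; first by move=> z /pr/rr'.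
by move=> z /=; rewrite inE => /orP[/eqP->|/gr'//]; exact: rr'.
Qed.

Lemma has_prime_chain_seq n : has_prime_chain A n ->
  exists p (s : seq (ideal A)), [/\ is_prime p, prime_chain p s & size s = n].
Proof.
move=> [c cP].
pose f i : ideal A := c (inord i).
have fp i : is_prime (f i) by exact: (Defs.primeP (c (inord i))).
have ff i : (i < n)%N -> f i `<` f i.+1.
  by move=> i_n; apply: cP; rewrite !inordK // ltnS ltnW.
suff H m i : (i + m <= n)%N -> prime_chain (f i) [seq f j | j <- iota i.+1 m].
  by exists (f 0%N), [seq f j | j <- iota 1 n]; split; rewrite ?size_map ?size_iota //; exact: H.
elim: m i => //= m IH i; rewrite addnS -addSn => im; split; [exact: fp| |exact: IH].
by apply: ff; apply: leq_trans im; rewrite leq_addr.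
Qed.

End KrullHeight.

Lemma inj_surj_bij (T U : Type) (f : T -> U) :
  injective f -> (forall y, exists x, f x = y) -> bijective f.
Proof.
move=> finj /choice[g gP]; exists g => // x; apply: finj; exact: gP.
Qed.

(** * Local rings and embedding dimension *)

Section LocalRings.
Variable A : comPzRingType.
Implicit Types (m I : ideal A) (x y : A).

Definition is_unit x := exists y, x * y = 1.

(** Elementwise form of [local_with]; [local_with_local] and [local_at_with] pass between the
    two. *)
Definition local_at m := ~ m 1 /\ forall x, ~ m x -> is_unit x.

(** Maximality of [m], expressed by inverses modulo [m]. *)
Definition comaximal m := ~ m 1 /\ forall x, ~ m x -> exists y, m (1 - x * y).

Lemma is_unitM x y : is_unit x -> is_unit y -> is_unit (x * y).
Proof.
move=> [x' ex] [y' ey]; exists (x' * y').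
have -> : x * y * (x' * y') = (x * x') * (y * y') by ring.
by rewrite ex ey mulr1.
Qed.

Lemma unit_ideal I x y : is_unit x -> I (x * y) -> I y.
Proof.
by move=> [z e] /(idealMl z); rewrite mulrA (mulrC z) e mul1r.
Qed.

Lemma is_unitMl x y : is_unit (x * y) -> is_unit x.
Proof. by move=> [z e]; exists (y * z); rewrite mulrA. Qed.

Lemma local_comaximal m : local_at m -> comaximal m.
Proof.
by move=> [m1 mu]; split=> // x /mu[y e]; exists y; rewrite e subrr; exact: ideal0.
Qed.

Lemma comaximal_prime m : comaximal m -> is_prime m.
Proof.
move=> [m1 mc]; split=> // x y mxy; apply: contrapT => /not_orP[/mc[z mz] ny].
apply: ny; have -> : y = (1 - x * z) * y + z * (x * y) by ring.
by apply: idealD; [exact: idealMr|exact: idealMl].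
Qed.

Lemma local_with_local m : local_at m -> local_with m.
Proof.
move=> [m1 mu].
have sub (J : ideal A) : ~ J 1 -> J `<=` m.
  by move=> J1 x Jx; apply: contrapT => /mu[y e]; apply: J1; rewrite -e; exact: idealMr.
split; first by split=> // J _; exact: sub.
by move=> n [n1 nmax]; apply/seteqP; split; [exact: sub|apply: nmax => //; exact: sub].
Qed.

Lemma local_with_eq m n : local_at m -> local_with n -> n = m :> set A.
Proof. by move=> /local_with_local [mm _] [_ H]; rewrite (H _ mm). Qed.

Lemma local_at_with m : noetherian A -> local_with m -> local_at m.
Proof.
move=> noeth [[m1 _] mu]; split=> // x mx; apply: contrapT => ux.
have [|n [[n1 xn] nmax]] :=
    @noetherian_max _ (fun I : ideal A => ~ I 1 /\ ideal_gen [set` [:: x]] `<=` I) noeth.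
  exists (ideal_gen [set` [:: x]]); split=> // /gen_seq1P[a e]; apply: ux.
  by exists a; rewrite mulrC.
have en : n = m :> set A.
  apply: mu; split=> // J nJ J1; apply: nmax => //; split=> // y /xn; exact: nJ.
by apply: mx; rewrite -en; apply/xn/sub_gen; rewrite /= inE.
Qed.

Lemma prime_sub_local m (P : ideal A) : local_at m -> is_prime P -> P `<=` m.
Proof.
move=> [m1 mu] [P1 _] x Px; apply: contrapT => /mu[y e]; apply: P1.
by rewrite -e; exact: idealMr.
Qed.

Lemma comaximal_exp m n x : comaximal m -> ~ m x -> exists y, ideal_exp m n (1 - x * y).
Proof.
move=> [m1 mc] mx; have [z mz] := mc _ mx.
elim: n => [|n [y ny]]; first by exists 0; exact: ideal_exp0.
(* Chosen so that the errors of the two approximate inverses [y] and [z] multiply. *)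
exists (y + z - x * y * z).
have -> : 1 - x * (y + z - x * y * z) = (1 - x * z) * (1 - x * y) by ring.
exact: ideal_mulI.
Qed.

(** A chain that stops below [m] is prolonged by [m], so that [krull_height] can be applied with
    [m], or a prime equal to it, on top. *)
Lemma local_height m (g : seq A) k : noetherian A -> local_at m -> [set` g] `<=` m ->
  (forall r : ideal A, is_prime r -> [set` g] `<=` r -> m `<=` r) ->
  has_prime_chain A k -> (k <= size g)%N.
Proof.
move=> noeth mloc gm gmin /has_prime_chain_seq[p [s [pp cs <-]]].
have mp := comaximal_prime (local_comaximal mloc).
have lp q t : is_prime q -> prime_chain q t -> is_prime (last q t).
  by elim: t q => //= r t IH q _ [rp _]; exact: IH.
have cr q t : prime_chain q t -> last q t `<` m -> prime_chain q (rcons t m).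
  by elim: t q => //= r t IH q [rp qr cr] l; split=> //; exact: IH.
have [lm|nlm] := pselect (last p s `<` m).
  have := @krull_height _ noeth g p (rcons s m) pp (cr _ _ cs lm).
  rewrite last_rcons size_rcons => H; apply: ltnW; apply: H.
    by move=> x /gm.
  by move=> r rp _ gr _; exact: gmin.
have el : m `<=` last p s.
  apply: contrapT => h; apply: nlm; split=> //; apply: prime_sub_local => //; exact: lp.
apply: (@krull_height _ noeth g p s pp cs); first by move=> x /gm/el.
move=> r rp _ gr _ x lx; apply: gmin => //; apply: prime_sub_local lx => //; exact: lp.
Qed.

End LocalRings.

Section Edim.
Variables (A : comPzRingType) (m : ideal A).

(** [cot_span] and [cot_free] express a basis of m/m^2 over A/m by representatives in [A], which
    keeps later computations out of the two quotients; [edimP] is the translation. *)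
Definition cot_span n (v : 'I_n -> A) := (forall i, m (v i)) /\
  forall x, m x -> exists a : 'I_n -> A, ideal_exp m 2 (x - \sum_i a i * v i).

Definition cot_free n (v : 'I_n -> A) :=
  forall a : 'I_n -> A, ideal_exp m 2 (\sum_i a i * v i) -> forall i, m (a i).

Lemma in_ideal_pred (I : ideal A) x : I x -> x \in ideal_pred I.
Proof. by move=> Ix; apply/asboolP. Qed.

Lemma cot_pi_eq0 (x : ideal_elt m) : cot_pi x = 0 <-> ideal_exp m 2 (elt_val x).
Proof.
have e0 : elt_val (0 : ideal_elt m) = 0 by exact: (raddf0 (\val : ideal_elt m -> A)).
have -> : 0 = cot_pi (0 : ideal_elt m) by rewrite /cot_pi raddf0.
by rewrite cot_piP e0 subr0.
Qed.

Lemma cot_comb n (a : 'I_n -> A) (w : 'I_n -> ideal_elt m) :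
  exists y : ideal_elt m, elt_val y = \sum_i a i * elt_val (w i) /\
    cot_pi y = \sum_i (quot_pi m (a i) : quot_ring m) *: cot_pi (w i).
Proof.
exists (\sum_i elt_scale (a i) (w i)); split.
  by rewrite -[elt_val _]/(\val _) raddf_sum.
rewrite /cot_pi raddf_sum; apply: eq_bigr => i _.
exact/esym/cot_scaleE.
Qed.

Lemma edimP n : has_edim m n <-> exists v : 'I_n -> A, cot_span v /\ cot_free v.
Proof.
split=> [[f fbij]|[v [[vm vspan] vfree]]].
  pose w i := repr (f (delta_mx 0 i)).
  have fE r : f r = \sum_i r 0 i *: cot_pi (w i).
    rewrite {1}[r]row_sum_delta linear_sum; apply: eq_bigr => i _.
    by rewrite linearZ /= cot_pi_repr.
  exists (fun i => elt_val (w i)); split.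
    split=> [i|x mx]; first exact: elt_valP.
    have [g fK gK] := fbij.
    pose X := IdealElt (in_ideal_pred mx).
    pose a i := repr (g (cot_pi X) 0 i).
    have [y [ey cy]] := cot_comb a w.
    exists a; rewrite -ey -[x]/(elt_val X); apply/cot_piP.
    by rewrite cy -[LHS]gK fE; apply: eq_bigr => i _; rewrite quot_pi_repr.
  move=> a; have [y [<- cy]] := cot_comb a w; move=> /cot_pi_eq0.
  rewrite cy => e i.
  have : f (\row_i quot_pi m (a i)) = 0.
    by rewrite fE -[RHS]e; apply: eq_bigr => j _; rewrite mxE.
  rewrite -[RHS](linear0 f) => /(bij_inj fbij)/rowP/(_ i).
  by rewrite !mxE -[0](raddf0 (quot_pi m)) => /quot_piP; rewrite subr0.
pose w i := IdealElt (in_ideal_pred (vm i)).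
pose f (r : 'rV[quot_ring m]_n) : cotangent m := \sum_i r 0 i *: cot_pi (w i).
have flin : linear f.
  move=> b r s; rewrite /f scaler_sumr -big_split; apply: eq_bigr => i _ /=.
  by rewrite !mxE scalerDl scalerA.
pose F : {linear 'rV[quot_ring m]_n -> cotangent m} :=
  HB.pack f (GRing.isLinear.Build _ _ _ _ f flin).
exists F; apply: inj_surj_bij.
  apply: raddf_inj => r /= e.
  apply/rowP => i; rewrite mxE.
  have [y [ey cy]] := cot_comb (fun i => repr (r 0 i)) w.
  have : cot_pi y = 0.
    by rewrite cy -[RHS]e; apply: eq_bigr => j _; rewrite quot_pi_repr.
  move=> /cot_pi_eq0; rewrite ey => /vfree/(_ i) mri.
  rewrite -[r 0 i]quot_pi_repr -[RHS](raddf0 (quot_pi m)).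
  by apply/quot_piP; rewrite subr0.
move=> y; have [a ha] := vspan _ (elt_valP (repr y)).
have [z [ez cz]] := cot_comb a w.
exists (\row_i quot_pi m (a i)).
rewrite -[y]cot_pi_repr /=.
have -> : f (\row_i quot_pi m (a i)) = cot_pi z.
  by rewrite cz; apply: eq_bigr => j _; rewrite mxE.
apply/esym/cot_piP; by rewrite ez.
Qed.

(** Nakayama at [m], where the multiplier it produces is a unit. *)
Lemma cot_span_gen n (v : 'I_n -> A) : noetherian A -> local_at m -> cot_span v ->
  m `<=` ideal_gen [set` [seq v i | i <- enum 'I_n]].
Proof.
move=> noeth mloc [vm vspan].
have mp := comaximal_prime (local_comaximal mloc).
have [s es] := noeth m.
have [|t [mt Ht]] := @nakayama _ m (ideal_gen [set` [seq v i | i <- enum 'I_n]]) s mp.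
  move=> g gs; exists 1; split; first by case: mloc.
  have mg : m g by rewrite es; exact: sub_gen.
  have [a ha] := vspan _ mg.
  exists (\sum_i a i * v i), (g - \sum_i a i * v i); split; last by ring.
    by apply/gen_ordP; exists a.
  move: ha; rewrite ideal_expS; apply: ideal_mul_min => x y mx /ideal_exp1 my.
  by apply: ideal_mulI => //; rewrite -es.
move=> x; rewrite es => /Ht; apply: unit_ideal; by case: mloc => _; apply.
Qed.

Lemma dim_le_edim n k : noetherian A -> local_at m -> has_edim m n ->
  has_prime_chain A k -> (k <= n)%N.
Proof.
move=> noeth mloc /edimP[v [vs _]] /(local_height (g := [seq v i | i <- enum 'I_n])).
move=> /(_ m noeth mloc); rewrite size_map size_enum_ord; apply.
  by case: vs => vm _ x /mapP[i _ ->].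
by move=> r rp vr x /(cot_span_gen noeth mloc vs); apply: gen_min.
Qed.

End Edim.

(** * Localization and completion *)

Section Morphisms.

(** Allows a morphism to be made from a plain function in the middle of a proof; most morphisms
    below are obtained as existence statements in this way. *)
Lemma rmorphism_exists (A B : pzRingType) (f : A -> B) :
  (forall x y, f (x - y) = f x - f y) -> f 1 = 1 ->
  (forall x y, f (x * y) = f x * f y) ->
  exists F : {rmorphism A -> B}, forall x, F x = f x.
Proof.
move=> fB f1 fM.
have fMM : monoid_morphism f by split.
pose F : {rmorphism A -> B} := HB.pack f
  (GRing.isZmodMorphism.Build _ _ f fB) (GRing.isMonoidMorphism.Build _ _ f fMM).
by exists F.
Qed.

Lemma rmorph_factor (A B C : comPzRingType) (h : {rmorphism A -> B})
    (g : {rmorphism A -> C}) :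
  (forall b, exists a, h a = b) -> (forall a, h a = 0 -> g a = 0) ->
  exists G : {rmorphism B -> C}, forall a, G (h a) = g a.
Proof.
move=> /choice[k hk] ker.
have gk a : g (k (h a)) = g a.
  apply/eqP; rewrite -subr_eq0 -rmorphB; apply/eqP/ker.
  by rewrite rmorphB hk subrr.
have [|||G eG] := @rmorphism_exists B C (g \o k).
- by move=> x y; rewrite -[x]hk -[y]hk -rmorphB /= !gk rmorphB.
- by rewrite -(rmorph1 h) /= gk rmorph1.
- by move=> x y; rewrite -[x]hk -[y]hk -rmorphM /= !gk rmorphM.
by exists G => a; rewrite eG /= gk.
Qed.

Lemma ring_iso_quot (R C : comPzRingType) (g : {rmorphism R -> C}) (I : ideal R) :
  (forall c, exists r, g r = c) -> (forall r, g r = 0 <-> I r) ->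
  ring_iso C (quot_ring I).
Proof.
move=> gs gk.
have pi0 r : quot_pi I r = 0 <-> I r.
  by rewrite -[0](rmorph0 (quot_pi I)) quot_piP subr0.
have [|G eG] := rmorph_factor (g := quot_pi I) gs.
  by move=> r /gk/pi0.
have G0 c : G c = 0 -> c = 0 by have [r <-] := gs c; rewrite eG => /pi0/gk.
exists G; apply: inj_surj_bij; first by apply: raddf_inj => c; exact: G0.
by move=> y; exists (g (repr y)); rewrite eG; exact: quot_pi_repr.
Qed.

Lemma ring_iso_trans (A B C : comPzRingType) :
  ring_iso A B -> ring_iso B C -> ring_iso A C.
Proof. by move=> [f fb] [g gb]; exists (g \o f); exact: bij_comp. Qed.

End Morphisms.

Section Localizations.
Variables (B L : comPzRingType) (Q : ideal B) (phi : {rmorphism B -> L}).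

(** [L] is a model of the localization of [B] at [Q], unique up to isomorphism by [loc_unique]. With
    a predicate, dual numbers over a localization or a composite with an isomorphism can serve as
    localizations directly. *)
Definition is_loc :=
  [/\ forall s, ~ Q s -> is_unit (phi s),
      forall l, exists b s, ~ Q s /\ phi s * l = phi b &
      forall b, phi b = 0 -> exists s, ~ Q s /\ s * b = 0].

Hypotheses (Qp : is_prime Q) (locL : is_loc).

Lemma loc_eq b b' : phi b = phi b' -> exists s, ~ Q s /\ s * b = s * b'.
Proof.
move=> e; have [_ _ ker] := locL; have [|s [Qs es]] := ker (b - b').
  by rewrite rmorphB e subrr.
by exists s; split=> //; apply/eqP; rewrite -subr_eq0 -mulrBr es.
Qed.

Lemma is_ideal_ext (I : ideal B) :
  is_ideal [set l | exists b s, [/\ I b, ~ Q s & phi s * l = phi b]].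
Proof.
have [_ QM] := Qp; have [_ ls _] := locL.
split=> [|l l' [b [s [Ib Qs e]]] [b' [s' [Ib' Qs' e']]]|a l [b [s [Ib Qs e]]]].
- by exists 0, 1; split; [exact: ideal0|case: Qp|rewrite mulr0 rmorph0].
- exists (s' * b + s * b'), (s * s'); split; last 1 first.
  + rewrite rmorphD !rmorphM mulrDr -e -e'; ring.
  + by apply: idealD; exact: idealMl.
  + by move=> /QM[].
- have [c [t [Qt et]]] := ls a; exists (c * b), (t * s); split; last 1 first.
  + rewrite !rmorphM -e -et; ring.
  + exact: idealMl.
  + by move=> /QM[].
Qed.
Definition ext_ideal I : ideal L := Ideal (is_ideal_ext I).
Definition loc_max : ideal L := ext_ideal Q.

Lemma ext_idealP (I : ideal B) b : I b -> ext_ideal I (phi b).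
Proof. by move=> Ib; exists b, 1; split; [|case: Qp|rewrite rmorph1 mul1r]. Qed.

Lemma ext_ideal_saturated (I : ideal B) b : ext_ideal I (phi b) ->
  exists s, ~ Q s /\ I (s * b).
Proof.
move=> [b' [s [Ib' Qs]]]; rewrite -rmorphM => /loc_eq[t [Qt e]].
exists (t * s); rewrite -mulrA e; split; last exact: idealMl.
by have [_ QM] := Qp; move=> /QM[].
Qed.

Lemma loc_maxP b : loc_max (phi b) <-> Q b.
Proof.
split; last exact: ext_idealP.
by move=> /ext_ideal_saturated[s [Qs]]; have [_ QM] := Qp; move=> /QM[].
Qed.

Lemma loc_local : local_at loc_max.
Proof.
have [lu ls lk] := locL.
split; first by rewrite -(rmorph1 phi) loc_maxP; case: Qp.
move=> l ml; have [b [s [Qs e]]] := ls l.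
apply: (@is_unitMl _ l (phi s)); rewrite mulrC e; apply: lu => Qb.
by apply: ml; exists b, s.
Qed.

Lemma noetherian_loc : noetherian B -> noetherian L.
Proof.
move=> noeth J; have [lu ls lk] := locL.
have IP : is_ideal [set b | J (phi b)].
  split=> [|x y Jx Jy|a x Jx] /=.
  - by rewrite rmorph0; exact: ideal0.
  - by rewrite rmorphD; exact: idealD.
  - by rewrite rmorphM; exact: idealMl.
have [g eg] := noeth (Ideal IP); exists (map phi g).
apply/seteqP; split; last first.
  apply: gen_min => _ /mapP[x xg ->].
  by have : Ideal IP x by rewrite eg; exact: sub_gen.
move=> l Jl; have [b [s [Qs e]]] := ls l.
apply: (unit_ideal (lu s Qs)); rewrite e.
have : Ideal IP b by rewrite /= -e; exact: idealMl.
have JP : is_ideal [set b | ideal_gen [set` map phi g] (phi b)].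
  split=> [|x y Jx Jy|a x Jx] /=.
  - by rewrite rmorph0; exact: ideal0.
  - by rewrite rmorphD; exact: idealD.
  - by rewrite rmorphM; exact: idealMl.
rewrite eg; apply: (gen_min (J := Ideal JP)) => x xg /=.
by apply: sub_gen; apply: map_f.
Qed.

Lemma loc_extend (C : comPzRingType) (g : {rmorphism B -> C}) :
  (forall s, ~ Q s -> is_unit (g s)) ->
  exists G : {rmorphism L -> C}, forall b, G (phi b) = g b.
Proof.
move=> gu; have [lu ls lk] := locL; have [Q1 QM] := Qp.
have gcan s x y : ~ Q s -> g s * x = g s * y -> x = y.
  move=> /gu[v ev] e; rewrite -[x]mul1r -[y]mul1r -ev.
  by rewrite [g s * v]mulrC -!mulrA e.
have gexists l : exists c, forall b s, ~ Q s -> phi s * l = phi b -> g s * c = g b.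
  have [b0 [s0 [Qs0 e0]]] := ls l; have [v ev] := gu _ Qs0.
  exists (g b0 * v) => b s Qs e.
  have : phi (s0 * b) = phi (s * b0) by rewrite !rmorphM -e -e0; ring.
  move=> /loc_eq[t [Qt et]]; move: (congr1 g et); rewrite !rmorphM => /(gcan _ _ _ Qt) eb.
  by apply: (gcan s0) => //; rewrite eb -[RHS]mulr1 -ev; ring.
have [G GP] := choice gexists.
have [|||F eF] := @rmorphism_exists L C G.
- move=> l l'; have [b [s [Qs e]]] := ls l; have [b' [s' [Qs' e']]] := ls l'.
  have Qss' : ~ Q (s * s') by move=> /QM[].
  apply: (gcan (s * s')) => //; rewrite (GP _ (s' * b - s * b')) //; last first.
    by rewrite rmorphB !rmorphM -e -e'; ring.
  by rewrite rmorphB !rmorphM -(GP _ _ _ Qs e) -(GP _ _ _ Qs' e'); ring.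
- by apply: (gcan 1) => //; rewrite (GP _ 1) ?rmorph1 ?mulr1.
- move=> l l'; have [b [s [Qs e]]] := ls l; have [b' [s' [Qs' e']]] := ls l'.
  have Qss' : ~ Q (s * s') by move=> /QM[].
  apply: (gcan (s * s')) => //; rewrite (GP _ (b * b')) //; last first.
    by rewrite !rmorphM -e -e'; ring.
  by rewrite !rmorphM -(GP _ _ _ Qs e) -(GP _ _ _ Qs' e'); ring.
exists F => b; rewrite eF; have := GP (phi b) b 1 Q1.
by rewrite !rmorph1 !mul1r; exact.
Qed.

Lemma loc_expP n l : ideal_exp loc_max n l <-> ext_ideal (ideal_exp Q n) l.
Proof.
have [lu ls lk] := locL; have [Q1 QM] := Qp.
have ext_exp b : ideal_exp Q n b -> ideal_exp loc_max n (phi b).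
  elim: n b => [|n IH] b; first by move=> _; exact: ideal_exp0.
  have JP : is_ideal [set b | ideal_exp loc_max n.+1 (phi b)].
    split=> [|x y Jx Jy|a x Jx] /=.
    - by rewrite rmorph0; exact: ideal0.
    - by rewrite rmorphD; exact: idealD.
    - by rewrite rmorphM; exact: idealMl.
  rewrite ideal_expS; apply: (ideal_mul_min (K := Ideal JP)) => x y Qx ny /=.
  by rewrite rmorphM ideal_expS; apply: ideal_mulI; [exact: ext_idealP|exact: IH].
split; last first.
  by move=> [b [s [nb Qs e]]]; apply: (unit_ideal (lu s Qs)); rewrite e; exact: ext_exp.
elim: n {ext_exp} l => [|n IH] l.
  by move=> _; have [b [s [Qs e]]] := ls l; exists b, s; split=> //; exact: ideal_exp0.
rewrite ideal_expS; apply: ideal_mul_min => x y [b [s [Qb Qs e]]] /IH[b' [s' [nb' Qs' e']]].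
exists (b * b'), (s * s'); split; first exact: ideal_mulI.
  by move=> /QM[].
by rewrite !rmorphM -e -e'; ring.
Qed.

(** For maximal [Q] the power [Q^n] is already saturated, since a denominator has an inverse modulo
    [Q^n]. With [loc_dense], B/Q^n and its localized version agree, and so do the cotangent spaces
    in [edim_loc]. *)
Lemma loc_exp_comax n b : comaximal Q -> ideal_exp loc_max n (phi b) <-> ideal_exp Q n b.
Proof.
move=> Qc; rewrite loc_expP; split; last exact: ext_idealP.
move=> /ext_ideal_saturated[s [Qs nsb]].
have [y ny] := comaximal_exp n Qc Qs.
have -> : b = b * (1 - s * y) + y * (s * b) by ring.
by apply: idealD; exact: idealMl.
Qed.

Lemma loc_dense n l : comaximal Q -> exists b, ideal_exp loc_max n (l - phi b).
Proof.
move=> Qc; have [lu ls lk] := locL; have [b [s [Qs e]]] := ls l.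
have [y ny] := comaximal_exp n Qc Qs.
exists (y * b); have -> : l - phi (y * b) = l * phi (1 - s * y).
  by rewrite rmorphB !rmorphM rmorph1 -e; ring.
by apply: idealMl; apply/loc_exp_comax.
Qed.

Lemma edim_loc n : comaximal Q -> has_edim Q n -> has_edim loc_max n.
Proof.
move=> Qc /edimP[v [[vQ vs] vf]]; apply/edimP; exists (phi \o v).
split; [split=> [i|l ml]|move=> a].
- exact/loc_maxP.
- have [b nb] := loc_dense 2 l Qc.
  have Qb : Q b.
    apply/loc_maxP; have -> : phi b = l - (l - phi b) by ring.
    by apply: idealB => //; exact/ideal_exp1/ideal_expSsub.
  have [a ha] := vs b Qb; exists (phi \o a).
  have -> : l - \sum_i (phi \o a) i * (phi \o v) i =
      (l - phi b) + phi (b - \sum_i a i * v i).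
    rewrite rmorphB rmorph_sum addrA subrK; congr (_ - _).
    by apply: eq_bigr => i _; rewrite rmorphM.
  by apply: idealD => //; exact/loc_exp_comax.
- have /choice[b hb] i : exists b, ideal_exp loc_max 2 (a i - phi b) by exact: loc_dense.
  move=> ha i.
  have : ideal_exp loc_max 2 (phi (\sum_j b j * v j)).
    have -> : phi (\sum_j b j * v j) =
        \sum_j a j * (phi \o v) j - \sum_j (a j - phi (b j)) * phi (v j).
      rewrite rmorph_sum -sumrB; apply: eq_bigr => j _ /=; rewrite rmorphM; ring.
    by apply: idealB => //; apply: ideal_sum => j; exact: idealMr.
  move=> /loc_exp_comax-/(_ Qc)/vf/(_ i)/loc_maxP mb; apply: idealBr mb _.
  exact/ideal_exp1/ideal_expSsub.
Qed.

End Localizations.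

Section LocalizationHom.
Variables (B : comPzRingType) (p : Spec B).

Lemma loc_hom_exists : exists phi : {rmorphism B -> localization p}, is_loc p phi.
Proof.
have [|||F eF] := @rmorphism_exists B (localization p) (fun b => loc_pi (frac_of p b)).
- move=> x y; rewrite -[RHS]/(loc_add _ (loc_opp _)) loc_oppE loc_addE.
  by apply: loc_pi_eq => /=; ring.
- by [].
- move=> x y; rewrite -[RHS]/(loc_mul _ _) loc_mulE.
  by apply: loc_pi_eq => /=; ring.
have [p1 pM] := Defs.primeP p.
exists F; split=> [s ps|l|b].
- exists (loc_pi (Fraction 1 ps)); rewrite eF -[LHS]/(loc_mul _ _) loc_mulE.
  by rewrite -[RHS]/(loc_pi (frac_of p 1)); apply: loc_pi_eq => /=; ring.
- case: (repr l) (loc_pi_repr l) => b s ps <-; exists b, s; split=> //.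
  rewrite !eF -[LHS]/(loc_mul _ _) loc_mulE.
  by apply: loc_pi_eq => /=; ring.
- rewrite eF -[0]/(loc_pi (frac_of p 0)) => /loc_piP[u [pu /= e]]; exists u.
  by move: e; rewrite !mulr1 mulr0.
Qed.

End LocalizationHom.

Section Completions.
Variables (A : comPzRingType) (m : ideal A).
Local Notation C := (completion m).

Lemma coord_le (x : C) k n a : (k <= n)%N -> x n = quot_pi _ a -> x k = quot_pi _ a.
Proof.
elim: n => [|n IH]; first by rewrite leqn0 => /eqP->.
rewrite leq_eqVlt => /orP[/eqP->//|kn e]; apply: IH => //; exact: coordP.
Qed.

Lemma coord_repr (x : C) k n : (k <= n)%N -> x k = quot_pi _ (repr (x n)).
Proof. by move=> /coord_le; apply; rewrite quot_pi_repr. Qed.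

Lemma quot_pi0P (I : ideal A) a : quot_pi I a = 0 <-> I a.
Proof. by rewrite -[0](rmorph0 (quot_pi I)) quot_piP subr0. Qed.

Lemma to_completion_hom : exists F : {rmorphism A -> C}, forall a, F a = to_completion m a.
Proof.
apply: rmorphism_exists => [x y||x y] //; apply: completion_eq => n /=.
  by rewrite rmorphB.
by rewrite rmorphM.
Qed.

(** The inverse system is constant from level [N] on. *)
Lemma completion_nilpotent N : (forall x, ideal_exp m N x -> x = 0) -> ring_iso A C.
Proof.
move=> m0; have [F eF] := to_completion_hom; exists F; apply: inj_surj_bij.
  apply: raddf_inj => x /= ; rewrite eF => e; apply: m0; apply/quot_pi0P.
  have := congr1 (fun y : C => y N) e; rewrite -[(0 : C) N]/(quot_pi _ 0) rmorph0; exact.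
move=> y; exists (repr (y N)); rewrite eF; apply: completion_eq => n /=.
have [nN|Nn] := leqP n N; first by rewrite -(coord_repr y nN).
rewrite -[RHS]quot_pi_repr; congr quot_pi.
have : ideal_exp m N (repr (y N) - repr (y n)).
  by apply/quot_piP; rewrite quot_pi_repr; apply: coord_repr; exact: ltnW.
by move=> /m0/eqP; rewrite subr_eq0 => /eqP.
Qed.

Hypothesis mc : comaximal m.

Lemma completion_unit (x : C) : x 1 <> 0 -> is_unit x.
Proof.
move=> x1.
have na n : (0 < n)%N -> ~ m (repr (x n)).
  by move=> /coord_repr ex mx; apply: x1; rewrite ex; apply/quot_pi0P/ideal_exp1.
have /choice[y hy] n : exists y, ideal_exp m n (1 - repr (x n) * y).
  case: n => [|n]; first by exists 0; exact: ideal_exp0.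
  by apply: comaximal_exp => //; exact: na.
have cy : compatible (fun n => quot_pi (ideal_exp m n) (y n)).
  apply: compatibleP => n; exists (y n.+1); split=> //; apply/quot_piP.
  have hx : ideal_exp m n (repr (x n.+1) - repr (x n)).
    by apply/quot_piP; rewrite quot_pi_repr -coord_repr.
  (* The levelwise inverses are compatible because inverses of congruent elements are congruent;
     this identity makes it explicit. *)
  have -> : y n - y n.+1 = y n * (1 - repr (x n.+1) * y n.+1) -
      y n.+1 * (1 - repr (x n) * y n) + y n * y n.+1 * (repr (x n.+1) - repr (x n)).
    by ring.
  by do ?apply: idealD; do ?apply: idealN; apply: idealMl => //; exact: ideal_expSsub.
exists (Completion cy); apply: completion_eq => n.
rewrite -[LHS]/(x n * quot_pi _ (y n)) -[RHS]/(quot_pi _ 1) -[x n]quot_pi_repr -rmorphM.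
by apply/esym/quot_piP.
Qed.

Lemma is_ideal_completion_max : is_ideal [set x : C | x 1 = 0].
Proof.
split=> [|x y /= ex ey|a x /= ex].
- exact: (rmorph0 (quot_pi _)).
- by rewrite -[LHS]/(x 1 + y 1) ex ey addr0.
- by rewrite -[LHS]/(a 1 * x 1) ex mulr0.
Qed.
Definition completion_max : ideal C := Ideal is_ideal_completion_max.

Lemma completion_local : local_at completion_max.
Proof.
split=> [e|x /completion_unit//].
have /quot_pi0P/ideal_exp1 : quot_pi (ideal_exp m 1) 1 = 0 := e.
by case: mc.
Qed.

End Completions.

(** * Regular local domains *)

Section Domains.

Definition domain (A : comPzRingType) :=
  (1 : A) <> 0 /\ forall x y : A, x * y = 0 -> x = 0 \/ y = 0.

Lemma domain_cancel (A : comPzRingType) (x y z : A) :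
  domain A -> x <> 0 -> x * y = x * z -> y = z.
Proof.
move=> [_ dom] x0 e; have : x * (y - z) = 0 by rewrite mulrBr e subrr.
by move=> /dom[//|/eqP]; rewrite subr_eq0 => /eqP.
Qed.

Lemma is_ideal_zero (A : comPzRingType) : is_ideal [set x : A | x = 0].
Proof. by split=> // [x y -> ->|a x ->]; rewrite ?addr0 ?mulr0. Qed.
Definition zero_ideal A : ideal A := Ideal (is_ideal_zero A).

Lemma zero_prime (A : comPzRingType) : domain A -> is_prime (zero_ideal A).
Proof. by []. Qed.

Lemma is_ideal_preim (A B : comPzRingType) (g : {rmorphism A -> B}) (I : ideal B) :
  is_ideal [set a | I (g a)].
Proof.
split=> [|x y Ix Iy|a x Ix] /=.
- by rewrite rmorph0; exact: ideal0.
- by rewrite rmorphD; exact: idealD.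
- by rewrite rmorphM; exact: idealMl.
Qed.
Definition preim_ideal (A B : comPzRingType) (g : {rmorphism A -> B}) (I : ideal B) : ideal A :=
  Ideal (is_ideal_preim g I).

Lemma preim_prime (A B : comPzRingType) (g : {rmorphism A -> B}) (I : ideal B) :
  is_prime I -> is_prime (preim_ideal g I).
Proof.
by move=> [I1 IM]; split=> [|x y]; rewrite /= ?rmorph1 // rmorphM; exact: IM.
Qed.

Lemma gen_map (A B : comPzRingType) (g : {rmorphism A -> B}) (s : seq A) x :
  ideal_gen [set` s] x -> ideal_gen [set` map g s] (g x).
Proof.
apply: (gen_min (J := preim_ideal g (ideal_gen [set` map g s]))) => y ys /=.
by apply: sub_gen; exact: map_f.
Qed.

Lemma has_prime_chain0 (A : comPzRingType) (p : ideal A) :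
  is_prime p -> has_prime_chain A 0.
Proof. by move=> pp; exists (fun=> PrimeIdeal pp) => i j; rewrite !ord1. Qed.

(** The chain of [V] is pulled back to [L] and the zero ideal is put underneath; the inclusion is
    strict because [l] lies in every pullback. *)
Lemma has_prime_chain_hom (L V : comPzRingType) (g : {rmorphism L -> V}) (l : L) d :
  domain L -> (forall v, exists l, g l = v) -> g l = 0 -> l <> 0 ->
  has_prime_chain V d -> has_prime_chain L d.+1.
Proof.
move=> dom gs gl l0 [c cP].
pose c' (i : 'I_d.+2) : Spec L := oapp
  (fun j => PrimeIdeal (preim_prime g (Defs.primeP (c j)))) (PrimeIdeal (zero_prime dom))
  (unlift ord0 i).
exists c' => i j; rewrite /c'.
case: (unliftP ord0 j) => [j' ->|->]; last by rewrite ltn0.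
case: (unliftP ord0 i) => [i' ->|->] ij /=; last first.
  split=> [x ->|H]; first by rewrite /= rmorph0; exact: ideal0.
  by apply/l0/H; rewrite /= gl; exact: ideal0.
have [cij ncij] := cP _ _ (ij : (i' < j')%N).
split=> [x /cij//|H]; apply: ncij => v; have [x <-] := gs v; exact: H.
Qed.

Lemma has_edim1 (A : comPzRingType) (m : ideal A) (u : A) :
  domain A -> (forall x, m x <-> exists w, x = w * u) -> u <> 0 -> has_edim m 1.
Proof.
move=> dom mP u0; have mu : m u by apply/mP; exists 1; rewrite mul1r.
apply/edimP; exists (fun=> u); split; [split=> // x /mP[w ->]|move=> a].
  by exists (fun=> w); rewrite big_ord_recl big_ord0 addr0 subrr; exact: ideal0.
rewrite big_ord_recl big_ord0 addr0 => ha i; rewrite (ord1 i).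
have : exists w, a ord0 * u = w * u * u.
  have IP : is_ideal [set x | exists w, x = w * u * u].
    split=> [|x y [w ->] [z ->]|b x [w ->]].
    - by exists 0; rewrite !mul0r.
    - by exists (w + z); rewrite !mulrDl.
    - by exists (b * w); rewrite !mulrA.
  move: ha; rewrite ideal_expS; apply: (ideal_mul_min (K := Ideal IP)) => x y.
  by move=> /mP[w ->] /ideal_exp1/mP[z ->]; exists (w * z); ring.
move=> [w e]; apply/mP; exists w.
by apply: (@domain_cancel A u) => //; rewrite mulrC e mulrC.
Qed.

(** Carries what is propagated to localized polynomial rings: being a domain is part of the data
    instead of being derived from regularity, and only a chain of length [d] is recorded, the upper
    bound on the dimension coming from [dim_le_edim]. *)
Definition regular_domain (R : comPzRingType) (m : ideal R) (d : nat) :=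
  [/\ noetherian R, local_at m, domain R, has_edim m d & has_prime_chain R d].

Lemma regular_domain_local (R : comPzRingType) (m : ideal R) d :
  regular_domain m d -> regular_local R.
Proof.
move=> [noeth mloc _ md cd]; split=> //; exists m, d; split=> //.
  exact: local_with_local.
by split=> // n; exact: dim_le_edim md.
Qed.

Lemma field_regular (F : comPzRingType) : (1 : F) <> 0 ->
  (forall x : F, x <> 0 -> is_unit x) -> regular_domain (zero_ideal F) 0.
Proof.
move=> F1 Fu; have F0 : local_at (zero_ideal F) by [].
have Fp := comaximal_prime (local_comaximal F0).
have mz x y : ideal_exp (zero_ideal F) 2 (x - y) -> x = y.
  by move=> /ideal_expSsub/ideal_exp1/eqP; rewrite subr_eq0 => /eqP.
split=> //; last exact: has_prime_chain0 Fp.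
- move=> I; have [[x [Ix x0]]|H] := pselect (exists x, I x /\ x <> 0).
    have I1 : I 1 by apply: (unit_ideal (Fu _ x0)); rewrite mulr1.
    exists [:: 1]; apply/seteqP; split=> y _; last exact: ideal1.
    by apply/gen_seq1P; exists y; rewrite mulr1.
  exists [::]; apply/seteqP; split=> y; last by move=> /gen_nilP->; exact: ideal0.
  by move=> Iy; apply/gen_nilP; apply: contrapT => y0; apply: H; exists y.
- apply/edimP; exists (fun i : 'I_0 => 0); split; [split=> [[]//|x /= ->]|by move=> a _ []].
  by exists (fun=> 0); rewrite big_ord0 subr0; exact: ideal0.
Qed.

End Domains.

(** * Completion along a principal maximal ideal *)

Section CompleteDVR.
Variables (W : comPzRingType) (m : ideal W) (u : W).
Hypotheses (mP : forall x, m x <-> exists w, x = w * u) (mc : comaximal m).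
Hypothesis u_nzd : forall x, u * x = 0 -> x = 0.
Local Notation C := (completion m).

Lemma principal_expP n x : ideal_exp m n x <-> exists w, x = w * u ^+ n.
Proof.
split; last first.
  move=> [w ->]; apply: idealMl; elim: n => [|n IH]; first exact: ideal_exp0.
  rewrite exprS ideal_expS; apply: ideal_mulI => //.
  by apply/mP; exists 1; rewrite mul1r.
elim: n x => [|n IH] x; first by exists x; rewrite expr0 mulr1.
have IP : is_ideal [set x | exists w, x = w * u ^+ n.+1].
  split=> [|y z [w ->] [v ->]|b y [w ->]].
  - by exists 0; rewrite !mul0r.
  - by exists (w + v); rewrite !mulrDl.
  - by exists (b * w); rewrite !mulrA.
rewrite ideal_expS; apply: (ideal_mul_min (K := Ideal IP)) => y z.
by move=> /mP[w ->] /IH[v ->]; exists (w * v); rewrite exprS; ring.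
Qed.

Lemma pow_nzd n x : u ^+ n * x = 0 -> x = 0.
Proof.
elim: n => [|n IH]; first by rewrite expr0 mul1r.
by rewrite exprS -mulrA => /u_nzd.
Qed.

Lemma pow_not_exp n : ~ ideal_exp m n.+1 (u ^+ n).
Proof.
move=> /principal_expP[w e]; have : u ^+ n * (1 - w * u) = 0.
  by rewrite mulrBr mulr1 {1}e exprS; ring.
move=> /pow_nzd/eqP; rewrite subr_eq0 => /eqP e1.
by case: mc => m1 _; apply: m1; apply/mP; exists w.
Qed.

Local Notation uh := (to_completion m u).

Lemma coord_pow n k : (uh ^+ n : C) k = quot_pi _ (u ^+ n).
Proof.
have [F eF] := to_completion_hom m.
by rewrite -eF -rmorphXn eF.
Qed.

(** Here [n] is the last level at which [x] vanishes. Representatives of [x] are divided by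
    [u ^+ n], which is possible in a compatible way because [u] is not a zero divisor; the quotient
    is nonzero modulo [m], hence a unit. *)
Lemma completion_dvr (x : C) : x <> 0 -> exists n e, is_unit e /\ x = e * uh ^+ n.
Proof.
move=> x0.
have [n [xn xSn]] : exists n, x n = 0 /\ x n.+1 <> 0.
  have [k xk] : exists k, `[< x k <> 0 >].
    apply: contrapT => /forallNP H; apply: x0; apply: completion_eq => k.
    have -> : x k = 0 by apply: contrapT => xk; apply/(H k)/asboolP.
    exact/esym/(rmorph0 (quot_pi _)).
  case: (@ex_minnP (fun k => `[< x k <> 0 >]) (ex_intro _ k xk)) => -[|n] /asboolP xn nmin.
    case: xn; rewrite -[x 0]quot_pi_repr; apply/quot_pi0P; exact: ideal_exp0.
  exists n; split=> //; apply: contrapT => /asboolP/nmin; by rewrite ltnn.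
(* The shift by [n] makes up for the precision lost in the division: level [n + k] of [x] determines
   level [k] of the quotient. *)
pose a k := repr (x (n + k)%N).
have /choice[b hb] k : exists b, a k = b * u ^+ n.
  apply/principal_expP/quot_pi0P; rewrite -xn; apply/esym/coord_repr.
  exact: leq_addr.
have cb : compatible (fun k => quot_pi (ideal_exp m k) (b k)).
  apply: compatibleP => k; exists (b k.+1); split=> //; apply/quot_piP.
  have : ideal_exp m (n + k) (a k - a k.+1).
    apply/quot_piP; rewrite -!coord_repr //; by rewrite leq_add2l.
  rewrite !hb => /principal_expP[w e]; apply/principal_expP; exists w.
  apply/eqP; rewrite -subr_eq0; apply/eqP/(@pow_nzd n).
  have -> : u ^+ n * (b k - b k.+1 - w * u ^+ k) =
    (b k * u ^+ n - b k.+1 * u ^+ n) - w * (u ^+ n * u ^+ k) by ring.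
  by rewrite -exprD e subrr.
exists n, (Completion cb); split.
  apply: completion_unit => // /quot_pi0P/ideal_exp1/mP[w e]; apply: xSn.
  rewrite -addn1 -[x _]quot_pi_repr; apply/quot_pi0P/principal_expP; exists w.
  by rewrite -/(a 1) hb e exprD expr1; ring.
apply: completion_eq => k; rewrite (coord_repr x (leq_addl n k)) -/(a k) hb rmorphM.
by rewrite -[RHS]/(quot_pi _ (b k) * (uh ^+ n : C) k) coord_pow.
Qed.

Lemma completion_pow_neq0 n : (uh ^+ n : C) <> 0.
Proof.
move=> e; apply: (@pow_not_exp n); apply/quot_pi0P.
by rewrite -coord_pow e -[LHS]/(quot_pi _ 0) rmorph0.
Qed.

Lemma completion_domain : domain C.
Proof.
split=> [e|x y exy]; first by apply: (@completion_pow_neq0 0); rewrite expr0.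
apply: contrapT => /not_orP[/completion_dvr[n [e [eu ex]]] /completion_dvr[k [f [fu ey]]]].
apply: (@completion_pow_neq0 (n + k)).
have : zero_ideal C (e * f * uh ^+ (n + k)) by rewrite /= -[RHS]exy ex ey exprD; ring.
by apply: unit_ideal; exact: is_unitM.
Qed.

Lemma completion_maxP (x : C) : completion_max m x <-> exists w, x = w * uh.
Proof.
have mu : completion_max m uh.
  rewrite /= -[LHS]/(quot_pi _ u); apply/quot_pi0P/ideal_exp1/mP.
  by exists 1; rewrite mul1r.
split=> [mx|[w ->]]; last exact: idealMl.
have [->|/completion_dvr[[|n] [e [eu ex]]]] := pselect (x = 0).
- by exists 0; rewrite mul0r.
- case: (completion_local mc) => C1 _; case: C1; apply: (unit_ideal eu).
  by rewrite -[e * 1]/(e * uh ^+ 0) -ex.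
- by exists (e * uh ^+ n); rewrite ex exprSr mulrA.
Qed.

Lemma completion_regular : regular_domain (completion_max m) 1.
Proof.
have Cloc := completion_local mc.
have Cmax := comaximal_prime (local_comaximal Cloc).
have u0 : uh <> 0 by rewrite -[uh]expr1; exact: completion_pow_neq0.
split=> //; [|exact: completion_domain|exact: has_edim1 completion_domain completion_maxP u0|].
  move=> I; have [H|H] := pselect (exists x, I x /\ x <> 0); last first.
    exists [::]; apply/seteqP; split=> y; last by move=> /gen_nilP->; exact: ideal0.
    by move=> Iy; apply/gen_nilP; apply: contrapT => y0; apply: H; exists y.
  have [n In] : exists n, `[< I (uh ^+ n) >].
    have [x [Ix /completion_dvr[n [e [eu ex]]]]] := H.
    by exists n; apply/asboolP; apply: (unit_ideal eu); rewrite -ex.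
  case: (@ex_minnP (fun n => `[< I (uh ^+ n) >]) (ex_intro _ n In)) => {In}n /asboolP In nmin.
  exists [:: uh ^+ n]; apply/seteqP; split=> y; last first.
    by move=> /gen_seq1P[a ->]; exact: idealMl.
  move=> Iy; apply/gen_seq1P.
  have [->|/completion_dvr[k [e [eu ey]]]] := pselect (y = 0).
    by exists 0; rewrite mul0r.
  have /nmin nk : `[< I (uh ^+ k) >] by apply/asboolP; apply: (unit_ideal eu); rewrite -ey.
  by exists (e * uh ^+ (k - n)); rewrite -mulrA -exprD subnK.
pose pz := PrimeIdeal (zero_prime completion_domain); pose pm := PrimeIdeal Cmax.
exists (fun i : 'I_2 => if i == ord0 then pz else pm) => i j.
case: (unliftP ord0 j) => [j' ->|->]; last by rewrite ltn0.
case: (unliftP ord0 i) => [i' ->|-> _].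
  by rewrite !ord1.
rewrite eqxx /=; split=> [x ->|H]; first exact: (ideal0 (completion_max m)).
by apply/u0/H/completion_maxP; exists 1; rewrite mul1r.
Qed.

End CompleteDVR.

(** Polynomials are formed over nonzero rings. Case analysis on this equality of structures replaces
    a given [comPzRingType] by a [comNzRingType] with the same operations. *)
Lemma nz_structure (V : comPzRingType) : (1 : V) <> 0 ->
  exists Vn : comNzRingType, (Vn : comPzRingType) = V.
Proof.
move=> /eqP h.
exists (HB.pack_for comNzRingType (GRing.ComPzRing.sort V) (GRing.PzSemiRing_isNonZero.Build V h)).
by move: h; case: V => T [].
Qed.

(* [quad b] is [B[y] / (y^2 - b)], on the basis [1, y]; [quad 0] is the ring of
   dual numbers. *)
Definition quad (B : comPzRingType) (b : B) : Type := (B * B)%type.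

Section Quadratic.
Variables (B : comPzRingType) (b : B).
Local Notation quad := (quad b).

HB.instance Definition _ := GRing.Zmodule.copy quad (B * B)%type.

Definition quad_one : quad := (1, 0).
Definition quad_mul (x y : quad) : quad :=
  (x.1 * y.1 + b * (x.2 * y.2), x.1 * y.2 + x.2 * y.1).

Lemma quad_mulA : associative quad_mul.
Proof. by move=> [? ?] [? ?] [? ?]; congr pair => /=; ring. Qed.
Lemma quad_mulC : commutative quad_mul.
Proof. by move=> [? ?] [? ?]; congr pair => /=; ring. Qed.
Lemma quad_mul1 : left_id quad_one quad_mul.
Proof. by move=> [x y]; rewrite /quad_mul /=; congr pair; ring. Qed.
Lemma quad_mulDl : left_distributive quad_mul +%R.
Proof. by move=> [? ?] [? ?] [? ?]; congr pair => /=; ring. Qed.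

HB.instance Definition _ := GRing.Zmodule_isComPzRing.Build quad
  quad_mulA quad_mulC quad_mul1 quad_mulDl.

Lemma quad_addE (x y : quad) : x + y = (x.1 + y.1, x.2 + y.2). Proof. by []. Qed.
Lemma quad_oppE (x : quad) : - x = (- x.1, - x.2). Proof. by []. Qed.
Lemma quad_mulE (x y : quad) :
  x * y = (x.1 * y.1 + b * (x.2 * y.2), x.1 * y.2 + x.2 * y.1).
Proof. by []. Qed.

Lemma quad_in_hom : exists F : {rmorphism B -> quad}, forall x, F x = (x, 0).
Proof.
apply: rmorphism_exists => [x y||x y] //.
  by rewrite quad_addE quad_oppE /= oppr0 addr0.
by rewrite quad_mulE /=; congr pair; ring.
Qed.

(** The inverse is the conjugate divided by the norm. *)
Lemma quad_unit (x : quad) : is_unit (x.1 * x.1 - b * (x.2 * x.2)) -> is_unit x.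
Proof.
move=> [v ev]; exists (x.1 * v, - x.2 * v); rewrite quad_mulE.
by congr pair => /=; rewrite -?ev; ring.
Qed.

(** As a [B]-module, [quad] is an extension of [B] by [B]: lifts of generators of the ideal of first
    coordinates, together with generators of the ideal of those [y] with [(0, y)] in [I], generate
    [I]. *)
Lemma noetherian_quad : noetherian B -> noetherian quad.
Proof.
move=> noeth I.
have IP : is_ideal [set x | exists y, I (x, y)].
  split=> [|x y [x' Ix] [y' Iy]|a x [x' Ix]].
  - by exists 0; exact: ideal0.
  - exists (x' + y'); rewrite -[(_, _)]/((x, x') + (y, y') : quad); exact: idealD.
  - exists (a * x'); have -> : (a * x, a * x') = ((a, 0) : quad) * (x, x').
      by rewrite quad_mulE /=; congr pair; ring.
    exact: idealMl.
have JP : is_ideal [set y | I (0, y)].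
  split=> [|x y Ix Iy|a x Ix] /=.
  - exact: ideal0.
  - have -> : (0, x + y) = (0, x) + (0, y) :> quad by rewrite quad_addE /= addr0.
    exact: idealD.
  - have -> : (0, a * x) = ((a, 0) : quad) * (0, x).
      by rewrite quad_mulE /=; congr pair; ring.
    exact: idealMl.
have [F eF] := quad_in_hom.
have [s es] := noeth (Ideal IP); have [t et] := noeth (Ideal JP).
have [s' [s'I s's]] : exists s' : seq quad, [set` s'] `<=` I /\
    forall x, ideal_gen [set` s] x -> exists y, ideal_gen [set` s'] (x, y).
  have : [set` s] `<=` Ideal IP by rewrite es; exact: sub_gen.
  elim: s {es} => [|g s IH] sI.
    exists [::]; split=> // x /gen_nilP->; exists 0; exact: ideal0.
  have [|s' [s'I Hs']] := IH; first by move=> x xs; apply: sI; rewrite /= inE [x \in s]xs orbT.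
  have [|h Igh] := sI g; first by rewrite /= mem_head.
  exists ((g, h) :: s'); split.
    by move=> x /=; rewrite inE => /orP[/eqP->|/s'I].
  move=> x /gen_consP[a [y [sy ->]]]; have [z yz] := Hs' y sy.
  exists (a * h + z); apply/gen_consP; exists (a, 0), (y, z); split=> //.
  by rewrite quad_mulE quad_addE /=; congr pair; ring.
pose t' : seq quad := [seq (0, y) | y <- t].
have t't y : ideal_gen [set` t] y -> ideal_gen [set` t'] ((0, y) : quad).
  have KP : is_ideal [set y | ideal_gen [set` t'] ((0, y) : quad)].
    split=> [|x z Ix Iz|a x Ix] /=.
    - exact: ideal0.
    - have -> : (0, x + z) = (0, x) + (0, z) :> quad by rewrite quad_addE /= addr0.
      exact: idealD.
    - have -> : (0, a * x) = ((a, 0) : quad) * (0, x).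
        by rewrite quad_mulE /=; congr pair; ring.
      exact: idealMl.
  apply: (gen_min (J := Ideal KP)) => z zt /=.
  by apply: sub_gen; apply/mapP; exists z.
exists (s' ++ t'); apply/seteqP; split=> [[x y] Ixy|]; last first.
  apply: gen_min => x /=; rewrite mem_cat => /orP[/s'I//|/mapP[y yt ->]].
  have : Ideal JP y by rewrite et; exact: sub_gen.
  exact.
have [|z gz] := s's x; first by rewrite -es; exists y.
have Iz : I (x, z) by apply: gen_min gz.
apply/gen_catP; exists (x, z), (0, y - z); split=> //.
  apply: t't; rewrite -et /=.
  have -> : (0, y - z) = (x, y) - (x, z) :> quad.
    by rewrite quad_oppE quad_addE /= subrr.
  exact: idealB.
by rewrite quad_addE /= addr0 addrC subrK.
Qed.

End Quadratic.

(** * Polynomial rings: Hilbert's basis theorem and regularity at (m, X) *)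

Section PolynomialRing.
Variable V : comNzRingType.
Implicit Types (p q : {poly V}) (I : ideal V).

Lemma poly_decomp p : exists q, p = q * 'X + (p`_0)%:P.
Proof.
elim/poly_ind: p => [|p c _]; first by exists 0; rewrite mul0r coef0 addr0.
by exists p; rewrite coefD coefMX coefC /= add0r.
Qed.

(** [Lc n] collects the coefficients of degree [n] of the members of [I] of degree at most [n].
    These ideals increase and are stationary from [N] on, so generators are lifted for the degrees
    up to [N] only, and a power of X serves the higher ones. *)
Lemma hilbert_basis : noetherian V -> noetherian {poly V}.
Proof.
move=> noeth I.
pose deg_le n p := forall j, (n < j)%N -> p`_j = 0.
have LP n : is_ideal [set c | exists p, [/\ I p, deg_le n p & c = p`_n]].
  split=> [|_ _ [p [Ip dp ->]] [q [Iq dq ->]]|a _ [p [Ip dp ->]]].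
  - exists 0; split=> [|j _|]; rewrite ?coef0 //; exact: ideal0.
  - exists (p + q); split=> [|j nj|]; rewrite ?coefD //; first exact: idealD.
    by rewrite dp // dq // addr0.
  - exists (a%:P * p); split=> [|j nj|]; rewrite ?coefCM //; first exact: idealMl.
    by rewrite dp // mulr0.
pose Lc n := Ideal (LP n).
have LS n : Lc n `<=` Lc n.+1.
  move=> _ [p [Ip dp ->]]; exists (p * 'X); split; first exact: idealMr.
    by move=> [|j] // nj; rewrite coefMX /= dp.
  by rewrite coefMX.
have [N HN] := noetherian_acc noeth LS.
have /choice[t tP] k : exists t : seq {poly V}, [set` t] `<=` I /\
    forall c, Lc k c -> exists p, [/\ ideal_gen [set` t] p, deg_le k p & c = p`_k].
  have [s es] := noeth (Lc k).
  have sL : [set` s] `<=` Lc k by rewrite es; exact: sub_gen.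
  rewrite es; elim: s sL {es} => [|g s IH] sL.
    exists [::]; split=> // c /gen_nilP->; exists 0; split=> [|j _|]; rewrite ?coef0 //.
    exact: ideal0.
  have [|t [tI Ht]] := IH; first by move=> x xs; apply: sL; rewrite /= inE [x \in s]xs orbT.
  have [|p [Ip dp ep]] := sL g; first by rewrite /= mem_head.
  exists (p :: t); split; first by move=> x /=; rewrite inE => /orP[/eqP->|/tI].
  move=> _ /gen_consP[a [c [sc ->]]]; have [q [tq dq ->]] := Ht c sc.
  exists (a%:P * p + q); split=> [|j kj|].
  - by apply/gen_consP; exists a%:P, q.
  - by rewrite coefD coefCM dp // dq // mulr0 addr0.
  - by rewrite coefD coefCM ep.
pose G := flatten [seq t k | k <- iota 0 N.+1].
exists G; apply/seteqP; split; last first.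
  apply: gen_min => x /flatten_mapP[k _ xt]; by have [tI _] := tP k; exact: tI.
have tG k : (k <= N)%N -> ideal_gen [set` t k] `<=` ideal_gen [set` G].
  move=> kN; apply: gen_min => x xt; apply: sub_gen; apply/flatten_mapP.
  by exists k => //; rewrite mem_iota.
suff H n p : I p -> (forall j, (n <= j)%N -> p`_j = 0) -> ideal_gen [set` G] p.
  by move=> p Ip; apply: (H (size p)) => // j; exact: nth_default.
elim: n p => [|n IH] p Ip dp.
  suff -> : p = 0 by exact: ideal0.
  by apply/polyP => j; rewrite dp // coef0.
pose k := minn n N.
have kN : (k <= N)%N := geq_minr _ _.
have : Lc k p`_n.
  have Ln : Lc n p`_n by exists p.
  rewrite /k /minn; case: ltnP => // Nn; exact: HN Ln.
have [_ /[apply] [[q [tq dq e]]]] := tP k.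
have -> : p = (p - q * 'X^(n - k)) + q * 'X^(n - k) by rewrite subrK.
have Gq := tG _ kN _ tq.
have Iq : I q by apply: gen_min tq; case: (tP k).
apply: idealD; last exact: idealMr.
apply: IH => [|j]; first by apply: idealB => //; exact: idealMr.
have kn : (k <= n)%N := geq_minl _ _.
rewrite leq_eqVlt coefB coefMXn => /orP[/eqP<-|nj].
  by rewrite ltnNge leq_subr /= subKn // e subrr.
rewrite dp // ltnNge (leq_trans (leq_subr _ _) (ltnW nj)) /= dq ?subrr //.
by rewrite ltn_subRL subnK // .
Qed.

Lemma poly_domain : domain V -> domain {poly V}.
Proof.
move=> [_ dom]; split=> [/eqP|p q e]; first by rewrite oner_eq0.
apply: contrapT => /not_orP[/eqP p0 /eqP q0].
have : lead_coef p * lead_coef q != 0.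
  by apply/eqP => /dom[/eqP|/eqP]; rewrite lead_coef_eq0; apply/negP.
by move=> h; have := lead_coef_proper_mul h; rewrite e lead_coef0 => e0; rewrite -e0 eqxx in h.
Qed.

Lemma is_ideal_coefs I : is_ideal [set p : {poly V} | forall j, I p`_j].
Proof.
split=> [j|p q Ip Iq j|a p Ip j] /=.
- by rewrite coef0; exact: ideal0.
- by rewrite coefD; exact: idealD.
- by rewrite coefM; apply: ideal_sum => i; exact: idealMl.
Qed.
Definition coef_ideal I : ideal {poly V} := Ideal (is_ideal_coefs I).

(** A polynomial with unit constant term is invertible as a power series, so it cancels coefficient
    by coefficient, starting from the lowest one. *)
Lemma coef_ideal_cancel I (s p : {poly V}) : is_unit s`_0 -> coef_ideal I (s * p) -> coef_ideal I p.
Proof.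
move=> su Isp j /=; have [n] := ubnP j; elim: n j => // n IH j; rewrite ltnS => jn.
apply: (unit_ideal su); have := Isp j; rewrite coefM big_ord_recl /= subn0.
set S := \sum_(i < j) _ => h; have -> : s`_0 * p`_j = (s`_0 * p`_j + S) - S by rewrite addrK.
apply: idealB => //; apply: ideal_sum => i; apply: idealMl; apply: IH.
by rewrite /bump /=; apply: leq_trans jn; rewrite ltn_subrL (leq_ltn_trans _ (ltn_ord i)).
Qed.

End PolynomialRing.

Section LocalPolynomialRing.
Variables (V : comNzRingType) (m : ideal V) (d : nat).
Hypothesis Vreg : regular_domain m d.

Lemma is_ideal_coef0 : is_ideal [set p : {poly V} | m p`_0].
Proof.
split=> [|p q mp mq|a p mp] /=.
- by rewrite coef0; exact: ideal0.
- by rewrite coefD; exact: idealD.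
- by rewrite coef0M; exact: idealMl.
Qed.
Definition poly_max : ideal {poly V} := Ideal is_ideal_coef0.

Lemma poly_max_comaximal : comaximal poly_max.
Proof.
have [_ [m1 mu] _ _ _] := Vreg.
split=> [|p /= /mu[y ey]] /=; first by rewrite coef1.
exists y%:P => /=; rewrite coefB coef1 coefMC /= ey subrr; exact: ideal0.
Qed.

Lemma poly_max_prime : is_prime poly_max.
Proof. exact: comaximal_prime poly_max_comaximal. Qed.

Lemma polyC_exp n x : ideal_exp m n x -> ideal_exp poly_max n x%:P.
Proof.
elim: n x => [|n IH] x; first by move=> _; exact: ideal_exp0.
rewrite !ideal_expS.
apply: (ideal_mul_min (K := preim_ideal polyC (ideal_mul poly_max (ideal_exp poly_max n)))).
move=> a b ma nb /=; rewrite polyCM; apply: ideal_mulI; last exact: IH.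
by rewrite /= coefC.
Qed.

Lemma poly_edim : has_edim poly_max d.+1.
Proof.
have [_ mloc _ /edimP[v [[vm vs] vf]] _] := Vreg; have [m1 mu] := mloc.
apply/edimP.
pose v' (i : 'I_d.+1) : {poly V} := oapp (fun j => (v j)%:P) 'X (unlift ord0 i).
have v'0 : v' ord0 = 'X by rewrite /v' unlift_none.
have v'S j : v' (lift ord0 j) = (v j)%:P by rewrite /v' liftK.
exists v'; split; [split=> [i|p mp]|move=> a].
- case: (unliftP ord0 i) => [j ->|->]; rewrite ?v'0 ?v'S /=.
    by rewrite coefC /=; exact: vm.
  by rewrite coefX; exact: ideal0.
- have [a ha] := vs _ mp; have [q eq] := poly_decomp p.
  pose a' (i : 'I_d.+1) : {poly V} := oapp (fun j => (a j)%:P) q (unlift ord0 i).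
  have a'0 : a' ord0 = q by rewrite /a' unlift_none.
  have a'S j : a' (lift ord0 j) = (a j)%:P by rewrite /a' liftK.
  exists a'; rewrite big_ord_recl v'0 a'0.
  under eq_bigr do rewrite v'S a'S -polyCM.
  rewrite -rmorph_sum {1}eq opprD addrACA subrr add0r -polyCB; exact: polyC_exp.
(* A member of (m, X)^2 has constant coefficient in m^2 and linear coefficient in m. The first fact
   handles the coefficients of the [v j], the second that of X. *)
- have KP : is_ideal [set p : {poly V} | ideal_exp m 2 p`_0 /\ m p`_1].
    split=> [|p q [p0 p1] [q0 q1]|b p [p0 p1]] /=.
    + by rewrite !coef0; split; exact: ideal0.
    + by rewrite !coefD; split; exact: idealD.
    + rewrite coef0M; split; first exact: idealMl.
      rewrite coefM !big_ord_recl big_ord0 addr0 /= /bump /= subnn subn0.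
      apply: idealD; apply: idealMl => //; exact/ideal_exp1/ideal_expSsub.
  have sub2 p : ideal_exp poly_max 2 p -> ideal_exp m 2 p`_0 /\ m p`_1.
    rewrite ideal_expS; apply: (ideal_mul_min (K := Ideal KP)) => q r /= q0 /ideal_exp1 /= r0.
    rewrite coef0M; split; first by apply: ideal_mulI => //; exact/ideal_exp1.
    rewrite coefM !big_ord_recl big_ord0 addr0 /= /bump /= subnn subn0.
    by apply: idealD; [exact: idealMr|exact: idealMl].
  move=> /sub2[]; rewrite big_ord_recl v'0.
  under eq_bigr do rewrite v'S.
  rewrite !coefD !coefMX /= add0r !coef_sum.
  under eq_bigr do rewrite coefMC.
  move=> /vf a0 h i; rewrite /=; case: (unliftP ord0 i) => [j ->|->]; first exact: a0.
  apply: idealBr h _; rewrite opprD addrA subrr add0r; apply: idealN.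
  apply: ideal_sum => j; rewrite coefMC; exact: idealMl.
Qed.

Definition poly_spec : Spec {poly V} := PrimeIdeal poly_max_prime.

Lemma loc_domain (B L : comPzRingType) (Q : ideal B) (phi : {rmorphism B -> L}) :
  is_prime Q -> is_loc Q phi -> domain B -> domain L.
Proof.
move=> Qp locL [B1 dom]; have [lu ls lk] := locL.
have nz s : ~ Q s -> s <> 0 by move=> Qs s0; apply: Qs; rewrite s0; exact: ideal0.
have inj b : phi b = 0 -> b = 0 by move=> /lk[s [/nz s0 /dom[]]].
have l0 l b s : ~ Q s -> phi s * l = phi b -> b = 0 -> l = 0.
  move=> /lu su e b0; apply: (unit_ideal (I := zero_ideal L) su).
  by rewrite e b0 rmorph0.
split=> [|x y exy]; first by rewrite -(rmorph1 phi) => /inj.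
have [b [s [Qs e]]] := ls x; have [b' [s' [Qs' e']]] := ls y.
have /inj/dom[b0|b0] : phi (b * b') = 0.
- have -> : phi (b * b') = phi s * phi s' * (x * y) by rewrite rmorphM -e -e'; ring.
  by rewrite exy mulr0.
- by left; exact: l0 Qs e b0.
- by right; exact: l0 Qs' e' b0.
Qed.

Lemma local_poly_regular (phi : {rmorphism {poly V} -> localization poly_spec})
    (locL : is_loc poly_max phi) :
  regular_domain (loc_max poly_max_prime locL) d.+1.
Proof.
have [noeth [m1 mu] dom _ cd] := Vreg.
have domB := poly_domain dom.
have domL := loc_domain poly_max_prime locL domB.
split.
- exact: noetherian_loc locL (hilbert_basis noeth).
- exact: loc_local.
- exact: domL.
- exact: edim_loc poly_max_comaximal poly_edim.
(* Setting X to zero maps the local ring onto [V] and kills the nonzero element X, which lengthens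
   the chain of [V] by one. *)
have [|||g eg] := @rmorphism_exists {poly V} V (fun p => p`_0).
- by move=> x y; rewrite coefB.
- by rewrite coef1.
- by move=> x y; rewrite coef0M.
have [|G eG] := loc_extend poly_max_prime locL (g := g).
  by move=> s Qs; rewrite eg; exact: mu.
apply: (@has_prime_chain_hom _ _ G (phi 'X)) => //.
- by move=> v; exists (phi v%:P); rewrite eG eg coefC.
- by rewrite eG eg coefX.
- have [_ _ lk] := locL; move=> /lk[s [Qs /domB.2[s0|/eqP]]]; last by rewrite polyX_eq0.
  by apply: Qs; rewrite s0; exact: ideal0.
Qed.

End LocalPolynomialRing.

(** * Complete intersections *)

(** [C] is [R / (f)] with [R] a regular local domain. The notion concerns [C] itself and not its
    completion, so it can be propagated through [quad] before [ci_of_presented] applies it to a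
    completion. *)
Definition ci_presented (C : comPzRingType) :=
  exists (R : comPzRingType) (m : ideal R) (d : nat) (f : seq R) (g : {rmorphism R -> C}),
    [/\ regular_domain m d, regular_sequence f, forall c, exists r, g r = c &
        forall r, g r = 0 <-> ideal_gen [set` f] r].

Lemma regular_ci (R : comPzRingType) (m : ideal R) d :
  regular_domain m d -> ci_presented R.
Proof.
move=> Rreg; have [_ _ [R1 _] _ _] := Rreg.
exists R, m, d, [::], idfun; split=> // [|c|r].
- by split=> // /gen_nilP.
- by exists c.
- by rewrite gen_nilP.
Qed.

Lemma ci_presented_iso (C C' : comPzRingType) :
  ring_iso C C' -> ci_presented C -> ci_presented C'.
Proof.
move=> [h [h' hK h'K]] [R [m [d [f [g [Rreg fr gs gk]]]]]].
exists R, m, d, f, (h \o g); split=> // [c|r].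
  by have [r er] := gs (h' c); exists r; rewrite /= er h'K.
by rewrite -gk /=; split=> [|->]; [rewrite -(rmorph0 h); exact: (can_inj hK)|exact: rmorph0].
Qed.

Lemma ci_of_presented (A : comPzRingType) (m : ideal A) :
  ci_presented (completion m) -> complete_intersection m.
Proof.
move=> [R [n [d [f [g [Rreg fr gs gk]]]]]]; exists R, f; split=> //.
  exact: regular_domain_local Rreg.
exact: ring_iso_quot gs gk.
Qed.

Lemma poly_eval_exists (V : comNzRingType) (C : comPzRingType)
    (g : {rmorphism V -> C}) (y : C) : (1 : C) <> 0 ->
  exists h : {rmorphism {poly V} -> C}, (forall c, h c%:P = g c) /\ h 'X = y.
Proof.
move=> /nz_structure[Cn eC]; case: _ / eC in g y *.
have cy : commr_rmorph g y by move=> x; exact: mulrC.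
exists (horner_morph cy); split=> [c|]; first exact: horner_morphC.
exact: horner_morphX.
Qed.

Section QuadraticExtension.
Variables (V : comNzRingType) (m : ideal V) (d : nat).
Hypothesis Vreg : regular_domain m d.
Variables (C : comPzRingType) (f : seq V) (g : {rmorphism V -> C}) (beta : V).
Hypotheses (freg : regular_sequence f) (gs : forall c, exists r, g r = c).
Hypothesis gk : forall r, g r = 0 <-> ideal_gen [set` f] r.
Hypothesis mbeta : m beta.
Let C' := quad (g beta).
Let h0 : {poly V} := 'X * 'X - beta%:P.

(** Division by the monic [h0]. The congruence on [r0] ensures that a polynomial outside (m, X)
    keeps a remainder with constant term outside [m]. *)
Lemma poly_quad_division (p : {poly V}) : exists q r0 r1,
  p = h0 * q + (r0%:P + r1%:P * 'X) /\ m (r0 - p`_0).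
Proof.
elim/poly_ind: p => [|p c [q [r0 [r1 [-> mr]]]]].
  exists 0, 0, 0; rewrite coef0 subr0; split; last exact: ideal0.
  by rewrite polyC0; ring.
exists (q * 'X + r1%:P), (c + beta * r1), r0; split.
  by rewrite /h0 polyCD polyCM; ring.
by rewrite coefD coefMX coefC /= add0r addrAC subrr add0r; exact: idealMr.
Qed.

(** If [C] is V/(f), then [quad (g beta)] is the localization of V[X] at (m, X) modulo [f] and X^2 -
    beta. Since [beta] is in [m], every polynomial outside (m, X) already becomes a unit in the
    quadratic extension, so localizing does not change the quotient. *)
Theorem quad_ci_presented : ci_presented C'.
Proof.
have [noeth [m1 mu] dom _ cd] := Vreg.
have [F eF] := quad_in_hom (g beta).
have C1 : (1 : C') <> 0.
  move=> /(congr1 fst) /= e; case: freg => f1 _; apply/f1/gk.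
  by rewrite rmorph1.
have [h [hC hX]] := poly_eval_exists (F \o g) ((0, 1) : C') C1.
have hE q r0 r1 : h (h0 * q + (r0%:P + r1%:P * 'X)) = (g r0, g r1).
  rewrite rmorphD rmorphM /h0 rmorphB rmorphM hX hC /= eF.
  rewrite [X in X * _](_ : _ = 0); last first.
    by rewrite quad_mulE quad_oppE quad_addE /=; congr pair; ring.
  rewrite mul0r add0r rmorphD rmorphM hX !hC /= !eF.
  by rewrite quad_mulE quad_addE /=; congr pair; ring.
pose Qp := poly_max_prime Vreg.
have [phi locL] := loc_hom_exists (poly_spec Vreg).
have [lu ls lk] := locL.
(* The norm [r0 * r0 - beta * (r1 * r1)] of the image of [s] comes from an element outside [m]. *)
have hu s : ~ poly_max m s -> is_unit (h s).
  move=> ms; have [q [r0 [r1 [es mr]]]] := poly_quad_division s.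
  rewrite es hE; apply: quad_unit => /=.
  have [|v ev] := mu (r0 * r0 - beta * (r1 * r1)).
    move=> mN; have mp := comaximal_prime (local_comaximal (conj m1 mu)).
    have : m (r0 * r0).
      have -> : r0 * r0 = (r0 * r0 - beta * (r1 * r1)) + beta * (r1 * r1) by ring.
      by apply: idealD => //; exact: idealMr.
    move=> /mp.2 mr0; apply: ms => /=.
    have -> : s`_0 = r0 - (r0 - s`_0) by ring.
    by apply: idealB => //; case: mr0.
  by exists (g v); rewrite -!rmorphM -rmorphB -rmorphM ev rmorph1.
have [H eH] := loc_extend Qp locL hu.
pose psi : {rmorphism V -> localization (poly_spec Vreg)} := phi \o polyC.
pose f' := map psi f ++ [:: phi h0].
(* Ideals extended from [V] are detected coefficientwise. *)
have coefsP t (p : {poly V}) :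
    ideal_gen [set` map psi t] (phi p) <-> forall j, ideal_gen [set` t] p`_j.
  split=> [|tp].
    set K := ext_ideal Qp locL (coef_ideal (ideal_gen [set` t])).
    have : [set` map psi t] `<=` K.
      move=> _ /mapP[x xt ->]; apply: ext_idealP => j /=; rewrite coefC.
      by case: eqP => _; [exact: sub_gen|exact: ideal0].
    move=> /gen_min h1 /h1 /ext_ideal_saturated[s [Qs]] /coef_ideal_cancel; apply.
    exact: mu.
  rewrite -[p]coefK poly_def rmorph_sum; apply: ideal_sum => i.
  rewrite -mul_polyC rmorphM; apply: idealMr; exact: gen_map.
have kerP l : H l = 0 <-> ideal_gen [set` f'] l.
  have [p [s [Qs e]]] := ls l; split=> [Hl|].
    have : h p = 0 by rewrite -eH -e rmorphM Hl mulr0.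
    have [q [r0 [r1 [ep _]]]] := poly_quad_division p.
    rewrite {1}ep hE => -[/gk fr0 /gk fr1].
    apply: (unit_ideal (lu s Qs)); rewrite e ep rmorphD rmorphM.
    apply: idealD.
      by apply/idealMr/sub_gen; rewrite /= mem_cat mem_seq1 eqxx orbT.
    apply/gen_catP; exists (phi (r0%:P + r1%:P * 'X)), 0; rewrite addr0; split=> //.
      rewrite rmorphD rmorphM; apply: idealD; last apply: idealMr; exact: gen_map.
    exact: ideal0.
  have : [set` f'] `<=` preim_ideal H (zero_ideal _).
    move=> x /=; rewrite mem_cat mem_seq1 => /orP[/mapP[y yf ->]|/eqP->].
      rewrite eH hC /= eF; have -> : g y = 0 by apply/gk/sub_gen.
      by [].
    rewrite eH; have := hE 1 0 0; rewrite mulr1 polyC0 mul0r !addr0 rmorph0.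
    exact.
  by move=> /gen_min; apply.
exists (localization (poly_spec Vreg)), (loc_max Qp locL), d.+1, f', H.
split=> //; [exact: local_poly_regular| |].
  split=> [/kerP|i]; first by rewrite rmorph1.
  rewrite size_cat size_map addn1 ltnS leq_eqVlt => /orP[/eqP ei|i_f] l.
    have -> : take i f' = map psi f by rewrite ei -(size_map psi) take_size_cat.
    have -> : nth 0 f' i = phi h0 by rewrite ei nth_cat size_map ltnn subnn.
    have [p [s [Qs e]]] := ls l => fl.
    apply: (unit_ideal (lu s Qs)); rewrite e; apply/coefsP.
    have : ideal_gen [set` map psi f] (phi (h0 * p)).
      have -> : phi (h0 * p) = phi s * (phi h0 * l) by rewrite rmorphM -e; ring.
      exact: idealMl.
    move=> /coefsP cf j.
    (* [h0] is a non-zero-divisor modulo (f) because it is monic: the coefficient of degree [j.+2]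
       of [h0 * p] is [p_j - beta * p_(j+2)], and the induction descends from the degree of [p],
       beyond which coefficients vanish. *)
    have [k] := ubnP (size p - j)%N; elim: k j => // k IH j; rewrite ltnS => jk.
    have [pj|jp] := leqP (size p) j; first by rewrite nth_default //; exact: ideal0.
    have := cf j.+2; rewrite /h0 mulrBl coefB -mulrA coefXM /= coefXM /= coefCM => hj.
    have -> : p`_j = (p`_j - beta * p`_j.+2) + beta * p`_j.+2 by ring.
    apply: idealD => //; apply: idealMl; apply: IH.
    by apply: leq_trans jk; apply: ltn_sub2l.
  have -> : take i f' = map psi (take i f).
    by rewrite take_cat size_map i_f map_take.
  have -> : nth 0 f' i = psi (nth 0 f i) by rewrite nth_cat size_map i_f (nth_map 0).
  have [p [s [Qs e]]] := ls l => fl.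
  apply: (unit_ideal (lu s Qs)); rewrite e; apply/coefsP => j.
  have [_ /(_ i i_f)] := freg; apply.
  have : ideal_gen [set` map psi (take i f)] (phi ((nth 0 f i)%:P * p)).
    have -> : phi ((nth 0 f i)%:P * p) = phi s * (psi (nth 0 f i) * l).
      by rewrite rmorphM -e /=; ring.
    exact: idealMl.
  by move=> /coefsP/(_ j); rewrite coefCM.
move=> [c1 c2]; have [x1 <-] := gs c1; have [x2 <-] := gs c2.
by exists (phi (h0 * 0 + (x1%:P + x2%:P * 'X))); rewrite eH hE.
Qed.

End QuadraticExtension.

Lemma ci_presented_quad (V : comPzRingType) (m : ideal V) d (b : V) :
  regular_domain m d -> m b -> ci_presented (quad b).
Proof.
move=> Vreg mb; have [_ _ [V1 _] _ _] := Vreg.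
have [Vn eV] := nz_structure V1; case: _ / eV in m b Vreg mb V1 *.
apply: (@quad_ci_presented Vn m d Vreg Vn [::] idfun b) => //.
- by split=> // /gen_nilP.
- by move=> c; exists c.
- by move=> r; rewrite gen_nilP.
Qed.

Lemma ci_presented_dual (C : comPzRingType) : ci_presented C -> ci_presented (quad (0 : C)).
Proof.
move=> [R [m [d [f [g [Rreg fr gs gk]]]]]]; have [_ _ [R1 _] _ _] := Rreg.
have [Rn eR] := nz_structure R1; case: _ / eR in m f g Rreg fr gs gk R1 *.
have := quad_ci_presented Rreg fr gs gk (ideal0 m); rewrite rmorph0; exact.
Qed.

(** * Maximal ideals of quadratic extensions and dual numbers *)

Section QuadraticIdeals.
Variables (B : comPzRingType) (b : B) (m : ideal B).
Local Notation D := (quad b).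

Lemma is_ideal_quad_max : m b -> is_ideal [set x : D | m x.1].
Proof.
move=> mb; split=> [|x y mx my|a x mx] /=.
- exact: ideal0.
- exact: idealD.
- by apply: idealD; [exact: idealMl|exact: idealMr].
Qed.
Definition quad_max (mb : m b) : ideal D := Ideal (is_ideal_quad_max mb).

Hypothesis mb : m b.
Local Notation n := (quad_max mb).

Lemma quad_max_comaximal : comaximal m -> comaximal n.
Proof.
move=> [m1 mc]; split=> // x /= /mc[y my]; exists (y, 0).
move: my; have -> : 1 - x.1 * y = (1 - x * ((y, 0) : D)).1; last exact.
by rewrite -[RHS]/(1 - (x.1 * y + b * (x.2 * 0))); ring.
Qed.

Lemma quad_exp_in k x : ideal_exp m k x -> ideal_exp n k (x, 0).
Proof.
have [F eF] := quad_in_hom b.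
elim: k x => [|k IH] x; first by move=> _; exact: ideal_exp0.
rewrite !ideal_expS -eF.
apply: (ideal_mul_min (K := preim_ideal F (ideal_mul n (ideal_exp n k)))).
by move=> y z my kz /=; rewrite rmorphM; apply: ideal_mulI; rewrite eF //; exact: IH.
Qed.

Lemma quad_exp_sup k x :
  ideal_exp m k.+1 x.1 -> ideal_exp m k x.2 -> ideal_exp n k.+1 x.
Proof.
case: x => x y /= kx ky.
have -> : (x, y) = (x, 0) + ((0, 1) : D) * (y, 0) :> D.
  by rewrite quad_mulE quad_addE /=; congr pair; ring.
apply: idealD; first exact: quad_exp_in.
rewrite ideal_expS; apply: ideal_mulI; last exact: quad_exp_in.
exact: (ideal0 m).
Qed.

(** With [quad_exp_sup] this computes n^(k+1) as m^(k+1) + m^k y. As y^2 = b lies in m^2, a product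
    of two multiples of y gains the two powers of [m] that their coefficients lack. *)
Lemma quad_exp_sub k x : ideal_exp m 2 b -> ideal_exp n k.+1 x ->
  ideal_exp m k.+1 x.1 /\ ideal_exp m k x.2.
Proof.
move=> m2b; elim: k x => [|k IH] x.
  by move=> /ideal_exp1 mx; split; [exact/ideal_exp1|exact: ideal_exp0].
have KP : is_ideal [set x : D | ideal_exp m k.+2 x.1 /\ ideal_exp m k.+1 x.2].
  split=> [|y z [y1 y2] [z1 z2]|c y [y1 y2]] /=.
  - by split; exact: ideal0.
  - by split; exact: idealD.
  - split; apply: idealD; try (by apply: idealMl); last by apply/idealMl/ideal_expSsub.
    rewrite mulrCA; apply: idealMl; apply: (@ideal_exp_le _ _ k.+2 (2 + k.+1)) => //.
    exact: ideal_expM.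
rewrite ideal_expS; apply: (ideal_mul_min (K := Ideal KP)) => y z my /IH[z1 z2] /=.
have y1 := (ideal_exp1 m y.1).2 my.
split; apply: idealD.
- by rewrite ideal_expS; apply: ideal_mulI.
- rewrite mulrCA; apply: idealMl; exact: (ideal_expM (m := 2) (n := k)).
- by rewrite ideal_expS; apply: ideal_mulI.
- exact: idealMl.
Qed.

End QuadraticIdeals.

Section Dual.
Variables (B : comPzRingType) (m : ideal B).
Definition dual_max : ideal (quad (0 : B)) := quad_max (ideal0 m).

Lemma dual_local : local_at m -> local_at dual_max.
Proof.
move=> [m1 mu]; split=> // x /= /mu xu; apply: quad_unit.
by rewrite mul0r subr0; exact: is_unitM.
Qed.

Lemma dual_nilpotent N : (forall x, ideal_exp m N x -> x = 0) ->
  forall x, ideal_exp dual_max N.+1 x -> x = 0.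
Proof.
move=> m0 [x y] /(quad_exp_sub (ideal0 _))[/= /ideal_expSsub/m0-> /m0->].
by [].
Qed.

(** The basis is the old one together with the nilpotent generator [(0, 1)]. *)
Lemma dual_edim n : comaximal m -> has_edim m n -> has_edim dual_max n.+1.
Proof.
move=> [m1 mc] /edimP[v [[vm vs] vf]]; apply/edimP.
pose v' (i : 'I_n.+1) : quad 0 := oapp (fun j => (v j, 0)) (0, 1) (unlift ord0 i).
have v'0 : v' ord0 = (0, 1) by rewrite /v' unlift_none.
have v'S j : v' (lift ord0 j) = (v j, 0) by rewrite /v' liftK.
have [F eF] := quad_in_hom (0 : B).
have sumE (a : 'I_n -> quad (0 : B)) : \sum_j a j * ((v j, 0) : quad 0) =
    (\sum_j (a j).1 * v j, \sum_j (a j).2 * v j).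
  elim/big_rec3: _ => // j x y z _ ->; rewrite quad_mulE quad_addE /=.
  by congr pair; ring.
exists v'; split; [split=> [i|[x y] /= mx]|move=> a].
- case: (unliftP ord0 i) => [j ->|->]; rewrite ?v'0 ?v'S /=; first exact: vm.
  exact: ideal0.
- have [a ha] := vs _ mx.
  pose a' (i : 'I_n.+1) : quad 0 := oapp (fun j => (a j, 0)) (y, 0) (unlift ord0 i).
  have a'0 : a' ord0 = (y, 0) by rewrite /a' unlift_none.
  have a'S j : a' (lift ord0 j) = (a j, 0) by rewrite /a' liftK.
  exists a'; rewrite big_ord_recl v'0 a'0.
  under eq_bigr do rewrite v'S a'S.
  have -> : \sum_j ((a j, 0) : quad (0 : B)) * (v j, 0) = (\sum_j a j * v j, 0).
    rewrite (sumE (fun j => (a j, 0))) /=; congr pair.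
    by rewrite big1 // => j _; rewrite mul0r.
  have := quad_exp_in (ideal0 m) ha.
  have -> // : (x - \sum_i a i * v i, 0) = (x, y) -
      (((y, 0) : quad (0 : B)) * (0, 1) + (\sum_j a j * v j, 0)) :> quad (0 : B).
  by rewrite quad_mulE quad_addE quad_oppE quad_addE /=; congr pair; ring.
- rewrite big_ord_recl v'0.
  under eq_bigr do rewrite v'S.
  rewrite sumE quad_mulE => /(quad_exp_sub (ideal0 _))[/= h1 h2] i.
  have mj j : m (a (lift ord0 j)).1.
    apply: (vf (fun j => (a (lift ord0 j)).1)); move: h1.
    by rewrite mulr0 mul0r !add0r.
  case: (unliftP ord0 i) => [j ->|->]; first exact: mj.
  move: h2 => /ideal_exp1 h2; move: h2; rewrite mulr1 mulr0 addr0 => h2.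
  apply: idealBr h2 _; rewrite opprD addrA subrr add0r; apply: idealN.
  by apply: ideal_sum => j; exact: idealMl.
Qed.

End Dual.

(** * Iterated dual numbers and two criteria for membership in the locus *)

Fixpoint iter_dual (k : nat) (B : comPzRingType) : comPzRingType :=
  if k is k'.+1 then quad (0 : iter_dual k' B) else B.

Lemma noetherian_iter_dual k B : noetherian B -> noetherian (iter_dual k B).
Proof. by elim: k => //= k IH /IH; exact: noetherian_quad. Qed.

Lemma iter_dual_field (F : comPzRingType) k : (1 : F) <> 0 ->
  (forall x : F, x <> 0 -> is_unit x) ->
  [/\ noetherian (iter_dual k F), ci_presented (iter_dual k F) &
    exists m : ideal (iter_dual k F), [/\ local_at m, has_edim m k &
      forall x, ideal_exp m k.+1 x -> x = 0]].
Proof.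
move=> F1 Fu; have Freg := field_regular F1 Fu.
have [noethF F0 _ edimF _] := Freg.
elim: k => [|k [noeth ci [m [mloc medim mnil]]]].
  split=> //; first exact: regular_ci Freg.
  by exists (zero_ideal F); split=> // x /ideal_exp1.
split; [exact: noetherian_quad|exact: ci_presented_dual|].
exists (dual_max m); split; first exact: dual_local.
  exact: dual_edim (local_comaximal mloc) medim.
exact: dual_nilpotent.
Qed.

(** The maximal ideal is nilpotent: the ring is its own completion, and its dimension is zero
    because every prime contains the maximal ideal, so that [local_height] applies with no
    generator. The codimension is therefore [k]; the case [k = 0] covers fields. *)
Lemma CI_le_dual (F L : comPzRingType) k c : (1 : F) <> 0 ->
  (forall x : F, x <> 0 -> is_unit x) -> ring_iso (iter_dual k F) L -> (k <= c)%N ->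
  CI_le c L.
Proof.
move=> F1 Fu iso kc; have [noeth ci [m [mloc medim mnil]]] := iter_dual_field k F1 Fu.
have [h [h' hK h'K]] := iso.
have locL : is_loc m h.
  split=> [s /mloc.2[v e]|l|b].
  - by exists (h v); rewrite -rmorphM e rmorph1.
  - by exists (h' l), 1; rewrite rmorph1 mul1r h'K; split=> //; case: mloc.
  - rewrite -(rmorph0 h) => /(can_inj hK)->; exists 1; rewrite mul1r.
    by split=> //; case: mloc.
have mc := local_comaximal mloc; have mp := comaximal_prime mc.
have Lloc := loc_local mp locL.
have Lnoeth := noetherian_loc locL noeth.
have Lnil x : ideal_exp (loc_max mp locL) k.+1 x -> x = 0.
  rewrite -[x]h'K loc_exp_comax // => /mnil->; exact: rmorph0.
exists (loc_max mp locL); split.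
- by split=> //; exact: local_with_local.
- apply: ci_of_presented; apply: ci_presented_iso ci.
  exact: ring_iso_trans iso (completion_nilpotent Lnil).
- exists k => //; exists k, 0; rewrite add0n; split=> //; first exact: edim_loc.
  split; first exact: has_prime_chain0 (comaximal_prime (local_comaximal Lloc)).
  move=> n; apply: (local_height (g := [::]) Lnoeth Lloc) => // r rp _.
  by apply: (prime_sub_exp (n := k.+1) rp) => x /Lnil->; exact: ideal0.
Qed.

Lemma has_prime_chain1 (A : comPzRingType) (m : ideal A) (x : A) :
  domain A -> is_prime m -> m x -> x <> 0 -> has_prime_chain A 1.
Proof.
move=> dom mp mx x0.
exists (fun i : 'I_2 => if i == ord0 then PrimeIdeal (zero_prime dom) else PrimeIdeal mp) => i j.
case: (unliftP ord0 j) => [j' ->|->]; last by rewrite ltn0.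
case: (unliftP ord0 i) => [i' ->|-> _]; first by rewrite !ord1.
rewrite eqxx /=; split=> [y ->|H]; first exact: (ideal0 m).
exact/x0/H.
Qed.

Lemma CI_le_dvr (L : comPzRingType) (m : ideal L) (u : L) c : noetherian L -> local_at m ->
  domain L -> (forall x, m x <-> exists w, x = w * u) -> u <> 0 -> CI_le c L.
Proof.
move=> noeth mloc dom mP u0; have mc := local_comaximal mloc.
have medim := has_edim1 dom mP u0.
have u_nzd x : u * x = 0 -> x = 0 by move=> /dom.2[].
exists m; split.
- by split=> //; exact: local_with_local.
- apply: ci_of_presented; exact: regular_ci (completion_regular mP mc u_nzd).
- exists 0 => //; exists 1, 1; split=> //; split; last by move=> n; exact: dim_le_edim medim.
  apply: has_prime_chain1 dom (comaximal_prime mc) _ u0.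
  by apply/mP; exists 1; rewrite mul1r.
Qed.

(** * Quadratic extensions over a principal maximal ideal *)

Section QuadraticOverDVR.
Variables (W : comPzRingType) (m : ideal W) (u a : W).
Hypotheses (mP : forall x, m x <-> exists w, x = w * u) (mc : comaximal m).
Hypothesis u_nzd : forall x, u * x = 0 -> x = 0.
Let b := u ^+ 2 * a.
Local Notation D := (quad b).

Let mu : m u.
Proof. by apply/mP; exists 1; rewrite mul1r. Qed.

Let m2b : ideal_exp m 2 b.
Proof. by apply/(principal_expP mP); exists a; rewrite mulrC. Qed.

Let mb : m b.
Proof. exact/ideal_exp1/ideal_expSsub. Qed.

Local Notation n := (quad_max mb).

Let nc : comaximal n := quad_max_comaximal mb mc.

(** The cotangent basis is u, y: as [b] lies in m^2, the relation y^2 = b has no linear part. *)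
Lemma quad_edim : has_edim n 2.
Proof.
apply/edimP; pose v (i : 'I_2) : D := if i == ord0 then (u, 0) else (0, 1).
have sumE (c : 'I_2 -> D) : \sum_i c i * v i =
    ((c ord0).1 * u + b * (c ord_max).2, (c ord0).2 * u + (c ord_max).1).
  rewrite !big_ord_recl big_ord0 addr0 /v /= (_ : lift ord0 ord0 = ord_max); last exact/val_inj.
  by rewrite !quad_mulE quad_addE /=; congr pair; ring.
exists v; split; [split=> [i|[x y] /= /mP[w ->]]|move=> c].
- by rewrite /v; case: ifP => _ //=; exact: ideal0.
- exists (fun i => if i == ord0 then (w, 0) else (y, 0)); rewrite sumE /=.
  by rewrite mulr0 addr0 mul0r add0r subrr; exact: ideal0.
- rewrite sumE => /(quad_exp_sub m2b)[/= h1 /ideal_exp1 h2] i.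
  have [->|] := eqVneq i ord0.
    have /(principal_expP mP)[w e] : ideal_exp m 2 ((c ord0).1 * u).
      have -> : (c ord0).1 * u = ((c ord0).1 * u + b * (c ord_max).2) - b * (c ord_max).2 by ring.
      by apply: idealB => //; exact: idealMr.
    apply/mP; exists w; apply/eqP; rewrite -subr_eq0; apply/eqP/u_nzd.
    by rewrite mulrBr mulrC e expr2; ring.
  have [j ->|->] := unliftP ord0 i; last by rewrite eqxx.
  rewrite (ord1 j) (_ : lift ord0 ord0 = ord_max) => [_ /=|]; last exact/val_inj.
  apply: idealBr h2 _; rewrite opprD addrCA subrr addr0; apply: idealN; exact: idealMl.
Qed.

Section Completion.
Variables (L : comPzRingType) (phi : {rmorphism D -> L}).
Hypothesis locL : is_loc n phi.
Let np : is_prime n := comaximal_prime nc.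
Local Notation mL := (loc_max np locL).
Local Notation bh := (to_completion m b).

(** The powers n^(k+1) = m^(k+1) + m^k y are cofinal with the ideals m^k + m^k y, so completing at
    [n] amounts to completing each of the two coordinates at [m]; by maximality of [n], passing to
    [L] changes no quotient. *)
Lemma quad_completion_iso : ring_iso (quad (bh : completion m)) (completion mL).
Proof.
have approx k w1 w2 w1' w2' : ideal_exp m k (w1 - w2) -> ideal_exp m k (w1' - w2') ->
    quot_pi (ideal_exp mL k) (phi (w1, w1')) = quot_pi (ideal_exp mL k) (phi (w2, w2')).
  move=> h1 h2; apply/quot_piP; rewrite -rmorphB; apply/(loc_exp_comax np locL _ _ nc).
  case: k h1 h2 => [|k] h1 h2; first exact: ideal_exp0.
  by apply: quad_exp_sup => //; exact: ideal_expSsub.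
have approxP k w1 w2 w1' w2' :
    quot_pi (ideal_exp mL k.+1) (phi (w1, w1')) = quot_pi (ideal_exp mL k.+1) (phi (w2, w2')) ->
    ideal_exp m k.+1 (w1 - w2) /\ ideal_exp m k (w1' - w2').
  move=> /quot_piP; rewrite -rmorphB => /(loc_exp_comax np locL _ _ nc).
  by move=> /(quad_exp_sub m2b).
pose f (x : quad (bh : completion m)) k : quot_ring (ideal_exp mL k) :=
  quot_pi _ (phi (repr (x.1 k), repr (x.2 k))).
have fE (x : quad (bh : completion m)) k w w' :
    x.1 k = quot_pi _ w -> x.2 k = quot_pi _ w' -> f x k = quot_pi _ (phi (w, w')).
  by move=> e e'; apply: approx; apply/quot_piP; rewrite quot_pi_repr.
have fc x : compatible (f x).
  apply: compatibleP => k; exists (phi (repr (x.1 k.+1), repr (x.2 k.+1))).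
  by split=> //; apply: fE; exact: coord_repr.
pose Phi x := Completion (fc x).
have PhiE (x : quad (bh : completion m)) k w w' :
    x.1 k = quot_pi _ w -> x.2 k = quot_pi _ w' -> Phi x k = quot_pi _ (phi (w, w')).
  exact: fE.
have rE (x : quad (bh : completion m)) k :
    x.1 k = quot_pi _ (repr (x.1 k)) /\ x.2 k = quot_pi _ (repr (x.2 k)).
  by rewrite !quot_pi_repr.
have [|||F eF] := @rmorphism_exists _ _ Phi.
- move=> x y; apply: completion_eq => k.
  have [ex ex'] := rE x k; have [ey ey'] := rE y k.
  rewrite -[RHS]/(Phi x k - Phi y k) (PhiE _ _ _ _ ex ex') (PhiE _ _ _ _ ey ey').
  rewrite -!rmorphB.
  apply: (PhiE _ _ (repr (x.1 k) - repr (y.1 k)) (repr (x.2 k) - repr (y.2 k))).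
    by rewrite -[LHS]/(x.1 k - y.1 k) {1}ex {1}ey; exact/esym/rmorphB.
  by rewrite -[LHS]/(x.2 k - y.2 k) {1}ex' {1}ey'; exact/esym/rmorphB.
- apply: completion_eq => k; rewrite -[RHS]/(quot_pi _ 1) -(rmorph1 phi).
  exact: PhiE.
- move=> x y; apply: completion_eq => k.
  have [ex ex'] := rE x k; have [ey ey'] := rE y k.
  rewrite -[RHS]/(Phi x k * Phi y k) (PhiE _ _ _ _ ex ex') (PhiE _ _ _ _ ey ey').
  rewrite -!rmorphM.
  apply: (PhiE _ _ (repr (x.1 k) * repr (y.1 k) + b * (repr (x.2 k) * repr (y.2 k)))
      (repr (x.1 k) * repr (y.2 k) + repr (x.2 k) * repr (y.1 k))).
    rewrite -[LHS]/(x.1 k * y.1 k + quot_pi _ b * (x.2 k * y.2 k)) {1}ex {1}ey {1}ex' {1}ey'.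
    by rewrite rmorphD !rmorphM.
  rewrite -[LHS]/(x.1 k * y.2 k + x.2 k * y.1 k) {1}ex {1}ey {1}ex' {1}ey'.
  by rewrite rmorphD !rmorphM.
exists F; apply: inj_surj_bij.
  apply: raddf_inj => x /= ; rewrite eF => e.
  have H k : ideal_exp m k.+1 (repr (x.1 k.+1)) /\ ideal_exp m k (repr (x.2 k.+1)).
    rewrite -[repr (x.1 k.+1)]subr0 -[repr (x.2 k.+1)]subr0; apply: approxP.
    have [ex ex'] := rE x k.+1; rewrite -(PhiE _ _ _ _ ex ex') e.
    rewrite -[LHS]/(quot_pi _ 0); congr quot_pi; apply/esym/rmorph0.
  rewrite [x]surjective_pairing; congr pair; apply: completion_eq => k.
    rewrite -[RHS]/(quot_pi _ 0) (coord_repr x.1 (leqnSn k)); apply/quot_piP; rewrite subr0.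
    by apply: ideal_expSsub; case: (H k).
  rewrite -[RHS]/(quot_pi _ 0) (coord_repr x.2 (leqnSn k)); apply/quot_piP; rewrite subr0.
  by case: (H k).
(* For surjectivity, level [k] of both coordinates is read off an approximation of [z] at level
   [k.+1], since n^(k+1) controls the coefficient of y only modulo m^k. *)
move=> z.
have /choice[w hw] k : exists w : D, z k = quot_pi _ (phi w).
  have [w hw] := loc_dense np locL k (repr (z k)) nc.
  by exists w; rewrite -{1}[z k]quot_pi_repr; apply/quot_piP.
have zz k : z k.+1 = quot_pi _ (phi (w k.+2)) /\ z k.+1 = quot_pi _ (phi (w k.+1)).
  by split=> //; apply: coordP; exact: hw.
have hz k : ideal_exp m k.+1 ((w k.+2).1 - (w k.+1).1) /\ ideal_exp m k ((w k.+2).2 - (w k.+1).2).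
  apply: approxP; rewrite -!surjective_pairing; by have [<- <-] := zz k.
have c1 : compatible (fun k => quot_pi (ideal_exp m k) (w k.+1).1).
  apply: compatibleP => k; exists (w k.+2).1; split=> //; apply/quot_piP.
  by rewrite -opprB; apply/idealN/ideal_expSsub; case: (hz k).
have c2 : compatible (fun k => quot_pi (ideal_exp m k) (w k.+1).2).
  apply: compatibleP => k; exists (w k.+2).2; split=> //; apply/quot_piP.
  by rewrite -opprB; apply/idealN; case: (hz k).
exists (Completion c1, Completion c2); rewrite eF; apply: completion_eq => k.
rewrite (PhiE _ k (w k.+1).1 (w k.+1).2) // -surjective_pairing.
by apply/esym/coordP.
Qed.

(** The codimension is 2 - 1: a prime containing [u] contains y, because y^2 = u^2 a, so the maximal
    ideal is minimal over the single element [u]. *)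
Lemma CI_le_quad c : noetherian L -> domain L -> (1 <= c)%N -> CI_le c L.
Proof.
move=> noeth dom c1; have Lloc := loc_local np locL.
have Lmc := local_comaximal Lloc; have Lmp := comaximal_prime Lmc.
have u0 : phi (u, 0) <> 0.
  have [_ _ lk] := locL; move=> /lk[[s1 s2] /= [ms1]].
  rewrite quad_mulE /= => -[/eqP]; rewrite !mulr0 addr0 mulrC => /eqP /u_nzd s10 _.
  by apply: ms1; rewrite s10; exact: ideal0.
exists mL; split.
- by split=> //; exact: local_with_local.
- apply: ci_of_presented; apply: ci_presented_iso quad_completion_iso _.
  apply: (ci_presented_quad (completion_regular mP mc u_nzd)).
  have : quot_pi (ideal_exp m 1) b = 0 by apply/quot_pi0P/ideal_exp1.
  exact.
- exists 1 => //; exists 2, 1; split=> //; first exact: edim_loc nc quad_edim.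
  split.
    apply: has_prime_chain1 dom Lmp _ u0; exact/loc_maxP.
  move=> k; apply: (local_height (g := [:: phi (u, 0)]) noeth Lloc).
    have mLu : mL (phi (u, 0)) by apply/loc_maxP.
    by move=> x /=; rewrite inE => /eqP->.
  move=> r rp ru l [[x y] [s [/= /mP[w ->] Qs e]]].
  have [lu _ _] := locL; apply: (unit_ideal (lu s Qs)); rewrite e.
  have {}ru : r (phi (u, 0)) by apply: ru; rewrite /= inE.
  have ry : r (phi (0, 1)).
    have : r (phi (0, 1) * phi (0, 1)).
      rewrite -rmorphM.
      have -> : ((0, 1) : D) * (0, 1) = ((u * a, 0) : D) * (u, 0).
        by rewrite !quad_mulE /=; congr pair; rewrite /b; ring.
      by rewrite rmorphM; exact: idealMl.
    by move=> /rp.2[].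
  have -> : (w * u, y) = ((w, 0) : D) * (u, 0) + ((y, 0) : D) * (0, 1).
    by rewrite !quad_mulE quad_addE /=; congr pair; ring.
  by rewrite rmorphD !rmorphM; apply: idealD; exact: idealMl.
Qed.

End Completion.
End QuadraticOverDVR.

(** * Localization and primes of iterated dual numbers *)

Section MoreLocalization.

Lemma loc_unique (B L1 L2 : comPzRingType) (Q : ideal B)
    (phi1 : {rmorphism B -> L1}) (phi2 : {rmorphism B -> L2}) :
  is_prime Q -> is_loc Q phi1 -> is_loc Q phi2 -> ring_iso L1 L2.
Proof.
move=> Qp loc1 loc2; have [lu1 ls1 lk1] := loc1; have [lu2 ls2 lk2] := loc2.
have [G eG] := loc_extend Qp loc1 lu2; exists G.
have G0 l : G l = 0 -> l = 0.
  move=> Gl; have [b [s [Qs e]]] := ls1 l.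
  have /lk2[t [Qt tb]] : phi2 b = 0 by rewrite -eG -e rmorphM Gl mulr0.
  have b0 : phi1 b = 0.
    apply: (unit_ideal (I := zero_ideal L1) (lu1 t Qt)).
    by rewrite /= -rmorphM tb rmorph0.
  by apply: (unit_ideal (I := zero_ideal L1) (lu1 s Qs)); rewrite /= e.
apply: inj_surj_bij; first by apply: raddf_inj => l; exact: G0.
move=> l; have [b [s [Qs e]]] := ls2 l; have [v ev] := lu1 s Qs.
exists (v * phi1 b); rewrite rmorphM eG -e mulrA -eG -rmorphM.
by rewrite (mulrC v) ev rmorph1 mul1r.
Qed.

Lemma dual_is_loc (B L : comPzRingType) (Q : ideal B) (phi : {rmorphism B -> L}) :
  is_prime Q -> is_loc Q phi ->
  exists phi' : {rmorphism quad (0 : B) -> quad (0 : L)}, is_loc (dual_max Q) phi'.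
Proof.
move=> [Q1 QM] [lu ls lk].
have [|||F eF] := @rmorphism_exists (quad (0 : B)) (quad (0 : L)) (fun x => (phi x.1, phi x.2)).
- by move=> x y; rewrite quad_oppE quad_addE /= !rmorphB.
- by congr pair; rewrite ?rmorph1 ?rmorph0.
- by move=> x y; rewrite !quad_mulE /= !mul0r !rmorphD !rmorphM rmorph0.
exists F; split=> [s /= /lu su|[l l']|x].
- by rewrite eF; apply: quad_unit; rewrite /= mul0r subr0; exact: is_unitM.
- have [b [s [Qs e]]] := ls l; have [b' [s' [Qs' e']]] := ls l'.
  exists (s' * b, s * b'), (s * s', 0); split; first by move=> /= /QM[].
  rewrite !eF quad_mulE /= !rmorphM rmorph0 -e -e'; congr pair; ring.
- rewrite eF => -[/lk[s [Qs e]] /lk[s' [Qs' e']]].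
  exists (s * s', 0); split; first by move=> /= /QM[].
  rewrite quad_mulE /= -[s * s' * x.2]mulrA e' [s * s']mulrC -[s' * s * x.1]mulrA e.
  by rewrite !mul0r !mulr0 addr0.
Qed.

Fixpoint iter_max (k : nat) (B : comPzRingType) (Q : ideal B) : ideal (iter_dual k B) :=
  if k is k'.+1 then dual_max (iter_max k' Q) else Q.

Fixpoint iter_fst (k : nat) (B : comPzRingType) : iter_dual k B -> B :=
  if k is k'.+1 then fun x : quad (0 : iter_dual k' B) => iter_fst x.1 else id.

Lemma iter_maxP k (B : comPzRingType) (Q : ideal B) (x : iter_dual k B) :
  iter_max k Q x <-> Q (iter_fst x).
Proof. by elim: k x => //= k IH [x y] /=. Qed.

Lemma iter_fst_hom k (B : comPzRingType) :
  exists F : {rmorphism iter_dual k B -> B}, forall x, F x = iter_fst x.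
Proof.
elim: k => [|k [F eF]]; first by exists idfun.
have [|||G eG] := @rmorphism_exists (quad (0 : iter_dual k B)) B (fun x => F x.1).
- by move=> x y; rewrite -rmorphB.
- by rewrite -(rmorph1 F).
- by move=> x y; rewrite quad_mulE /= mul0r addr0 rmorphM.
by exists G => x; rewrite eG eF.
Qed.

Lemma iter_in_hom k (B : comPzRingType) :
  exists F : {rmorphism B -> iter_dual k B}, forall x, iter_fst (F x) = x.
Proof.
elim: k => [|k [F eF]]; first by exists idfun.
have [G eG] := quad_in_hom (0 : iter_dual k B).
by exists (G \o F) => x; rewrite /= eG /= eF.
Qed.

(** The kernel of [iter_fst] is generated by elements of square zero, so it lies in every prime;
    hence primes of [iter_dual k B] are determined by their traces on [B]. *)
Lemma iter_fst_prime k (B : comPzRingType) (p : ideal (iter_dual k B)) (x : iter_dual k B) :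
  is_prime p -> iter_fst x = 0 -> p x.
Proof.
elim: k p x => [|k IH] p x; first by move=> _ /= ->; exact: ideal0.
move=> pp /= x0; have [G eG] := quad_in_hom (0 : iter_dual k B).
have p1 : p (x.1, 0) by rewrite -eG; exact: (IH _ _ (preim_prime G pp)).
have p2 : p (0, x.2).
  have : p (((0, x.2) : quad (0 : iter_dual k B)) * (0, x.2)).
    by rewrite quad_mulE /= !mul0r mulr0 !addr0; exact: ideal0.
  by move=> /pp.2[].
have -> : x = (x.1, 0) + (0, x.2) :> quad (0 : iter_dual k B).
  by rewrite quad_addE /= addr0 add0r; case: x {x0 p1 p2}.
exact: idealD.
Qed.

Lemma iter_max_prime k (B : comPzRingType) (Q : ideal B) :
  is_prime Q -> is_prime (iter_max k Q).
Proof.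
move=> Qp; have [F eF] := iter_fst_hom k B.
have [P1 PM] := preim_prime F Qp.
split; first by rewrite iter_maxP -eF.
by move=> x y; rewrite !iter_maxP -!eF; exact: PM.
Qed.

Lemma iter_dual_is_loc k (B L : comPzRingType) (Q : ideal B) (phi : {rmorphism B -> L}) :
  is_prime Q -> is_loc Q phi ->
  exists phi' : {rmorphism iter_dual k B -> iter_dual k L}, is_loc (iter_max k Q) phi'.
Proof.
move=> Qp locL; elim: k => [|k [phi' loc']]; first by exists phi.
exact: dual_is_loc (iter_max_prime k Qp) loc'.
Qed.

End MoreLocalization.

(* A system of [k] functionals on [Q/Q^2], with a dual family of vectors,
   bounds the embedding dimension of the localization at [Q] from below. *)
Definition cot_functionals (B : comPzRingType) (Q : ideal B) (k : nat) :=
  exists (F : fieldType) (rho : {rmorphism B -> F}) (d : 'I_k -> B -> F) (w : 'I_k -> B),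
  [/\ forall x, Q x <-> rho x = 0, forall j, Q (w j),
      forall i x y, Q x -> Q y -> d i (x + y) = d i x + d i y,
      forall i a x, Q x -> d i (a * x) = rho a * d i x &
      forall i j, d i (w j) = (i == j)%:R].

(** Cotangent generators of [L], cleared of denominators, express multiples of the [w j] by elements
    outside [Q] modulo Q^2. Applying the functionals factors the identity matrix of size [k] through
    a space of dimension [n]. *)
Lemma cot_functionals_edim (B L : comPzRingType) (Q : ideal B) (phi : {rmorphism B -> L})
    (m : ideal L) k n :
  is_prime Q -> is_loc Q phi -> cot_functionals Q k -> local_with m -> has_edim m n ->
  (k <= n)%N.
Proof.
move=> Qp locL [F [rho [d [w [rhoQ Qw dD dM dw]]]]] mloc /edimP[v [[vm vs] _]].
have em := local_with_eq (loc_local Qp locL) mloc.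
have msub : m `<=` loc_max Qp locL by rewrite em.
have /choice[b] l : exists b, Q b /\ exists s, ~ Q s /\ phi s * v l = phi b.
  by have [b [s [Qb Qs e]]] := msub _ (vm l); exists b; split=> //; exists s.
move=> hb.
pose I := ideal_add (ideal_exp Q 2) (ideal_gen [set` [seq b l | l <- enum 'I_n]]).
have /choice[s hs] j : exists s, ~ Q s /\ I (s * w j).
  apply: (ext_ideal_saturated (Qp := Qp) (locL := locL) (I := I)).
  have [|a ha] := vs (phi (w j)); first by rewrite em; exact/loc_maxP.
  rewrite -[phi (w j)](subrK (\sum_l a l * v l)); apply: idealD.
    have /(loc_expP Qp locL)[x [t [Qx Qt e]]] :
        ideal_exp (loc_max Qp locL) 2 (phi (w j) - \sum_l a l * v l).
      move: ha; rewrite ideal_expS; apply: ideal_mul_min => x y mx /ideal_exp1 my.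
      by apply: ideal_mulI; [exact: msub|apply/ideal_exp1; exact: msub].
    by exists x, t; split=> //; exact: ideal_addl.
  apply: ideal_sum => l; apply: idealMl; have [Qb [t [Qt e]]] := hb l.
  exists (b l), t; split=> //; apply/ideal_addr/sub_gen/map_f; exact: mem_enum.
have d0 i x : ideal_exp Q 2 x -> Q x /\ d i x = 0.
  have JP : is_ideal [set x | Q x /\ d i x = 0].
    split=> [|y z [Qy dy] [Qz dz]|a y [Qy dy]].
    - split; first exact: ideal0.
      have := dM i 0 0 (ideal0 Q); by rewrite mul0r rmorph0 mul0r.
    - by split; [exact: idealD|rewrite dD // dy dz addr0].
    - by split; [exact: idealMl|rewrite dM // dy mulr0].
  rewrite ideal_expS; apply: (ideal_mul_min (K := Ideal JP)) => y z Qy /ideal_exp1 Qz /=.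
  by split; [exact: idealMl|rewrite dM // (rhoQ y).1 // mul0r].
have /choice[a ha] j : exists a : 'I_n -> B, forall i,
    rho (s j) * (i == j)%:R = \sum_l rho (a l) * d i (b l).
  have [Qs [y [z [Qy /gen_ordP[a ez] e]]]] := hs j; exists a => i.
  rewrite -dw -dM // e dD; last 2 first.
  - by case: (d0 i _ Qy).
  - by rewrite ez; apply: ideal_sum => l; apply: idealMl; case: (hb l).
  have [_ ->] := d0 i _ Qy; rewrite add0r ez.
  have : Q (\sum_l a l * b l) /\ d i (\sum_l a l * b l) = \sum_l rho (a l) * d i (b l).
    elim/big_rec2: _ => [|l x y' _ [Qy' ey']].
      split; first exact: ideal0.
      by have := dM i 0 0 (ideal0 Q); rewrite mul0r rmorph0 mul0r.
    have Qb : Q (b l) by case: (hb l).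
    split; first by apply: idealD => //; exact: idealMl.
    by rewrite dD ?dM ?ey' //; exact: idealMl.
  by case.
pose M := \matrix_(j < k, l < n) ((rho (s j))^-1 * rho (a j l)).
pose N := \matrix_(l < n, i < k) d i (b l).
have MN : M *m N = 1%:M.
  apply/matrixP => j i; rewrite !mxE.
  have s0 : rho (s j) != 0 by apply/eqP => /rhoQ; case: (hs j).
  under eq_bigr do rewrite !mxE -mulrA.
  by rewrite -mulr_sumr -ha mulrA mulVf // mul1r eq_sym.
rewrite -(mxrank1 F k) -MN; apply: leq_trans (mxrankM_maxr _ _) _; exact: rank_leq_row.
Qed.

(** The additional functional is the residue of the second coordinate; its dual vector is
    [(0, 1)]. *)
Lemma cot_functionals_dual (B : comPzRingType) (Q : ideal B) k :
  cot_functionals Q k -> cot_functionals (dual_max Q) k.+1.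
Proof.
move=> [F [rho [d [w [rhoQ Qw dD dM dw]]]]].
have [|||rho' erho] := @rmorphism_exists (quad (0 : B)) F (fun x => rho x.1).
- by move=> x y; rewrite -rmorphB.
- by rewrite -(rmorph1 rho).
- by move=> x y; rewrite quad_mulE /= mul0r addr0 rmorphM.
exists F, rho', (fun i x => oapp (fun j => d j x.1) (rho x.2) (unlift ord0 i)),
  (fun i => oapp (fun j => (w j, 0)) (0, 1) (unlift ord0 i)).
split=> [x|j|i x y /= Qx Qy|i a x Qx|i j].
- by rewrite erho; exact: rhoQ.
- by case: (unlift ord0 j) => [j'|] /=; [exact: Qw|exact: ideal0].
- case: (unlift ord0 i) => [i'|] /=; first exact: dD.
  exact: (rmorphD rho).
- rewrite erho quad_mulE; case: (unlift ord0 i) => [i'|] /=.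
    by rewrite mul0r addr0 dM.
  by rewrite rmorphD !rmorphM ((rhoQ x.1).1 Qx) mulr0 addr0.
- case: (unliftP ord0 i) => [i' ->|->]; case: (unliftP ord0 j) => [j' ->|->].
  + by rewrite /= dw (inj_eq (@lift_inj _ _)).
  + by have := dM i' 0 0 (ideal0 Q); rewrite mul0r rmorph0 mul0r => /= ->.
  + by rewrite /= rmorph0.
  + by rewrite /= rmorph1.
Qed.

Lemma cot_functionals_iter_dual (B : comPzRingType) (Q : ideal B) n k :
  cot_functionals Q n -> cot_functionals (iter_max k Q) (k + n).
Proof. by move=> H; elim: k => //= k; exact: cot_functionals_dual. Qed.

(** * Failure of the Nagata criterion *)

Section Criterion.
Variables (E : comPzRingType) (M : nat -> ideal E).
Hypotheses (noeth : noetherian E) (dom : domain E).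
Hypothesis prime_comaximal :
  forall (Q : ideal E) x, is_prime Q -> Q x -> x <> 0 -> comaximal Q.
Hypothesis prime_ci : forall (Q : ideal E) x (L : comPzRingType) (phi : {rmorphism E -> L}) c,
  is_prime Q -> Q x -> x <> 0 -> is_loc Q phi -> (1 <= c)%N -> CI_le c L.
Hypothesis M_prime : forall i, is_prime (M i).
Hypothesis M_avoid : forall x, x <> 0 -> exists i, ~ M i x.
Hypothesis M_cot : forall i, cot_functionals (M i) 2.
Hypothesis M_param : forall i, exists2 u, M i u &
  forall r : ideal E, is_prime r -> r u -> M i `<=` r.

Lemma zero_loc_field (L : comPzRingType) (phi : {rmorphism E -> L}) :
  is_loc (zero_ideal E) phi -> (1 : L) <> 0 /\ forall l : L, l <> 0 -> is_unit l.
Proof.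
move=> locL; have [lu ls lk] := locL.
split; first by case: (loc_domain (zero_prime dom) locL dom).
move=> l l0; have [b [s [s0 e]]] := ls l; apply: (@is_unitMl _ l (phi s)).
rewrite mulrC e; apply: (lu b) => b0; apply: l0.
by apply: (unit_ideal (I := zero_ideal L) (lu s s0)); rewrite e b0 rmorph0.
Qed.

Variable c : nat.
Hypothesis c_gt0 : (1 <= c)%N.
Local Notation A := (iter_dual c E).

(** With F the fraction field of [E], this localization is F[e_1, ..., e_c]/(e_1^2, ..., e_c^2). *)
Lemma generic_ci : CI_le c (localization (PrimeIdeal (iter_max_prime c (zero_prime dom)))).
Proof.
have [phi locF] := loc_hom_exists (PrimeIdeal (zero_prime dom)).
have [F1 Fu] := zero_loc_field locF.
have [phi' loc'] := iter_dual_is_loc c (zero_prime dom) locF.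
have [psi locp] := loc_hom_exists (PrimeIdeal (iter_max_prime c (zero_prime dom))).
apply: (CI_le_dual F1 Fu _ (leqnn c)).
exact: loc_unique (iter_max_prime c (zero_prime dom)) loc' locp.
Qed.

(** The embedding dimension is at least [c + 2], by two functionals at [M i] and one for each
    dual-number step. The dimension is at most 1, because modulo nilpotents the maximal ideal is
    minimal over the parameter [u]. *)
Lemma closed_not_ci i : ~ CI_le c (localization (PrimeIdeal (iter_max_prime c (M_prime i)))).
Proof.
set p := PrimeIdeal _; have pp : is_prime p := iter_max_prime c (M_prime i).
have [phi locL] := loc_hom_exists p.
move=> [m [[Lnoeth mloc] _ [k [e [d [me [cd _] ek]]] kc]]].
have := cot_functionals_edim pp locL (cot_functionals_iter_dual c (M_cot i)) mloc me.
suff d1 : (d <= 1)%N.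
  rewrite ek addn2 leqNgt -addn2 => /negP; apply.
  by rewrite addnC addn2 ltnS (leq_trans (leq_add kc d1)) // addn1.
have [u Mu Mr] := M_param i; have [F eF] := iter_in_hom c E.
have em := local_with_eq (loc_local pp locL) mloc.
apply: (local_height (m := m) (g := [:: phi (F u)]) Lnoeth (local_at_with Lnoeth mloc)) => //.
  have : loc_max pp locL (phi (F u)) by apply/loc_maxP/iter_maxP; rewrite eF.
  by rewrite -em => h x /=; rewrite inE => /eqP->.
move=> r rp ru l; rewrite em => -[x [s [px Qs e']]].
have {}ru : r (phi (F u)) by apply: ru; rewrite /= inE.
have [lu _ _] := locL; apply: (unit_ideal (lu s Qs)); rewrite e'.
have rp' := preim_prime phi rp.
suff : preim_ideal phi r x by [].
apply: (@idealBr _ (preim_ideal phi r) x (F (iter_fst x))).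
  apply: (Mr (preim_ideal F (preim_ideal phi r)) (preim_prime F rp') ru).
  exact/iter_maxP.
apply: iter_fst_prime => //; have [G eG] := iter_fst_hom c E.
by rewrite -eG rmorphB !eG eF subrr.
Qed.

(** The quotient by [p] is [E / Q], where [Q] is the trace of [p] on [E]. Nonzero primes of [E] are
    maximal, so either [Q] is zero and the localization is that of [E] at [Q'], or [Q'] equals [Q]
    and the localization is a field. *)
Lemma quotient_ci (p : Spec A) (q : Spec (quot_ring p)) : CI_le c (localization q).
Proof.
have [F eF] := iter_in_hom c E; have [G eG] := iter_fst_hom c E.
pose Q := preim_ideal F p.
have Qp : is_prime Q by apply: preim_prime; exact: Defs.primeP.
pose h : {rmorphism E -> quot_ring p} := quot_pi p \o F.
have h0 x : h x = 0 <-> Q x by exact: quot_pi0P.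
have hs y : exists x, h x = y.
  exists (iter_fst (repr y)); rewrite -[RHS]quot_pi_repr; apply/quot_piP.
  apply: iter_fst_prime; first exact: Defs.primeP.
  by rewrite -eG rmorphB !eG eF subrr.
pose Q' := preim_ideal h q.
have Q'p : is_prime Q' by apply: preim_prime; exact: Defs.primeP.
have QQ' : Q `<=` Q' by move=> x /h0; rewrite /= => ->; exact: ideal0.
have [psi locL] := loc_hom_exists q; have [lu ls lk] := locL.
have [[x [Q'x nQx]]|Q'Q] := pselect (exists x, Q' x /\ ~ Q x).
  (* A nonzero [Q] would be maximal, which is incompatible with the strictly larger prime [Q']. *)
  have Q0 y : Q y -> y = 0.
    move=> Qy; apply: contrapT => y0.
    have [_ Qc] := prime_comaximal Qp Qy y0; have [z /QQ' Qz] := Qc _ nQx.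
    case: Q'p => Q1 _; apply: Q1; rewrite -(subrK (x * z) 1); apply: idealD => //.
    exact: idealMr.
  have x0 : x <> 0 by move=> x0; apply: nQx; rewrite x0; exact: ideal0.
  apply: (@prime_ci Q' x _ (psi \o h)) => //; split=> [s Qs|l|b].
  - exact: lu.
  - have [b [s [qs e]]] := ls l; have [b' eb] := hs b; have [s' es] := hs s.
    exists b', s'; split; first by rewrite -es in qs.
    by rewrite -[LHS]/(psi (h s') * l) -[RHS]/(psi (h b')) eb es.
  - move=> /lk[s [qs]]; have [s' es] := hs s; rewrite -es -rmorphM => /h0/Q0 e.
    by exists s'; split=> //; rewrite -es in qs.
have Lfield : forall l : localization q, l <> 0 -> is_unit l.
  move=> l l0; have [b [s [qs e]]] := ls l; apply: (@is_unitMl _ l (psi s)).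
  rewrite mulrC e; apply: (lu b) => qb; apply: l0; apply: (unit_ideal (I := zero_ideal _) (lu s qs)).
  rewrite e; have [b' eb] := hs b; have : Q b'.
    by apply: contrapT => nQ; apply: Q'Q; exists b'; split=> //; rewrite -eb in qb.
  by move=> /h0; rewrite eb => ->; exact: rmorph0.
have L1 : (1 : localization q) <> 0.
  have [L1 _] := loc_local (Defs.primeP q) locL.
  by move=> e; apply: L1; rewrite e; exact: ideal0.
by apply: (CI_le_dual (k := 0) L1 Lfield) => //; exists idfun; exists id.
Qed.

Theorem not_nagata_criterion : ~ nagata_criterion (CI_le c).
Proof.
move=> nc.
have [S eS] : zariski_open (locus (CI_le c) A).
  apply: (nc _ (noetherian_iter_dual (k := c) noeth)) => p; exists setT; split.
  - exact: openT.
  - have q0 : is_prime (zero_ideal (quot_ring p)).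
      have [p1 pM] := Defs.primeP p; split=> [/quot_pi0P//|x y].
      rewrite -[x]quot_pi_repr -[y]quot_pi_repr /= -rmorphM => /quot_pi0P/pM[] h.
        by left; apply/quot_pi0P.
      by right; apply/quot_pi0P.
    by exists (PrimeIdeal q0).
  - by move=> q _; exact: quotient_ci.
have : locus (CI_le c) A (PrimeIdeal (iter_max_prime c (zero_prime dom))) by exact: generic_ci.
rewrite eS => /existsNP[x /not_implyP[Sx nx]].
have [|i Mi] := M_avoid (x := iter_fst x).
  by move=> x0; apply: nx; apply/iter_maxP.
have : ~ locus (CI_le c) A (PrimeIdeal (iter_max_prime c (M_prime i))) by exact: closed_not_ci.
by rewrite eS; apply=> /(_ x Sx) /iter_maxP.
Qed.

End Criterion.

(** Cohen's theorem: an ideal maximal among those that are not finitely generated is prime. *)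
Lemma cohen_noetherian (A : comPzRingType) :
  (forall P : ideal A, is_prime P -> fg P) -> noetherian A.
Proof.
move=> pfg I; apply: contrapT => nfg.
pose T (X : set A) := X = set0 \/ (is_ideal X /\ ~ fg X).
have [|X [TX maxX]] := @Zorn_bigcup A T.
  move=> F FT Ftot; have [[X [FX [iX nX]]]|H] := pselect (exists X, F X /\ is_ideal X /\ ~ fg X); last first.
    left; rewrite -subset0 => x [X FX Xx]; have [X0|iX] := FT X FX.
      by rewrite -X0.
    by case: H; exists X.
  right.
  have Fi Y y : F Y -> Y y -> is_ideal Y.
    by move=> FY Yy; have [Y0|[]//] := FT Y FY; rewrite Y0 in Yy.
  have iU : is_ideal (\bigcup_(X in F) X).
    split=> [|x y [Y FY Yx] [Z FZ Zy]|a x [Y FY Yx]].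
    - by exists X => //; case: iX.
    - have [iY iZ] := (Fi _ _ FY Yx, Fi _ _ FZ Zy).
      have [YZ|ZY] := Ftot _ _ FY FZ.
        by exists Z => //; apply: (idealD (I := Ideal iZ)) => //; exact: YZ.
      by exists Y => //; apply: (idealD (I := Ideal iY)) => //; exact: ZY.
    - by exists Y => //; apply: (idealMl (I := Ideal (Fi _ _ FY Yx))).
  split=> // -[s es].
  have [Y FY sY] : exists2 Y, F Y & is_ideal Y /\ [set` s] `<=` Y.
    have : [set` s] `<=` Ideal iU by rewrite /= es; exact: sub_gen.
    elim: s {es} => [|g s IH] sU; first by exists X.
    have [|Y FY [iY sY]] := IH; first by move=> x xs; apply: sU; rewrite /= inE [x \in s]xs orbT.
    have [|Z FZ Zg] := sU g; first by rewrite /= mem_head.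
    have [YZ|ZY] := Ftot _ _ FY FZ.
      exists Z => //; split; first exact: Fi Zg.
      by move=> x /=; rewrite inE => /orP[/eqP->//|/sY/YZ].
    exists Y => //; split=> // x /=; rewrite inE => /orP[/eqP->|/sY//]; exact: ZY.
  case: sY => iY sY; have [Y0|[_]] := FT Y FY.
    by case: iY; rewrite Y0.
  apply; exists s; apply/seteqP; split=> y.
    by move=> Yy; rewrite -es; exists Y.
  by move=> /(gen_min (J := Ideal iY) sY).
have {TX} [iX nX] : is_ideal X /\ ~ fg X.
  case: TX => // X0; case: (maxX I); last by right; split=> //; exact: idealP.
  by rewrite X0; split=> // /(_ 0); apply; exact: ideal0.
pose P := Ideal iX.
have bigger (J : ideal A) y : P `<=` J -> J y -> ~ P y -> fg J.
  move=> PJ Jy nPy; apply: contrapT => nJ; apply: (maxX J).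
    by split=> // JP; exact/nPy/JP.
  by right; split=> //; exact: idealP.
apply: (nX); apply: (pfg P); split=> [P1|x y Pxy].
  apply: nX; exists [:: 1]; apply/seteqP; split=> z; last by move=> _; apply: (@ideal1 _ P).
  by move=> _; apply/gen_seq1P; exists z; rewrite mulr1.
(* Both [P + (x)] and the colon ideal of [P] by [x] are strictly larger than [P], hence finitely
   generated. The [P]-parts of generators of the former, with [x] times generators of the latter,
   generate [P]. *)
apply: contrapT => /not_orP[nPx nPy]; apply: nX.
pose J := ideal_add P (ideal_gen [set` [:: x]]).
have Jx : J x by apply/ideal_addr/sub_gen; rewrite /= inE.
have [g eg] := bigger J x (@ideal_addl _ _ _) Jx nPx.
have [c ec] : fg (colon P x).
  by apply: (bigger _ y) => //= [z Pz|]; [exact: (@idealMr _ P)|rewrite mulrC].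
have [p [pP Hp]] : exists p : seq A, [set` p] `<=` P /\
    forall z, ideal_gen [set` g] z -> exists w b, ideal_gen [set` p] w /\ z = w + b * x.
  have : [set` g] `<=` J by rewrite eg; exact: sub_gen.
  elim: g {eg} => [|h g IH] gJ.
    by exists [::]; split=> // z /gen_nilP->; exists 0, 0; split; [exact: ideal0|rewrite mul0r addr0].
  have [|p [pP Hp]] := IH; first by move=> z zs; apply: gJ; rewrite /= inE [z \in g]zs orbT.
  have [|p1 [x1 [Pp1 /gen_seq1P[b1 eb1] eh]]] := gJ h; first by rewrite /= mem_head.
  exists (p1 :: p); split; first by move=> z /=; rewrite inE => /orP[/eqP->//|/pP].
  move=> z /gen_consP[a [z' [gz' ->]]]; have [w [b [pw ->]]] := Hp z' gz'.
  exists (a * p1 + w), (a * b1 + b); split; last by rewrite eh eb1; ring.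
  by apply/gen_consP; exists a, w.
exists (p ++ [seq z * x | z <- c]); apply/seteqP; split=> z; last first.
  apply: (gen_min (J := P)) => z' /=; rewrite mem_cat => /orP[/pP//|/mapP[w wc ->]].
  have : colon P x w by rewrite ec; exact: sub_gen.
  exact.
move=> Pz; have : J z by apply/ideal_addl.
rewrite eg => /Hp[w [b [pw ez]]].
have Pw : P w by apply: gen_min pw.
have : colon P x b.
  rewrite /=; have -> : b * x = z - w by rewrite ez; ring.
  exact: (@idealB _ P).
rewrite ec => cb; apply/gen_catP; exists w, (b * x); split=> //.
have KP : is_ideal [set b | ideal_gen [set` [seq z * x | z <- c]] (b * x)].
  split=> [|u v hu hv|a u hu] /=; rewrite ?mul0r ?mulrDl -?mulrA.
  - exact: ideal0.
  - exact: idealD.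
  - exact: idealMl.
apply: (gen_min (J := Ideal KP) _ cb) => v vc /=; apply: sub_gen.
by apply/mapP; exists v.
Qed.

Lemma is_loc_iso (D B L : comPzRingType) (psi : {rmorphism D -> B}) (phi : {rmorphism B -> L})
    (Q : ideal B) (Q' : ideal D) : bijective psi -> (forall x, Q' x <-> Q (psi x)) ->
  is_loc Q phi -> is_loc Q' (phi \o psi).
Proof.
move=> [psi' K K'] QE [lu ls lk]; split=> [s Qs|l|b /lk[s [Qs e]]].
- by apply: lu => /QE.
- have [b [s [Qs e]]] := ls l; exists (psi' b), (psi' s).
  by rewrite QE K' /= !K'.
- exists (psi' s); rewrite QE K'; split=> //.
  by apply: (can_inj K); rewrite rmorphM K' e rmorph0.
Qed.

(** * The multiquadratic field *)

Section Multiquadratic.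

(** [prime_above] returns some larger prime, so this is a strictly increasing sequence of primes,
    possibly with gaps. *)
Fixpoint nth_prime (i : nat) : nat :=
  if i is i'.+1 then s2val (prime_above (nth_prime i')) else 2.

Lemma nth_prime_prime i : prime (nth_prime i).
Proof. by case: i => [|i] //=; case: (prime_above _). Qed.

Lemma nth_prime_inj : injective nth_prime.
Proof.
have lt i j : (i < j)%N -> (nth_prime i < nth_prime j)%N.
  elim: j => // j IH; have lj : (nth_prime j < nth_prime j.+1)%N by rewrite /=; case: (prime_above _).
  by rewrite ltnS leq_eqVlt => /orP[/eqP->//|/IH h]; exact: ltn_trans h lj.
by move=> i j e; case: (ltngtP i j) => // /lt; rewrite e ltnn.
Qed.

Definition root_p i : algC := 2.-root (nth_prime i)%:R.

Lemma root_pK i : root_p i * root_p i = (nth_prime i)%:R.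
Proof. by rewrite -expr2 rootCK. Qed.

Lemma root_p_neq0 i : root_p i != 0.
Proof.
apply/eqP => e; have /eqP := root_pK i; rewrite e mul0r eq_sym pnatr_eq0.
by have := prime_gt0 (nth_prime_prime i); case: (nth_prime i).
Qed.

Definition is_subfield (S : set algC) := [/\ S 1, forall x y, S x -> S y -> S (x - y) &
  forall x y, S x -> S y -> S (x / y)].

Definition field_gen (X : set nat) : set algC :=
  [set x | forall S, is_subfield S -> (forall i, X i -> S (root_p i)) -> S x].

Lemma field_gen_sub X : is_subfield (field_gen X).
Proof.
split=> [S|x y hx hy S|x y hx hy S] SS XS; have [S1 SB SD] := SS => //.
  by apply: SB; [exact: hx|exact: hy].
by apply: SD; [exact: hx|exact: hy].
Qed.

Lemma field_gen_root (X : set nat) i : X i -> field_gen X (root_p i).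
Proof. by move=> Xi S _; exact. Qed.

Lemma field_gen_le (X Y : set nat) : X `<=` Y -> field_gen X `<=` field_gen Y.
Proof. by move=> XY x hx S SS YS; apply: hx => // i /XY; exact: YS. Qed.

Section Subfield.
Variable S : set algC.
Hypothesis SS : is_subfield S.

Lemma sf1 : S 1. Proof. by case: SS. Qed.
Lemma sfB x y : S x -> S y -> S (x - y). Proof. by case: SS => _ + _; apply. Qed.
Lemma sf_div x y : S x -> S y -> S (x / y). Proof. by case: SS => _ _; apply. Qed.
Lemma sf0 : S 0. Proof. by rewrite -(subrr 1); apply: sfB; exact: sf1. Qed.
Lemma sfN x : S x -> S (- x). Proof. by rewrite -sub0r; apply: sfB; exact: sf0. Qed.
Lemma sfD x y : S x -> S y -> S (x + y).
Proof. by move=> Sx Sy; rewrite -[y]opprK; apply: sfB => //; exact: sfN. Qed.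
Lemma sfV x : S x -> S x^-1. Proof. by rewrite -div1r; apply: sf_div; exact: sf1. Qed.
Lemma sfM x y : S x -> S y -> S (x * y).
Proof. by move=> Sx Sy; rewrite -[y]invrK; apply: sf_div => //; exact: sfV. Qed.
Lemma sf_nat n : S n%:R.
Proof. by elim: n => [|n IH]; [exact: sf0|rewrite -natr1; apply: sfD => //; exact: sf1]. Qed.
End Subfield.

Lemma field_gen_adjoin (X : set nat) i x : field_gen (X `|` [set i]) x ->
  exists a b, [/\ field_gen X a, field_gen X b & x = a + b * root_p i].
Proof.
set r := root_p i; have XX := field_gen_sub X.
pose T := [set x | exists a b, [/\ field_gen X a, field_gen X b & x = a + b * r]].
have XT a : field_gen X a -> T a.
  by exists a, 0; rewrite mul0r addr0; split=> //; exact: (sf0 XX).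
move=> hx; apply: (hx T); first split.
- by apply: XT; exact: (sf1 XX).
- move=> _ _ [a [b [Xa Xb ->]]] [c [d [Xc Xd ->]]]; exists (a - c), (b - d).
  by split; [exact: (sfB XX)|exact: (sfB XX)|ring].
- move=> _ _ [a [b [Xa Xb ->]]] [c [d [Xc Xd ->]]].
  (* A quotient by zero is zero, so a vanishing denominator has to be treated. *)
  have [y0|y0] := eqVneq (c + d * r) 0.
    rewrite y0 invr0 mulr0; by apply: XT; exact: (sf0 XX).
  have Xp : field_gen X (r * r) by rewrite root_pK; exact: (sf_nat XX).
  (* The quotient is rationalized by the conjugate of its denominator. If only the conjugate
     vanishes, then [r] already belongs to the smaller field. *)
  have [z0|z0] := eqVneq (c - d * r) 0.
    have [d0|d0] := eqVneq d 0.
      by move: y0; rewrite -[c](subrK (d * r)) z0 d0 mul0r !addr0 eqxx.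
    have Xr : field_gen X r.
      have cE : c = d * r by apply/eqP; rewrite -subr_eq0 z0.
      have -> : r = c / d by rewrite cE mulrC mulKf.
      exact: (sf_div XX).
    by apply: XT; apply: (sf_div XX) => //; apply: (sfD XX) => //; exact: (sfM XX).
  pose N := c * c - d * d * (r * r).
  have XN : field_gen X N by apply: (sfB XX) => //; do ?[exact: Xp|apply: (sfM XX)] => //.
  have eN : N = (c + d * r) * (c - d * r) by rewrite /N; ring.
  exists ((a * c - b * d * (r * r)) / N), ((b * c - a * d) / N); split.
  + by apply: (sf_div XX) => //; apply: (sfB XX) => //; do ?[exact: Xp|apply: (sfM XX)] => //.
  + by apply: (sf_div XX) => //; apply: (sfB XX) => //; do ?[exact: Xp|apply: (sfM XX)] => //.
  + by rewrite eN; field; rewrite y0 z0.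
- move=> j [Xj|->]; first by apply: XT; exact: field_gen_root.
  by exists 0, 1; rewrite add0r mul1r; split=> //; [exact: (sf0 XX)|exact: (sf1 XX)].
Qed.

(** Elementary Kummer theory. If x = a + b r squares to an integer, then b = 0, or a = 0, or r lies
    in the smaller field. When a = 0, [x] is replaced by [x * r] and [n] by [n * nth_prime i]; in
    the other cases [i] is dropped. At the bottom [x] is rational and is written as a fraction. *)
Lemma field_gen_square (l : seq nat) x n : field_gen [set` l] x -> x * x = n%:R -> (0 < n)%N ->
  exists (l' : seq nat) m d, [/\ {subset l' <= l}, (0 < d)%N &
    (n * \prod_(j <- l') nth_prime j * d ^ 2 = m ^ 2)%N].
Proof.
elim: l x n => [|i l IH] x n hx ex n0.
  have [q eq] : exists q : rat, x = ratr q.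
    apply: (hx [set x | exists q : rat, x = ratr q]) => //; split=> [|_ _ [p ->] [q ->]|_ _ [p ->] [q ->]].
    - by exists 1; rewrite rmorph1.
    - by exists (p - q); rewrite rmorphB.
    - by exists (p / q); rewrite fmorph_div.
  have eqq : q * q = n%:R.
    by apply: (fmorph_inj (ratr : {rmorphism rat -> algC})); rewrite rmorphM rmorph_nat -ex eq.
  exists [::], `|numq q|%N, `|denq q|%N; split=> //; first by rewrite absz_gt0 denq_neq0.
  rewrite big_nil muln1; apply/eqP; rewrite -!mulnn -(eqr_nat rat).
  have d0 : (denq q)%:~R != 0 :> rat by rewrite intr_eq0 denq_neq0.
  have nE : ((`|numq q| * `|numq q|)%N%:R : rat) = (numq q)%:~R * (numq q)%:~R.
    by rewrite -intrM -abszM natr_absz ger0_norm // -expr2 sqr_ge0.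
  have dE : ((`|denq q| * `|denq q|)%N%:R : rat) = (denq q)%:~R * (denq q)%:~R.
    by rewrite -intrM -abszM natr_absz ger0_norm // -expr2 sqr_ge0.
  rewrite natrM dE nE -eqq -{1 2}[q]divq_num_den; apply/eqP; field; exact: d0.
have XX := field_gen_sub [set` l].
have set_cons : [set` i :: l] = [set` l] `|` [set i].
  apply/seteqP; split=> j /=; rewrite inE.
    by move=> /orP[/eqP->|jl]; [right|left].
  by move=> [->|->]; rewrite ?eqxx ?orbT.
have wk P : (exists l' m d, [/\ {subset l' <= l}, (0 < d)%N & P l' m d]) ->
    exists l' m d, [/\ {subset l' <= i :: l}, (0 < d)%N & P l' m d].
  move=> [l' [m [d [sl d0 e]]]]; exists l', m, d; split=> // j /sl jl.
  by rewrite inE jl orbT.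
rewrite set_cons in hx; have [a [b [Xa Xb eab]]] := field_gen_adjoin hx.
have [b0|b0] := eqVneq b 0.
  by apply: wk; apply: (IH x) => //; rewrite eab b0 mul0r addr0.
set r := root_p i in eab.
have Xp : field_gen [set` l] (r * r) by rewrite root_pK; exact: (sf_nat XX).
have [a0|a0] := eqVneq a 0.
  have [|||l' [m [d [sl d0 e]]]] := IH (x * r) (n * nth_prime i)%N.
  - by rewrite eab a0 add0r -mulrA; exact: (sfM XX).
  - by rewrite natrM -ex -root_pK -/r; ring.
  - by rewrite muln_gt0 n0 prime_gt0 // nth_prime_prime.
  exists (i :: l'), m, d; split=> //.
    by move=> j; rewrite !inE => /orP[->//|/sl->]; rewrite orbT.
  by rewrite big_cons mulnA.
have Xr : field_gen [set` l] r.
  have -> : r = (n%:R - a * a - b * b * (r * r)) / (2%:R * a * b).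
    rewrite -ex eab; by field; rewrite a0 b0.
  apply: (sf_div XX) => //; do ?[apply: (sfB XX) => //|apply: (sfM XX) => //]; exact: (sf_nat XX).
by apply: wk; apply: (IH x) => //; rewrite eab; apply: (sfD XX) => //; exact: (sfM XX).
Qed.

Lemma field_gen_finite (X : set nat) x : field_gen X x ->
  exists2 l : seq nat, [set` l] `<=` X & field_gen [set` l] x.
Proof.
have lc (l l' : seq nat) : [set` l] `<=` [set` l ++ l'] /\ [set` l'] `<=` [set` l ++ l'].
  by split=> j /= jl; rewrite mem_cat; apply/orP; [left|right].
move=> hx; apply: (hx [set x | exists2 l, [set` l] `<=` X & field_gen [set` l] x]); first split.
- by exists [::] => //; exact: (sf1 (field_gen_sub _)).
- move=> y z [l lX yl] [l' l'X zl']; have [h1 h2] := lc l l'; exists (l ++ l').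
    by move=> j /=; rewrite mem_cat => /orP[/lX|/l'X].
  by apply: (sfB (field_gen_sub _)); [exact: field_gen_le yl|exact: field_gen_le zl'].
- move=> y z [l lX yl] [l' l'X zl']; have [h1 h2] := lc l l'; exists (l ++ l').
    by move=> j /=; rewrite mem_cat => /orP[/lX|/l'X].
  by apply: (sf_div (field_gen_sub _)); [exact: field_gen_le yl|exact: field_gen_le zl'].
- move=> i Xi; exists [:: i]; first by move=> j /=; rewrite inE => /eqP->.
  by apply: field_gen_root; rewrite /= inE.
Qed.

(** Otherwise [nth_prime i], times a product of other primes of the sequence and a square, would be
    a square, although its valuation at [nth_prime i] is odd. *)
Lemma root_p_indep i : ~ field_gen (~` [set i]) (root_p i).
Proof.
move=> /field_gen_finite[l li /field_gen_square/(_ (root_pK i))].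
move=> /(_ (prime_gt0 (nth_prime_prime i)))[l' [m [d [sl d0 e]]]].
have pos : (0 < \prod_(j <- l') nth_prime j)%N.
  by rewrite prodn_gt0 // => j; exact/prime_gt0/nth_prime_prime.
have pi := nth_prime_prime i.
have m0 : (0 < m)%N.
  have : (0 < m ^ 2)%N by rewrite -e !muln_gt0 prime_gt0 // pos ?expn_gt0 ?d0.
  by rewrite expn_gt0 orbF.
have pP0 : (0 < nth_prime i * \prod_(j <- l') nth_prime j)%N.
  by rewrite muln_gt0 pos prime_gt0.
have := congr1 (logn (nth_prime i)) e; rewrite -!mulnn !lognM ?muln_gt0 ?d0 ?m0 ?pos ?prime_gt0 //.
rewrite logn_prime // eqxx.
have -> : logn (nth_prime i) (\prod_(j <- l') nth_prime j) = 0%N.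
  elim: l' sl pos {e pP0} => [|j l' IH] sl; first by rewrite big_nil logn1.
  rewrite big_cons muln_gt0 => /andP[p1 p2]; rewrite lognM // IH //; last first.
    by move=> k kl; apply: sl; rewrite inE kl orbT.
  rewrite logn_prime ?nth_prime_prime // addn0.
  case: eqP => // /nth_prime_inj ij; exfalso; apply: (li j) => //=.
  by apply: sl; rewrite mem_head.
by move=> /(congr1 odd); rewrite addn0 !oddD !addbb.
Qed.

Definition mq_pred : {pred algC} := fun x => `[< field_gen setT x >].

Lemma mq_divring_closed : divring_closed mq_pred.
Proof.
have KK := field_gen_sub setT.
split=> [|x y /asboolP hx /asboolP hy|x y /asboolP hx /asboolP hy]; apply/asboolP.
- exact: (sf1 KK).
- exact: (sfB KK).
- exact: (sf_div KK).
Qed.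
HB.instance Definition _ := GRing.isDivringClosed.Build algC mq_pred mq_divring_closed.

Record mq := Mq { mq_val : algC; _ : mq_val \in mq_pred }.
HB.instance Definition _ := [isSub for mq_val].
HB.instance Definition _ := [Choice of mq by <:].
HB.instance Definition _ := [SubChoice_isSubIntegralDomain of mq by <:].
HB.instance Definition _ := [SubIntegralDomain_isSubField of mq by <:].

Lemma mq_valP (x : mq) : field_gen setT (mq_val x).
Proof. by case: x => x /= /asboolP. Qed.

Lemma root_p_mq i : root_p i \in mq_pred.
Proof. by apply/asboolP; exact: field_gen_root. Qed.
Definition mq_root i : mq := Mq (root_p_mq i).

Lemma mq_ind (T : set mq) : T 1 -> (forall x y, T x -> T y -> T (x - y)) ->
  (forall x y, T x -> T y -> T (x / y)) -> (forall i, T (mq_root i)) -> forall x, T x.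
Proof.
move=> T1 TB TD Tr x.
have [y [ey Ty]] : exists y : mq, mq_val y = mq_val x /\ T y.
  pose T' : set algC := [set z | exists y, mq_val y = z /\ T y].
  have xT := mq_valP x; suff : T' (mq_val x) by [].
  apply: (xT T') => [|i _]; last by exists (mq_root i).
  split=> [|_ _ [y [<- Ty]] [z [<- Tz]]|_ _ [y [<- Ty]] [z [<- Tz]]].
  - by exists 1; split=> //; exact: (rmorph1 (\val : mq -> algC)).
  - by exists (y - z); split; [exact: (rmorphB (\val : mq -> algC))|exact: TB].
  - by exists (y / z); split; [exact: (fmorph_div (\val : mq -> algC))|exact: TD].
by have -> : x = y by exact/val_inj/esym.
Qed.

Lemma mq_morph_eq (f g : {rmorphism mq -> mq}) :
  (forall i, f (mq_root i) = g (mq_root i)) -> f =1 g.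
Proof.
move=> fg; apply: mq_ind => [|x y /= ex ey|x y /= ex ey|i] /=.
- by rewrite !rmorph1.
- by rewrite !rmorphB ex ey.
- by rewrite !fmorph_div ex ey.
- exact: fg.
Qed.

(** By [root_p_indep] the field is a proper quadratic extension, with basis [1, r], of the subfield
    generated by the other roots; [s] is its conjugation. *)
Lemma mq_conj_exists i : exists s : {rmorphism mq -> mq},
  s (mq_root i) = - mq_root i /\ forall j, j <> i -> s (mq_root j) = mq_root j.
Proof.
set X := ~` [set i]; have XX := field_gen_sub X; have KK := field_gen_sub setT.
set r := mq_root i.
pose KX := [set x : mq | field_gen X (mq_val x)].
have KX1 : KX 1 by exact: (sf1 XX).
have KX0 : KX 0 by exact: (sf0 XX).
have KXB x y : KX x -> KX y -> KX (x - y) by exact: (sfB XX).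
have KXD x y : KX x -> KX y -> KX (x + y) by exact: (sfD XX).
have KXM x y : KX x -> KX y -> KX (x * y) by exact: (sfM XX).
have KXdiv x y : KX x -> KX y -> KX (x / y).
  move=> hx hy; have e : mq_val (x / y) = mq_val x / mq_val y.
    exact: (fmorph_div (\val : mq -> algC)).
  suff : field_gen X (mq_val (x / y)) by [].
  by rewrite e; exact: (sf_div XX).
have Kr : ~ KX r by exact: root_p_indep.
have KXp : KX (r * r).
  suff : field_gen X (root_p i * root_p i) by [].
  by rewrite root_pK; exact: (sf_nat XX).
have /choice[a ha] x : exists a, KX a /\ exists b, KX b /\ x = a + b * r.
  have : field_gen (X `|` [set i]) (mq_val x).
    by apply: field_gen_le (mq_valP x) => j _; have [->|ji] := pselect (j = i); [right|left].
  move=> /field_gen_adjoin[a [b [Xa Xb e]]].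
  have inK c : field_gen X c -> c \in mq_pred.
    by move=> hc; apply/asboolP; exact: field_gen_le hc.
  exists (Mq (inK _ Xa)); split=> //; exists (Mq (inK _ Xb)); split=> //.
  exact: val_inj.
have /choice[b hb] x : exists b, KX b /\ x = a x + b * r by case: (ha x).
have uniq a1 b1 a2 b2 : KX a1 -> KX b1 -> KX a2 -> KX b2 ->
    a1 + b1 * r = a2 + b2 * r -> a1 = a2 /\ b1 = b2.
  move=> h1 h2 h3 h4 e; have [b12|b12] := eqVneq (b1 - b2) 0.
    have eb : b1 = b2 by apply/eqP; rewrite -subr_eq0 b12.
    by split=> //; move: e; rewrite eb => /addIr.
  case: Kr; have -> : r = (a2 - a1) / (b1 - b2).
    apply: (mulIf b12); rewrite mulfVK //.
    by apply/eqP; rewrite -subr_eq0; apply/eqP; transitivity ((a1 + b1 * r) - (a2 + b2 * r)); [ring|rewrite e subrr].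
  by apply: KXdiv; exact: KXB.
pose s x := a x - b x * r.
have sE u v : KX u -> KX v -> s (u + v * r) = u - v * r.
  move=> hu hv; have [ka _] := ha (u + v * r); have [kb e] := hb (u + v * r).
  by rewrite /s; have [<- <-] := uniq _ _ _ _ hu hv ka kb e.
have [|||F eF] := @rmorphism_exists mq mq s.
- move=> x y; have [kax _] := ha x; have [kbx ex] := hb x.
  have [kay _] := ha y; have [kby ey] := hb y.
  rewrite {1}ex {1}ey; have -> : a x + b x * r - (a y + b y * r) = (a x - a y) + (b x - b y) * r by ring.
  by rewrite sE /s; [ring|exact: KXB|exact: KXB].
- have := sE 1 0 KX1 KX0; by rewrite mul0r addr0 subr0.
- move=> x y; have [kax _] := ha x; have [kbx ex] := hb x.
  have [kay _] := ha y; have [kby ey] := hb y.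
  rewrite {1}ex {1}ey.
  have -> : (a x + b x * r) * (a y + b y * r) =
    (a x * a y + b x * b y * (r * r)) + (a x * b y + b x * a y) * r by ring.
  rewrite sE /s; [by ring|by apply: (KXD _ _); do ?[exact: KXp|apply: (KXM _ _)]|].
  by apply: (KXD _ _); apply: (KXM _ _).
exists F; rewrite eF; split=> [|j ji]; last rewrite eF.
  have := sE 0 1 KX0 KX1; by rewrite mul1r add0r sub0r.
have := sE (mq_root j) 0 _ KX0; rewrite mul0r addr0 subr0; apply.
by apply: field_gen_root => /=.
Qed.

End Multiquadratic.

(** These properties are all that the construction of E takes from the field; the section below is
    stated for any such data. *)
Theorem multiquadratic_field :
  exists (K : fieldType) (s : nat -> {rmorphism K -> K}) (t : nat -> K),
  [/\ forall n, n.+1%:R <> 0 :> K,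
      forall i a, s i (s i a) = a /\ forall j, s i (s j a) = s j (s i a),
      forall a, exists N, forall i, (N <= i)%N -> s i a = a,
      forall i, t i <> 0 /\ s i (t i) = - t i &
      forall i j, j <> i -> s j (t i) = t i].
Proof.
have /choice[s hs] := mq_conj_exists.
have sr i j : s i (mq_root j) = if j == i then - mq_root j else mq_root j.
  by have [h1 h2] := hs i; case: eqP => [->|/h2].
exists mq, s, mq_root; split=> [n|i a|a|i|i j ji].
- move=> /(congr1 mq_val) /eqP; rewrite -[mq_val 0]/(\val (0 : mq)) rmorph0.
  by rewrite -[mq_val _]/(\val (n.+1%:R : mq)) rmorph_nat pnatr_eq0.
- split=> [|j].
    apply: (@mq_morph_eq (s i \o s i) idfun) => j /=; rewrite !sr.
    by case: eqP => [->|/eqP/negPf ji]; rewrite ?rmorphN !sr ?eqxx ?opprK ?ji.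
  apply: (@mq_morph_eq (s i \o s j) (s j \o s i)) => k /=; rewrite !sr.
  by case: ifP => h1; case: ifP => h2; rewrite ?rmorphN !sr ?h1 ?h2.
- move: a; apply: mq_ind => [|x y [N hN] [M hM]|x y [N hN] [M hM]|j].
  + by exists 0%N => i _; rewrite rmorph1.
  + by exists (maxn N M) => i; rewrite geq_max => /andP[h1 h2]; rewrite rmorphB hN ?hM.
  + by exists (maxn N M) => i; rewrite geq_max => /andP[h1 h2]; rewrite fmorph_div hN ?hM.
  + by exists j.+1 => i ji; rewrite sr; case: eqP => // e; rewrite e ltnn in ji.
- split; last by rewrite sr eqxx.
  by move=> /(congr1 mq_val) /eqP; rewrite -[mq_val 0]/(\val (0 : mq)) rmorph0 (negPf (root_p_neq0 i)).
- by rewrite sr; case: eqP => // e; case: ji.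
Qed.

(** * A one-dimensional domain with infinitely many singular points *)

Section SingularRing.
Variables (K : fieldType) (s : nat -> {rmorphism K -> K}) (t : nat -> K).
Hypothesis char0 : forall n, n.+1%:R <> 0 :> K.
Hypothesis sK : forall i a, s i (s i a) = a.
Hypothesis sC : forall i j a, s i (s j a) = s j (s i a).
Hypothesis s_fin : forall a, exists N, forall i, (N <= i)%N -> s i a = a.
Hypothesis t_neq0 : forall i, t i <> 0.
Hypothesis s_t : forall i, s i (t i) = - t i.
Hypothesis s_t' : forall i j, j <> i -> s j (t i) = t i.
Implicit Types (f g p q : {poly K}) (i j : nat).

Local Notation "i %:K" := (i%:R : K) (at level 2, format "i %:K").
Local Notation S i := (map_poly (s i)).

Lemma natK_inj i j : i%:K = j%:K -> i = j.
Proof.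
have lt a b : (a < b)%N -> a%:K <> b%:K.
  move=> ab e; have : (b - a)%:K = 0 by rewrite natrB ?(ltnW ab) // e subrr.
  have : (0 < b - a)%N by rewrite subn_gt0.
  by case: (b - a)%N => // n _ /char0.
by move=> e; case: (ltngtP i j) => // /lt; rewrite e.
Qed.

Lemma two_neq0 : 2%:R != 0 :> K.
Proof. exact/eqP/char0. Qed.

Lemma s_horner i f j : (S i f).[j%:K] = s i f.[j%:K].
Proof. by rewrite -horner_map rmorph_nat. Qed.

Lemma SK i f : S i (S i f) = f.
Proof. by apply/polyP => k; rewrite !coef_map /= sK. Qed.

Lemma SC i j f : S i (S j f) = S j (S i f).
Proof. by apply/polyP => k; rewrite !coef_map /= sC. Qed.

Lemma S_lin i j : S i ('X - (j%:K)%:P) = 'X - (j%:K)%:P.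
Proof. by rewrite rmorphB /= map_polyX map_polyC /= rmorph_nat. Qed.

Lemma S_fin f : exists N, forall i, (N <= i)%N -> S i f = f.
Proof.
elim/poly_ind: f => [|f c [N hN]]; first by exists 0%N => i _; rewrite rmorph0.
have [M hM] := s_fin c; exists (maxn N M) => i; rewrite geq_max => /andP[h1 h2].
by rewrite rmorphD rmorphM /= map_polyX map_polyC /= hN ?hM.
Qed.

Lemma S_neq0 i f : f <> 0 -> S i f <> 0.
Proof. by move=> f0 /(congr1 (S i)); rewrite SK rmorph0. Qed.

Definition sing_pred : {pred {poly K}} :=
  fun f => `[< forall i, s i f.[i%:K] = f.[i%:K] >].

Lemma sing_predP f : f \in sing_pred <-> forall i, s i f.[i%:K] = f.[i%:K].
Proof. by split=> [/asboolP|h]; [|exact/asboolP]. Qed.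

Lemma sing_subring_closed : subring_closed sing_pred.
Proof.
split=> [|f g /sing_predP hf /sing_predP hg|f g /sing_predP hf /sing_predP hg];
  apply/sing_predP => i.
- by rewrite hornerC rmorph1.
- by rewrite hornerD hornerN rmorphB hf hg.
- by rewrite hornerM rmorphM hf hg.
Qed.
HB.instance Definition _ := GRing.isSubringClosed.Build {poly K} sing_pred sing_subring_closed.

Record sing_ring := SingRing { sing_val : {poly K}; sing_valP : sing_val \in sing_pred }.
HB.instance Definition _ := [isSub for sing_val].
HB.instance Definition _ := [Choice of sing_ring by <:].
HB.instance Definition _ := [SubChoice_isSubComNzRing of sing_ring by <:].
Local Notation E := sing_ring.
Local Notation v := (\val : E -> {poly K}).

(** The coefficients are fixed by every [s i], so the condition defining E holds at all integers at
    once, and products, norms and inverses modulo norms can be formed inside this class. *)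
Definition rational f := forall i, S i f = f.

Lemma rational_sing f : rational f -> f \in sing_pred.
Proof. by move=> rf; apply/sing_predP => i; rewrite -s_horner rf. Qed.

Lemma rational_horner f i j : rational f -> s j f.[i%:K] = f.[i%:K].
Proof. by move=> rf; rewrite -s_horner rf. Qed.

Lemma rationalM f g : rational f -> rational g -> rational (f * g).
Proof. by move=> rf rg i; rewrite rmorphM /= rf rg. Qed.

Lemma rational_lin j : rational ('X - (j%:K)%:P).
Proof. by move=> i; exact: S_lin. Qed.

Lemma S_sing i f : f \in sing_pred -> S i f \in sing_pred.
Proof. by move=> /sing_predP hf; apply/sing_predP => j; rewrite s_horner sC hf. Qed.

Lemma sing_domain : domain E.
Proof.
split=> [/(congr1 v)|x y /(congr1 v)]; rewrite ?rmorph1 ?rmorph0 ?rmorphM /=.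
  by move=> /eqP; rewrite oner_eq0.
move=> /eqP; rewrite mulf_eq0 => /orP[/eqP x0|/eqP y0]; [left|right]; exact: val_inj.
Qed.

Lemma sing_eval_exists i : exists rho : {rmorphism E -> K}, forall x, rho x = (v x).[i%:K].
Proof.
apply: rmorphism_exists => [x y||x y].
- by rewrite rmorphB hornerD hornerN.
- by rewrite rmorph1 hornerC.
- by rewrite rmorphM hornerM.
Qed.

Lemma is_ideal_sing_max i : is_ideal [set x : E | (v x).[i%:K] = 0].
Proof.
split=> [|x y /= ex ey|a x /= ex].
- exact: horner0.
- by rewrite hornerD ex ey addr0.
- by rewrite hornerM ex mulr0.
Qed.
Definition sing_max i : ideal E := Ideal (is_ideal_sing_max i).

Lemma sing_max_prime i : is_prime (sing_max i).
Proof.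
have [rho erho] := sing_eval_exists i; have dK : domain K.
  by split=> [/eqP|x y /eqP]; rewrite ?oner_eq0 // mulf_eq0 => /orP[/eqP|/eqP]; [left|right].
have [P1 PM] := preim_prime rho (zero_prime dK).
have e x : sing_max i x <-> preim_ideal rho (zero_ideal K) x by rewrite /= erho.
by split=> [/e//|x y /e/PM[] /e]; [left|right].
Qed.

Lemma sing_max_avoid (x : E) : x <> 0 -> exists i, ~ sing_max i x.
Proof.
move=> x0; apply: contrapT => /forallNP H.
have fx i : root (v x) i%:K by apply/rootP; exact: (contrapT (H i)).
have := @max_poly_roots K (v x) [seq i%:K | i <- iota 0 (size (v x))].
rewrite size_map size_iota ltnn => h; suff : false by []; apply: h.
- by apply/eqP => vx0; apply: x0; apply: val_inj; rewrite rmorph0.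
- by apply/allP => _ /mapP[i _ ->].
- by rewrite map_inj_in_uniq ?iota_uniq // => i j _ _; exact: natK_inj.
Qed.

Definition lin_sing i : E := SingRing (rational_sing (rational_lin i)).

Definition int_prod N : {poly K} := \prod_(0 <= j < N) ('X - (j%:K)%:P).

Lemma rational_int_prod N : rational (int_prod N).
Proof.
move=> i; rewrite /int_prod rmorph_prod; apply: eq_bigr => j _; exact: S_lin.
Qed.

Lemma int_prod_horner N j : (j < N)%N -> (int_prod N).[j%:K] = 0.
Proof.
move=> jN; rewrite /int_prod horner_prod big_mkord (bigD1 (Ordinal jN)) //=.
by rewrite hornerXsubC subrr mul0r.
Qed.

(** The conditions at integers below [N] hold because the product vanishes there, the others because
    [f] is fixed. With [S_fin], every polynomial has a nonzero rational multiple in E. *)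
Lemma int_prod_sing N f : (forall i, (N <= i)%N -> S i f = f) ->
  int_prod N * f \in sing_pred.
Proof.
move=> hN; apply/sing_predP => j; rewrite hornerM rmorphM.
have [Nj|jN] := leqP N j; last by rewrite int_prod_horner // rmorph0 !mul0r.
by rewrite (rational_horner _ _ (rational_int_prod N)) -s_horner hN.
Qed.

(** * Structure of E at the maximal ideal of i *)

Section FixedSubring.
Variable i : nat.

Definition fix_pred : {pred {poly K}} := fun f => (f \in sing_pred) && `[< S i f = f >].

Lemma fix_predP f : f \in fix_pred <-> f \in sing_pred /\ S i f = f.
Proof.
by split=> [/andP[h1 /asboolP h2]|[h1 h2]]; [split|apply/andP; split=> //; exact/asboolP].
Qed.

Lemma fix_subring_closed : subring_closed fix_pred.
Proof.
split=> [|f g /fix_predP[hf sf] /fix_predP[hg sg]|f g /fix_predP[hf sf] /fix_predP[hg sg]];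
  apply/fix_predP.
- by rewrite rmorph1; split=> //; exact: rpred1.
- by rewrite rmorphB /= sf sg; split=> //; exact: rpredB.
- by rewrite rmorphM /= sf sg; split=> //; exact: rpredM.
Qed.
HB.instance Definition _ := GRing.isSubringClosed.Build {poly K} fix_pred fix_subring_closed.

Record fix_ring := FixRing { fix_val : {poly K}; fix_valP : fix_val \in fix_pred }.
HB.instance Definition _ := [isSub for fix_val].
HB.instance Definition _ := [Choice of fix_ring by <:].
HB.instance Definition _ := [SubChoice_isSubComNzRing of fix_ring by <:].
Local Notation W := fix_ring.
Local Notation w := (\val : W -> {poly K}).

(** Lagrange interpolation with value [c] at [i] and 0 at the other integers below [N]. At integers
    from [N] on other than [i] the polynomial is fixed along with [c]. The residue field at [i] is
    thus the whole fixed field of [s i]. *)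
Lemma fix_interp c : s i c = c -> exists x : W, (w x).[i%:K] = c.
Proof.
move=> sc; have [N hN] := s_fin c.
pose g := c%:P * \prod_(0 <= j < N | j != i) (((i%:K - j%:K)^-1)%:P * ('X - (j%:K)%:P)).
have gr k : s k c = c -> S k g = g.
  move=> sk; rewrite rmorphM /= map_polyC /= sk; congr (_ * _).
  rewrite rmorph_prod; apply: eq_bigr => j _.
  by rewrite rmorphM /= S_lin map_polyC /= fmorphV rmorphB !rmorph_nat.
have gE : g \in fix_pred.
  apply/fix_predP; split; last exact: gr.
  apply/sing_predP => k; have [ki|/eqP ki] := eqVneq k i; first by rewrite -s_horner gr // ki.
  have [Nk|kN] := leqP N k; first by rewrite -s_horner gr // hN.
  suff -> : g.[k%:K] = 0 by rewrite rmorph0.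
  rewrite /g hornerM horner_prod big_mkord (bigD1 (Ordinal kN)) /=; last exact/eqP.
  by rewrite hornerM hornerXsubC subrr mulr0 mul0r mulr0.
exists (FixRing gE) => /=; rewrite /g hornerM hornerC horner_prod big1 ?mulr1 // => j ji.
rewrite hornerM hornerC hornerXsubC mulVf // subr_eq0; apply/eqP => /natK_inj e.
by rewrite e eqxx in ji.
Qed.

Lemma lin_fix : 'X - (i%:K)%:P \in fix_pred.
Proof. by apply/fix_predP; split; [exact: rational_sing (rational_lin i)|exact: S_lin]. Qed.
Definition fix_u : W := FixRing lin_fix.

Lemma tt_rational : rational ((t i * t i)%:P).
Proof.
move=> j; rewrite map_polyC /= rmorphM; have [->|/eqP ji] := eqVneq j i.
  by rewrite s_t mulrNN.
by rewrite s_t'.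
Qed.

Lemma tt_fix : (t i * t i)%:P \in fix_pred.
Proof. by apply/fix_predP; split; [exact: rational_sing tt_rational|exact: tt_rational]. Qed.
Definition fix_a : W := FixRing tt_fix.

Lemma is_ideal_fix_max : is_ideal [set x : W | (w x).[i%:K] = 0].
Proof.
split=> [|x y /= ex ey|a x /= ex].
- exact: horner0.
- by rewrite hornerD ex ey addr0.
- by rewrite hornerM ex mulr0.
Qed.
Definition fix_max : ideal W := Ideal is_ideal_fix_max.

(** Dividing by X - i loses the condition at [i], but invariance under [S i] restores it. In E,
    without this invariance, the quotient can leave the ring, which is why the maximal ideal there
    needs a second generator. *)
Lemma fix_maxP x : fix_max x <-> exists y, x = y * fix_u.
Proof.
split=> [/= /eqP/factor_theorem[g eg]|[y ->]]; last first.
  by rewrite /= hornerM hornerXsubC subrr mulr0.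
have u0 : 'X - (i%:K)%:P != 0 by rewrite polyXsubC_eq0.
have [/sing_predP hx Sx] := (fix_predP (w x)).1 (valP x).
have Sg : S i g = g.
  by apply: (mulIf u0); rewrite -eg -Sx /= eg rmorphM /= S_lin.
have gW : g \in fix_pred.
  apply/fix_predP; split=> //; apply/sing_predP => j.
  have [->|/eqP ji] := eqVneq j i; first by rewrite -s_horner Sg.
  have c0 : j%:K - i%:K != 0 by rewrite subr_eq0; apply/eqP => /natK_inj.
  apply: (mulIf c0); have := hx j; rewrite /= eg hornerM hornerXsubC.
  by rewrite rmorphM rmorphB !rmorph_nat.
by exists (FixRing gW); apply: val_inj; rewrite rmorphM /= eg.
Qed.

Lemma fix_max_comaximal : comaximal fix_max.
Proof.
split=> [|x /= x0].
  by rewrite /= hornerC => /eqP; rewrite oner_eq0.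
have [hx Sx] := (fix_predP (w x)).1 (valP x).
have [|y ey] := @fix_interp (fix_val x).[i%:K]^-1.
  by rewrite fmorphV -s_horner Sx.
exists y; rewrite /= in ey *.
by rewrite hornerD hornerN hornerM hornerC ey divff ?subrr //; exact/eqP.
Qed.

Lemma fix_u_nzd x : fix_u * x = 0 -> x = 0.
Proof.
move=> /(congr1 w); rewrite rmorphM rmorph0 => /eqP.
rewrite mulf_eq0 polyXsubC_eq0 /= => /eqP x0; exact: val_inj.
Qed.

Local Notation D := (quad (fix_u ^+ 2 * fix_a)).

Let y : {poly K} := ('X - (i%:K)%:P) * (t i)%:P.

Lemma y_sing f : f \in fix_pred -> f * y \in sing_pred.
Proof.
move=> /fix_predP[/sing_predP hf Sf]; apply/sing_predP => j.
rewrite /y !hornerM hornerXsubC hornerC; have [->|/eqP ji] := eqVneq j i.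
  by rewrite subrr mul0r mulr0 rmorph0.
by rewrite !rmorphM rmorphB !rmorph_nat hf s_t'.
Qed.

Lemma S_y : S i y = - y.
Proof. by rewrite /y rmorphM /= S_lin map_polyC /= s_t rmorphN mulrN. Qed.

Lemma y_neq0 : y != 0.
Proof. by rewrite mulf_neq0 ?polyXsubC_eq0 // polyC_eq0; exact/eqP. Qed.

(** Each element is the sum of its parts invariant and anti-invariant under [S i]. The
    anti-invariant part vanishes at [i], because the value of the element there is fixed by [s i],
    and is therefore an invariant multiple of y. *)
Lemma quad_sing_iso : exists psi : {rmorphism D -> E}, bijective psi /\
  forall x, v (psi x) = w x.1 + w x.2 * y.
Proof.
have inE (x : D) : w x.1 + w x.2 * y \in sing_pred.
  by apply: rpredD; [case: ((fix_predP (w x.1)).1 (valP x.1))|exact: y_sing (valP x.2)].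
pose psi x := SingRing (inE x).
have [|||F eF] := @rmorphism_exists D E psi.
- by move=> x z; apply: val_inj; rewrite rmorphB /=; ring.
- by apply: val_inj; rewrite rmorph1 /=; ring.
- by move=> x z; apply: val_inj; rewrite rmorphM /= /y polyCM; ring.
exists F; split; last by move=> x; rewrite eF.
apply: inj_surj_bij.
  apply: raddf_inj => x /=; rewrite eF => /(congr1 v); rewrite rmorph0 /= => e.
  have [_ S1] := (fix_predP (w x.1)).1 (valP x.1).
  have [_ S2] := (fix_predP (w x.2)).1 (valP x.2).
  have e' : w x.1 - w x.2 * y = 0.
    have := congr1 (S i) e; rewrite rmorph0 rmorphD rmorphM /= S1 S2 S_y.
    by rewrite mulrN.
  have two f : f + f = 0 -> f = 0.
    move=> ff; apply/polyP => k; rewrite coef0; have := congr1 (fun p : {poly K} => p`_k) ff.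
    rewrite coefD coef0 -mulr2n -mulr_natr => /eqP; rewrite mulf_eq0 (negPf two_neq0) orbF.
    by move=> /eqP.
  have x1 : w x.1 = 0.
    apply: two; rewrite -[RHS](addr0 0) -{1}e -e' /=; ring.
  have x2 : w x.2 = 0.
    move: e; rewrite -[fix_val x.1]/(w x.1) x1 add0r => /eqP.
    by rewrite mulf_eq0 (negPf y_neq0) orbF => /eqP.
  by rewrite [x]surjective_pairing; congr pair; exact: val_inj.
move=> x; have /sing_predP hx := valP x.
pose h : K := 2%:R^-1.
have hh : h + h = 1.
  have -> : h + h = h * 2%:R by rewrite mulr_natr mulr2n.
  by rewrite mulVf // two_neq0.
have hS j : s j h = h by rewrite fmorphV rmorph_nat.
pose f1 := h%:P * (v x + S i (v x)); pose f2 := h%:P * (v x - S i (v x)).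
have e12 : v x = f1 + f2.
  have -> : f1 + f2 = (h%:P + h%:P) * v x by rewrite /f1 /f2; ring.
  by rewrite -polyCD hh mul1r.
have ShP j : S j h%:P = h%:P by rewrite map_polyC /= hS.
have f1W : f1 \in fix_pred.
  apply/fix_predP; split; last by rewrite rmorphM /= ShP rmorphD /= SK addrC.
  apply/sing_predP => j; rewrite hornerM hornerC hornerD s_horner rmorphM rmorphD hS.
  by rewrite sC hx.
have Sf2 : S i f2 = - f2 by rewrite rmorphM /= ShP rmorphB /= SK -opprB mulrN.
have f2i : root f2 i%:K.
  by apply/rootP; rewrite hornerM hornerD hornerN s_horner hx subrr mulr0.
have [g eg] := factor_theorem _ _ f2i.
have ti0 : (t i)%:P != 0 by rewrite polyC_eq0; exact/eqP.
pose g' := g * ((t i)^-1)%:P.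
have tV : (t i)^-1 * t i = 1 by rewrite mulVf //; exact/eqP.
have eg' : f2 = g' * y.
  rewrite /g' /y eg; have -> : g * ((t i)^-1)%:P * (('X - (i%:K)%:P) * (t i)%:P) =
     g * ('X - (i%:K)%:P) * (((t i)^-1)%:P * (t i)%:P) by ring.
  by rewrite -polyCM tV mulr1.
(* Both [f2] and y change sign under [S i]. *)
have Sg' : S i g' = g'.
  apply: (mulIf y_neq0); rewrite -eg'; apply: oppr_inj; rewrite -Sf2 eg'.
  have -> : S i (g' * y) = S i g' * S i y by exact: rmorphM.
  by rewrite S_y mulrN.
have f2S : f2 \in sing_pred.
  have -> : f2 = v x - f1 by rewrite e12; ring.
  by apply: rpredB; [exact: valP|case: ((fix_predP f1).1 f1W)].
have g'W : g' \in fix_pred.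
  apply/fix_predP; split=> //; apply/sing_predP => j.
  have [->|/eqP ji] := eqVneq j i; first by rewrite -s_horner Sg'.
  have c0 : j%:K - i%:K != 0 by rewrite subr_eq0; apply/eqP => /natK_inj.
  have d0 : (j%:K - i%:K) * t i != 0 by rewrite mulf_neq0 //; exact/eqP.
  apply: (mulIf d0); move/sing_predP: f2S => /(_ j); rewrite eg' /y !hornerM.
  by rewrite hornerXsubC !hornerC !rmorphM rmorphB !rmorph_nat s_t'.
exists (FixRing f1W, FixRing g'W); rewrite eF; apply: val_inj => /=.
by rewrite -eg' -e12.
Qed.

End FixedSubring.

Lemma sing_max_gens i : exists Y c : E, [/\ sing_max i Y, Y * Y = c * lin_sing i &
  forall f : E, sing_max i f -> exists a b, f = a * lin_sing i + b * Y].
Proof.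
have [psi [[psi' K1 K2] psiE]] := quad_sing_iso i.
have eu : psi (fix_u i, 0) = lin_sing i.
  by apply: val_inj; rewrite psiE /= mul0r addr0.
exists (psi (0, 1)), (psi (fix_u i * fix_a i, 0)); split.
- by rewrite /= psiE /= add0r mul1r hornerM hornerXsubC subrr mul0r.
- rewrite -eu -!rmorphM; congr (psi _).
  by rewrite !quad_mulE /=; congr pair; ring.
- move=> f fi; rewrite -[f]K2; case: (psi' f) (K2 f) => x1 x2 ef.
  have /fix_maxP[z ez] : fix_max i x1.
    move: fi; rewrite -ef /= psiE /= hornerD hornerM [in X in _ + X](hornerM ('X - _)).
    by rewrite hornerXsubC subrr mul0r mulr0 addr0.
  exists (psi (z, 0)), (psi (x2, 0)); rewrite -eu -!rmorphM -rmorphD; congr (psi _).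
  by rewrite !quad_mulE quad_addE /= ez; congr pair; ring.
Qed.

Lemma lin_sing_max i : sing_max i (lin_sing i).
Proof. by rewrite /= hornerXsubC subrr. Qed.

Lemma sing_max_param i (r : ideal E) : is_prime r -> r (lin_sing i) -> sing_max i `<=` r.
Proof.
move=> rp ru; have [Y [c [Yi YY Hg]]] := sing_max_gens i.
have rY : r Y by have : r (Y * Y); [rewrite YY; exact: idealMl|move=> /rp.2[]].
by move=> f /Hg[a [b ->]]; apply: idealD; exact: idealMl.
Qed.

Lemma sing_max_comaximal i : comaximal (sing_max i).
Proof.
split; first by case: (sing_max_prime i).
move=> f /= f0; have /sing_predP hf := valP f.
have [|x ex] := @fix_interp i (sing_val f).[i%:K]^-1; first by rewrite fmorphV hf.
have [xE _] := (fix_predP i _).1 (valP x).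
exists (SingRing xE) => /=; rewrite /= in ex.
by rewrite hornerD hornerN hornerM hornerC ex divff ?subrr //; exact/eqP.
Qed.

Lemma sing_max_fg i : fg (sing_max i).
Proof.
have [Y [c [Yi YY Hg]]] := sing_max_gens i.
exists [:: lin_sing i; Y]; apply/seteqP; split=> f.
  move=> /Hg[a [b ->]]; apply/gen_consP; exists a, (b * Y); split=> //.
  by apply/gen_seq1P; exists b.
apply: gen_min => x; rewrite /= !inE => /orP[/eqP->|/eqP->] //; exact: lin_sing_max.
Qed.

Lemma sing_max_ci i (L : comPzRingType) (phi : {rmorphism E -> L}) c :
  noetherian E -> is_loc (sing_max i) phi -> (1 <= c)%N -> CI_le c L.
Proof.
move=> noeth locL c1; have mp := sing_max_prime i.
have [psi [psib psiE]] := quad_sing_iso i.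
apply: (@CI_le_quad _ _ _ _ (@fix_maxP i) (fix_max_comaximal i) (@fix_u_nzd i) L (phi \o psi)) => //.
- apply: is_loc_iso psib _ locL => x /=; rewrite psiE /= hornerD hornerM.
  by rewrite [in X in _ + X](hornerM ('X - _)) hornerXsubC subrr mul0r mulr0 addr0.
- exact: noetherian_loc locL noeth.
- exact: loc_domain mp locL sing_domain.
Qed.

(** The value at [i] of the derivative maps the cotangent space to K, a plane over the fixed field
    of [s i]; [d0] and [d1] are the coordinates in the basis [1, t i]. They are linear over E
    because residues of elements of E lie in the fixed field. *)
Lemma sing_max_cot i : cot_functionals (sing_max i) 2.
Proof.
have [rho erho] := sing_eval_exists i.
pose h : K := 2%:R^-1.
have hh : h + h = 1.
  have -> : h + h = h * 2%:R by rewrite mulr_natr mulr2n.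
  by rewrite mulVf // two_neq0.
pose d0 (a : K) := h * (a + s i a); pose d1 (a : K) := h * (a - s i a) / t i.
pose D (x : E) := (sing_val x)^`().[i%:K].
have DD x y : D (x + y) = D x + D y by rewrite /D derivD hornerD.
have DM a x : sing_max i x -> D (a * x) = rho a * D x.
  by move=> /= x0; rewrite /D derivM hornerD !hornerM x0 mulr0 add0r erho.
have srho a : s i (rho a) = rho a.
  by rewrite erho; have /sing_predP := valP a; exact.
have YE : ('X - (i%:K)%:P) * (t i)%:P \in sing_pred.
  apply/sing_predP => j; rewrite hornerM hornerXsubC hornerC; have [->|/eqP ji] := eqVneq j i.
    by rewrite subrr mul0r rmorph0.
  by rewrite rmorphM rmorphB !rmorph_nat s_t'.
have ti : t i != 0 by exact/eqP.
exists K, rho, (fun k x => if k == ord0 then d0 (D x) else d1 (D x)),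
  (fun k : 'I_2 => if k == ord0 then lin_sing i else SingRing YE).
split=> [x|k|k x y _ _|k a x x0|k l].
- by rewrite erho.
- case: ifP => _; first exact: lin_sing_max.
  by rewrite /= hornerM hornerXsubC subrr mul0r.
- by case: ifP => _; rewrite DD /d0 /d1 rmorphD; field.
- by case: ifP => _; rewrite DM // /d0 /d1 rmorphM srho; field.
- have Du : D (lin_sing i) = 1 by rewrite /D /= derivXsubC hornerC.
  have DY : D (SingRing YE) = t i.
    by rewrite /D /= derivM derivXsubC derivC mulr0 addr0 mul1r hornerC.
  have [e|l0] := eqVneq l ord0; have [e'|k0] := eqVneq k ord0; rewrite ?e ?e'.
  + by rewrite Du /d0 rmorph1 mulrDr mulr1 hh eqxx.
  + by rewrite Du /d1 rmorph1 subrr mulr0 mul0r (negPf k0).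
  + by rewrite DY /d0 s_t subrr mulr0 eq_sym (negPf l0).
  + rewrite DY /d1 s_t opprK mulrDr -mulrDl hh mul1r divff //.
    case: (unliftP ord0 k) k0 => [k' ->|->]; last by rewrite eqxx.
    case: (unliftP ord0 l) l0 => [l' ->|->]; last by rewrite eqxx.
    by rewrite !ord1 eqxx.
Qed.

(** * The nonzero primes of E other than the m_i *)

Section OtherPrimes.
Variables (Q : ideal E) (x0 : E).
Hypotheses (Qp : is_prime Q) (Qx0 : Q x0) (x0_neq0 : x0 <> 0).
Hypothesis Qlin : forall i, ~ Q (lin_sing i).

Definition inQ f := exists x, Q x /\ v x = f.

(* A norm of [x0]: the product of finitely many conjugates. *)
Lemma prime_norm : exists n, [/\ rational n, n != 0 & inQ n].
Proof.
have [N hN] := S_fin (v x0).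
suff [n [n0 [y [Qy ey]] hn]] : exists n, [/\ n != 0, inQ n &
    forall i, (i < N)%N || (N <= i)%N -> S i n = n].
  by exists n; split=> //; [move=> i; apply: hn; case: ltnP|exists y].
(* Multiplying by the conjugate under [S k] makes the product invariant under [S k] and keeps the
   invariances already obtained. *)
suff H k : exists n, [/\ n != 0, inQ n & forall i, (i < k)%N || (N <= i)%N -> S i n = n].
  exact: H.
elim: k => [|k [n [n0 [y [Qy ey]] hn]]].
  exists (v x0); split=> [||i /hN//]; last by exists x0.
  by apply/eqP => e; apply: x0_neq0; apply: val_inj; rewrite rmorph0.
exists (n * S k n); split.
- by rewrite mulf_neq0 //; apply/eqP; apply: S_neq0; exact/eqP.
- have yE : S k (v y) \in sing_pred := S_sing k (valP y).
  exists (y * SingRing yE); split; first exact: idealMr.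
  by rewrite rmorphM /= -ey.
- move=> i; rewrite ltnS leq_eqVlt -orbA => /orP[/eqP->|h].
    by rewrite rmorphM /= SK mulrC.
  by rewrite rmorphM /= SC (hn i h).
Qed.

(** Linear factors at integers are divided out of the norm one by one. The quotient stays rational,
    hence in E, and stays in [Q] since [Q] is prime and contains no [lin_sing i]. *)
Lemma prime_norm_no_root : exists n, [/\ rational n, inQ n & forall i, n.[i%:K] <> 0].
Proof.
have [n [rn n0 Qn]] := prime_norm.
have [k] := ubnP (size n); elim: k n rn n0 Qn => // k IH n rn n0 Qn; rewrite ltnS => nk.
have [[i ni]|H] := pselect (exists i, n.[i%:K] = 0); last first.
  by exists n; split=> // i ni; apply: H; exists i.
have /factor_theorem[g eg] : root n i%:K by exact/rootP.
have u0 : 'X - (i%:K)%:P != 0 by rewrite polyXsubC_eq0.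
have g0 : g != 0 by apply: contraNneq n0 => g0; rewrite eg g0 mul0r.
have rg : rational g.
  by move=> j; apply: (mulIf u0); rewrite -eg -[RHS](rn j) eg rmorphM /= S_lin.
apply: (IH g) => //; last by apply: leq_trans nk; rewrite eg size_Mmonic ?monicXsubC // size_XsubC addn2 /=.
have [y [Qy ey]] := Qn; exists (SingRing (rational_sing rg)); split=> //.
have : Q (SingRing (rational_sing rg) * lin_sing i).
  by have -> : SingRing (rational_sing rg) * lin_sing i = y by apply: val_inj; rewrite rmorphM ey.
by move=> /Qp.2[//|/Qlin].
Qed.

(** Reduction identifies E modulo N = n^2 with K[X] modulo N, so [Q] corresponds to a principal
    ideal of K[X] containing N, and [q] lifts its generator. The square matters: [n] is a multiple
    of [q] modulo n^2, which gives [n * (1 - n * z) = q * e] and makes [n] a multiple of [q] in the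
    local ring. *)
Lemma other_prime_data : exists q n z e : E, [/\ Q q, Q n,
  forall f : E, Q f -> exists a b, f = a * q + b * (n * n),
  n <> 0 & n * (1 - n * z) = q * e] /\ comaximal Q.
Proof.
have [n [rn [yn [Qyn eyn]] nroot]] := prime_norm_no_root.
pose N := n * n.
have rN : rational N by exact: rationalM.
have n0 : n != 0 by apply/eqP => e; apply: (nroot 0%N); rewrite e horner0.
have N0 : N != 0 by rewrite mulf_neq0.
have Nroot i : N.[i%:K] != 0 by rewrite hornerM mulf_neq0 //; exact/eqP.
(* The values of [N] at the integers are nonzero and fixed, so division by [N] does not leave E:
   multiples of [N] in K[X] that lie in E are multiples of [N] in E. *)
have divE f h : f \in sing_pred -> f = N * h -> h \in sing_pred.
  move=> /sing_predP hf ef; apply/sing_predP => i.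
  apply: (mulfI (Nroot i)); have := hf i; rewrite ef hornerM rmorphM.
  by rewrite (rational_horner _ _ rN).
have QN f h : f \in sing_pred -> f = N * h -> inQ f.
  move=> fE ef; exists (yn * yn * SingRing (divE _ _ fE ef)); split.
    by rewrite -mulrA; exact: idealMr.
  by rewrite rmorphM rmorphM /= -[sing_val yn]/(v yn) eyn ef.
(* As [N] does not vanish at [j], the factor X - j has an inverse modulo [N], found by dividing [N]
   minus its value at [j] by X - j; it is rational like [N]. *)
have lin_inv j : exists a, rational a /\ N %| 1 - ('X - (j%:K)%:P) * a.
  have /factor_theorem[h eh] : root (N - (N.[j%:K])%:P) j%:K.
    by apply/rootP; rewrite hornerD hornerN hornerC subrr.
  have u0 : 'X - (j%:K)%:P != 0 by rewrite polyXsubC_eq0.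
  have rh : rational h.
    move=> i; apply: (mulIf u0); rewrite -eh -{1}(S_lin i) -rmorphM -eh rmorphB /= rN.
    by rewrite map_polyC /= (rational_horner _ _ rN).
  exists (- (N.[j%:K]^-1)%:P * h); split.
    move=> i; rewrite rmorphM rmorphN /= rh map_polyC /= fmorphV.
    by rewrite (rational_horner _ _ rN).
  have -> : 1 - ('X - (j%:K)%:P) * (- (N.[j%:K]^-1)%:P * h) =
      (N.[j%:K]^-1)%:P * N + (1 - (N.[j%:K]^-1)%:P * (N.[j%:K])%:P).
    have -> : (N.[j%:K]^-1)%:P * N = (N.[j%:K]^-1)%:P * (N - (N.[j%:K])%:P + (N.[j%:K])%:P).
      by rewrite subrK.
    by rewrite eh; ring.
  by rewrite -polyCM mulVf // subrr addr0 dvdp_mull.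
have prod_inv M : exists a, rational a /\ N %| 1 - int_prod M * a.
  elim: M => [|M [a [ra Na]]].
    by exists 1; rewrite /int_prod big_geq // mul1r subrr dvdp0; split=> // i; exact: rmorph1.
  have [b [rb Nb]] := lin_inv M; exists (a * b); split; first exact: rationalM.
  have -> : int_prod M.+1 = int_prod M * ('X - (M%:K)%:P) by rewrite /int_prod big_nat_recr.
  have -> : 1 - int_prod M * ('X - (M%:K)%:P) * (a * b) =
    (1 - int_prod M * a) + int_prod M * a * (1 - ('X - (M%:K)%:P) * b) by ring.
  by rewrite dvdp_add // dvdp_mull.
(* [int_prod M * f] is in E for large [M], and multiplying by a rational inverse of [int_prod M]
   modulo [N] restores the class of [f]. *)
have lift f : exists e : E, N %| f - v e.
  have [M hM] := S_fin f; have [a [ra Na]] := prod_inv M.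
  have eE : int_prod M * f * a \in sing_pred.
    by apply: rpredM; [exact: int_prod_sing|exact: rational_sing].
  exists (SingRing eE) => /=; have -> : f - int_prod M * f * a = f * (1 - int_prod M * a) by ring.
  exact: dvdp_mull.
(* The ideal of K[X] that contains [N] and corresponds to [Q]; by [IQ] its trace on E is [Q]. *)
pose I f := exists e : E, Q e /\ N %| f - v e.
have ID f g : I f -> I g -> I (f + g).
  move=> [e [Qe fe]] [e' [Qe' ge]]; exists (e + e'); split; first exact: idealD.
  have -> : f + g - v (e + e') = (f - v e) + (g - v e') by rewrite rmorphD; ring.
  exact: dvdp_add.
have IM f k : I f -> I (k * f).
  move=> [e [Qe fe]]; have [ek hk] := lift k; exists (ek * e); split; first exact: idealMl.
  have -> : k * f - v (ek * e) = k * (f - v e) + (k - v ek) * v e by rewrite rmorphM; ring.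
  by apply: dvdp_add; [exact: dvdp_mull|exact: dvdp_mulr].
have IQ (f : E) : I (v f) <-> Q f.
  split=> [[e [Qe]]|Qf]; last by exists f; rewrite subrr dvdp0.
  move=> /dvdpP[h eh]; rewrite -rmorphB in eh.
  have [|y [Qy ey]] := QN (v (f - e)) h (valP _); first by rewrite eh mulrC.
  have -> : f = (f - e) + e by rewrite subrK.
  by apply: idealD => //; have <- : y = f - e by exact: val_inj.
have IN f : N %| f -> I f.
  by move=> Nf; exists 0; rewrite rmorph0 subr0; split=> //; exact: ideal0.
have [p [Ip p0 pmin]] : exists p, [/\ I p, p != 0 & forall f, I f -> f != 0 -> (size p <= size f)%N].
  have [k hk] : exists k, `[< exists f, [/\ I f, f != 0 & size f = k] >].
    by exists (size N); apply/asboolP; exists N; split=> //; apply: IN; exact: dvdpp.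
  case: (@ex_minnP (fun k => `[< exists f, [/\ I f, f != 0 & size f = k] >]) (ex_intro _ k hk)).
  move=> m /asboolP[p [Ip p0 <-]] hm; exists p; split=> // f If f0.
  by apply: hm; apply/asboolP; exists f.
have Idiv f : I f -> p %| f.
  move=> If; apply: contrapT => pf; have f0 : f %% p != 0 by exact/negP.
  have : I (f %% p).
    have -> : f %% p = f + (- (f %/ p)) * p by rewrite {2}(divp_eq f p); ring.
    by apply: ID => //; exact: IM.
  by move=> /pmin/(_ f0); rewrite leqNgt ltn_modp p0.
have [q [Qq Nq]] := Ip.
have [h eh] : exists h, v q = p - N * h.
  by move: Nq => /dvdpP[h eh]; exists h; rewrite mulrC -eh; ring.
have In : I n by rewrite -eyn; apply/IQ.
have reduce f k : f = p * k -> exists e : E, N %| f - v (q * e).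
  move=> ->; have [e ke] := lift k; exists e.
  rewrite (_ : v (q * e) = v q * v e) // eh.
  have -> : p * k - (p - N * h) * v e = p * (k - v e) + N * (h * v e) by ring.
  by apply: dvdp_add; [exact: dvdp_mull|exact: dvdp_mulr].
have reduceE (f : E) k : v f = p * k -> exists e z : E, f = e * q + z * (yn * yn).
  move=> /reduce[e /dvdpP[z ez]]; rewrite -rmorphB in ez.
  have zE : z \in sing_pred by apply: (divE (v (f - q * e))); [exact: valP|rewrite ez mulrC].
  exists e, (SingRing zE); rewrite -[f](subrK (q * e)) addrC; congr (_ + _); first exact: mulrC.
  by apply: val_inj; rewrite ez; transitivity (z * (v yn * v yn)); [rewrite eyn|].
have /dvdpP[k ek] := Idiv _ In.
have [|e [z ez]] := @reduceE yn k; first by rewrite eyn ek mulrC.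
exists q, yn, z, e; split; first split=> //.
- by move=> f /IQ/Idiv/dvdpP[kf]; rewrite mulrC => /reduceE.
- by move=> yn0; move: n0; rewrite -eyn yn0 rmorph0 eqxx.
- rewrite mulrBr mulr1 {1}ez; ring.
(* Maximality: with p = k' d and d the gcd of [f] and [p], one of the lifts of k' and d lies in [Q].
   A lift of d in [Q] would put [f] in [Q]; otherwise [p] divides k', so d is constant and Bezout
   gives an inverse of [f] modulo [Q]. *)
have [Q1 QM] := Qp; split=> // f nQf.
pose d := gcdp (v f) p.
have /dvdpP[k' ek'] : d %| p by exact: dvdp_gcdr.
have df : d %| v f by exact: dvdp_gcdl.
have [ed hd] := lift d; have [ek2 hk2] := lift k'.
have : I (v (ek2 * ed)).
  have -> : v (ek2 * ed) = p - ((k' - v ek2) * d + v ek2 * (d - v ed)).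
    by rewrite ek' rmorphM; ring.
  apply: ID => //; apply: IN; rewrite dvdpNr dvdp_add //; first exact: dvdp_mulr.
  exact: dvdp_mull.
have Ilift g (eg : E) : N %| g - v eg -> Q eg -> I g by move=> Ng Qg; exists eg.
move=> /IQ/QM[Qk|Qd]; last first.
  case: nQf; apply/IQ; have /dvdpP[l ->] := df; apply: IM; exact: Ilift hd Qd.
have /Idiv/dvdpP[l el] := Ilift _ _ hk2 Qk.
have k'0 : k' != 0 by apply: contraNneq p0 => k0; rewrite ek' k0 mul0r.
have dl : d * l = 1.
  by apply: (mulfI k'0); rewrite mulr1 mulrA -ek' mulrC -el.
have [[a b] /= ab] := Bezoutp (v f) p.
have /dvdpP[w ew] : a * v f + b * p %| 1.
  by rewrite (eqp_dvdl _ ab) -/d; apply/dvdpP; exists l; rewrite mulrC.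
have [y hy] := lift (w * a); exists y; apply/IQ.
have -> : v (1 - f * y) = (w * b) * p + (w * a - v y) * v f.
  rewrite rmorphB rmorph1 rmorphM ew; ring.
apply: ID; first exact: IM.
by apply: IN; exact: dvdp_mulr.
Qed.

End OtherPrimes.

(** A prime containing X - i contains the maximal ideal [sing_max i] by [sing_max_param], hence
    equals it. *)
Lemma prime_cases (Q : ideal E) : is_prime Q ->
  (exists i, Q = sing_max i :> set E) \/ forall i, ~ Q (lin_sing i).
Proof.
move=> Qp; have [[i Qi]|H] := pselect (exists i, Q (lin_sing i)); last first.
  by right=> i Qi; apply: H; exists i.
left; exists i; apply/seteqP; split; last exact: sing_max_param.
move=> f Qf; apply: contrapT => fi; have [_ /(_ f fi)[y my]] := sing_max_comaximal i.
case: (Qp) => Q1 _; apply: Q1; rewrite -(subrK (f * y) 1); apply: idealD; last exact: idealMr.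
exact: sing_max_param my.
Qed.

Lemma sing_noetherian : noetherian E.
Proof.
apply: cohen_noetherian => Q Qp.
have [[i ->]|Ql] := prime_cases Qp; first exact: sing_max_fg.
have [[x [Qx x0]]|H] := pselect (exists x, Q x /\ x <> 0).
  have [q [n [z [e [[Qq Qn Hg _ _] _]]]]] := other_prime_data Qp Qx x0 Ql.
  exists [:: q; n * n]; apply/seteqP; split=> f.
    move=> /Hg[a [b ->]]; apply/gen_consP; exists a, (b * (n * n)); split=> //.
    by apply/gen_seq1P; exists b.
  apply: gen_min => y; rewrite /= !inE => /orP[/eqP->|/eqP->] //; exact: idealMl.
exists [::]; apply/seteqP; split=> y; last by move=> /gen_nilP->; exact: ideal0.
by move=> Qy; apply/gen_nilP; apply: contrapT => y0; apply: H; exists y.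
Qed.

Lemma sing_prime_comaximal (Q : ideal E) x : is_prime Q -> Q x -> x <> 0 -> comaximal Q.
Proof.
move=> Qp Qx xn0; have [[i eQ]|Ql] := prime_cases Qp.
  by rewrite /comaximal eQ; exact: sing_max_comaximal.
by have [q [n [z [e [_ Qc]]]]] := other_prime_data Qp Qx xn0 Ql.
Qed.

Lemma sing_prime_ci (Q : ideal E) x (L : comPzRingType) (phi : {rmorphism E -> L}) c :
  is_prime Q -> Q x -> x <> 0 -> is_loc Q phi -> (1 <= c)%N -> CI_le c L.
Proof.
move=> Qp Qx xn0 locL c1; have [[i eQ]|Ql] := prime_cases Qp.
  apply: (@sing_max_ci i L phi) => //; first exact: sing_noetherian.
  by move: locL; rewrite /is_loc eQ.
have [q [n [z [e [[Qq Qn Hg n0 nz] Qc]]]]] := other_prime_data Qp Qx xn0 Ql.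
have [lu ls lk] := locL; have domL := loc_domain Qp locL sing_domain.
(* [1 - n * z] is outside [Q], hence a unit of [L], and [n * (1 - n * z) = q * e]. The two
   generators [q] and [n * n] of [Q] thus reduce to [q] in [L], which is a discrete valuation
   ring. *)
have [w ew] : exists w, phi n = w * phi q.
  have [|y ey] := lu (1 - n * z).
    by move=> h; case: Qp => Q1 _; apply: Q1; apply: idealBr h _; rewrite opprB addrC subrK; exact: idealMr.
  exists (phi e * y); rewrite -[phi n]mulr1 -ey mulrA -rmorphM nz rmorphM; ring.
have phin0 : phi n <> 0.
  by move=> /lk[s' [Qs' /sing_domain.2[s0|//]]]; apply: Qs'; rewrite s0; exact: ideal0.
apply: (CI_le_dvr (m := loc_max Qp locL) (u := phi q)).
- exact: noetherian_loc locL sing_noetherian.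
- exact: loc_local.
- exact: domL.
- move=> l; split=> [[b [s' [/Hg[a [b' ->]] Qs' el]]]|[y ->]]; last exact/idealMl/loc_maxP.
  have [y ey] := lu s' Qs'.
  exists (y * (phi a + phi b' * phi n * w)).
  rewrite -[l]mul1r -ey mulrAC mulrC el rmorphD !rmorphM {1}ew; ring.
- by move=> q0; apply: phin0; rewrite ew q0 mulr0.
Qed.

End SingularRing.

Theorem theoremA (c : nat) (hc : (1 <= c)%N) : ~ nagata_criterion (CI_le c).
Proof.
have [K [s [t [char0 sKC s_fin st s_t']]]] := multiquadratic_field.
have sK i a : s i (s i a) = a by case: (sKC i a).
have sC i j a : s i (s j a) = s j (s i a) by case: (sKC i a).
have t0 i : t i <> 0 by case: (st i).
have s_t i : s i (t i) = - t i by case: (st i).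
apply: (@not_nagata_criterion (sing_ring s) (sing_max s)) => //.
- exact: (sing_noetherian char0 sK sC s_fin t0 s_t s_t').
- exact: sing_domain.
- exact: (sing_prime_comaximal char0 sK sC s_fin t0 s_t s_t').
- exact: (sing_prime_ci char0 sK sC s_fin t0 s_t s_t').
- exact: sing_max_prime.
- exact: (sing_max_avoid char0).
- by move=> i; apply: (@sing_max_cot K s t).
- move=> i; exists (lin_sing s i); first exact: lin_sing_max.
  by apply: (@sing_max_param K s t).
Qed.
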